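(* Let $G$ be a Lie group of dimension $r$ acting smoothly, freely and regularly on (an open domain of) $M=J^n(X\times U)$, the $n$-th jet bundle with independent variables $\mathbf{x}=(x_1,\dots,x_p)$ and dependent variables $\mathbf{u}=(u^1,\dots,u^q)$, by a prolonged action with $g\cdot x_i=x_i$ for $i=1,\dots,p$. Let $\rho$ be a right moving frame for this action and let $\kappa_1,\dots,\kappa_N$ be generating differential invariants of the action. Let $\int L(\kappa_1,\kappa_2,\dots)\,\mathrm{d}\mathbf{x}$ be a variational problem invariant under $G$, where $L$ is a smooth function of the $\kappa_j$ and finitely many of their derivatives. Introduce a dummy invariant independent variable $\tau$ to effect the variation. Integration by parts then yields $$\frac{\partial}{\partial\tau}\int L(\kappa_1,\kappa_2,\dots)\,\mathrm{d}\mathbf{x}=\int\Big[\sum_{\alpha}\mathsf{E}^\alpha(L)\,I^\alpha_\tau+\mathsf{Div}(P)\Big]\mathrm{d}\mathbf{x},$$ where this defines the $p$-tuple $P=(P_1,\dots,P_p)$, whose components have the form $$P_i=\sum_{\alpha,J} I^\alpha_{\tau J}\,C^\alpha_{i,J},\qquad i=1,\dots,p.$$ Put $\mathcal{C}^\alpha_i=(C^\alpha_{i,J})_J$ (a column vector indexed by the multi-indices $J$). Let $(a_1,\dots,a_r)$ be coordinates of $G$ near the identity $e$, with associated infinitesimal vector fields $\mathbf{v}_1,\dots,\mathbf{v}_r$, let $\mathcal{A}d(g)$ be the matrix of the Adjoint representation of $G$ with respect to these vector fields, and, for $\alpha=1,\dots,q$, let $\Omega^\alpha(I)$ be the invariantised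 matrix of infinitesimals of the prolonged action for the dependent variable $u^\alpha$. Then the $r$ conservation laws obtained via Noether's Theorem (holding on solutions of the Euler--Lagrange system $\mathsf{E}^\alpha(L)=0$, $\alpha=1,\dots,q$) can be written in the form $$\sum_{i=1}^p\frac{D}{Dx_i}\Big(\mathcal{A}d(\rho)^{-1}\boldsymbol{\upsilon}_i(I)\Big)=0,\qquad\text{where}\qquad \boldsymbol{\upsilon}_i(I)=\sum_{\alpha}\Omega^\alpha(I)\,\mathcal{C}^\alpha_i .$$
   Context: Jet notation. Coordinates on $J^n(X\times U)$ are $x_i$, $u^\alpha$ and $u^\alpha_K=\partial^{|K|}u^\alpha/\partial x_1^{k_1}\cdots\partial x_p^{k_p}$, $K=(k_1,\dots,k_p)$, $|K|\le n$. The total derivative is $D_i=\frac{D}{Dx_i}=\frac{\partial}{\partial x_i}+\sum_{\alpha}\sum_K u^\alpha_{Ki}\frac{\partial}{\partial u^\alpha_K}$, and $\mathsf{Div}(P)=\sum_i D_iP_i$. The action of $G$ on jets is the prolonged one (induced by the chain rule); write $\widetilde z=g\cdot z$. Moving frame. The action is assumed free and regular on a domain $\mathcal{U}\subset M$: group orbits meeting $\mathcal{U}$ have dimension $r$ and foliate $\mathcal{U}$; there is a surface $\mathcal{K}\subset\mathcal{U}$ (cross-section) of dimension $\dim M-r$ meeting each orbit transversally in exactly one point; and the group element taking $z\in\mathcal{U}$ to the point of $\mathcal{O}(z)\cap\mathcal{K}$ is unique, where $\mathcal{O}(z)$ is the orbit of $z$. The right moving frame $\rho:\mathcal{U}\to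 G$ is defined by $\rho(z)\cdot z\in\mathcal{K}$. Invariantisation is $I(z)=\rho(z)\cdot z$; $I^\alpha_K=I(u^\alpha_K)=\widetilde{u^\alpha_K}|_{g=\rho(z)}$. Since the $x_i$ are invariant, the invariant differential operators are $\mathcal{D}_i=D/Dx_i$. Generating differential invariants $\kappa_1,\dots,\kappa_N$ are taken to be certain of the $I^\alpha_K$, such that every differential invariant is a function of the $x_i$, the $\kappa_j$ and derivatives of the $\kappa_j$ with respect to the $x_i$. Variation. Introduce an additional independent variable $\tau$, invariant under $G$, and let $u^\alpha=u^\alpha(\mathbf{x},\tau)$; the frame is unchanged (it involves no $\tau$-derivatives). Then $\mathcal{D}_\tau=D/D\tau$ commutes with the $\mathcal{D}_i$. Set $I^\alpha_{\tau J}=I(u^\alpha_{\tau J})=\widetilde{u^\alpha_{\tau J}}|_{g=\rho(z)}$, where $J$ is a (possibly empty) multi-index of differentiation with respect to the $x_i$; $I^\alpha_\tau$ is the case of empty $J$. There are syzygies $\mathcal{D}_\tau\kappa_j=\sum_\alpha\mathcal{H}_{j,\alpha}I^\alpha_\tau$, where the $\mathcal{H}_{j,\alpha}$ are linear differential operators depending only on the $\mathcal{D}_i$, the $\kappa_j$ and their derivatives. The integration by parts is as follows: write $\mathcal{D}_\tau L=\sum_{j,K}\frac{\partial L}{\partial\mathcal{D}_K\kappa_j}\mathcal{D}_K\mathcal{D}_\tau\kappa_j$, integrate by parts to move $\mathcal{D}_K$ off $\mathcal{D}_\tau\kappa_j$, substitute the syzygies, and integrate by parts again to move the operators off $I^\alpha_\tau$.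 This gives $\mathcal{D}_\tau L=\sum_\alpha\mathsf{E}^\alpha(L)I^\alpha_\tau+\sum_iD_iP_i$, with $\mathsf{E}^\alpha(L)=\sum_j\mathcal{H}^*_{j,\alpha}\mathsf{E}^j(L)$ the invariantised Euler--Lagrange expressions, where $\mathcal{H}^*_{j,\alpha}$ is the formal adjoint and $\mathsf{E}^j(L)=\sum_K(-1)^{|K|}\mathcal{D}_K\frac{\partial L}{\partial\mathcal{D}_K\kappa_j}$. The $P_i$ are linear in the $I^\alpha_{\tau J}$ (after rewriting derivatives of $I^\alpha_\tau$ and $\mathcal{D}_\tau$-derivatives of the $\kappa_j$ in terms of the $I^\alpha_{\tau J}$); $C^\alpha_{i,J}$ is the coefficient of $I^\alpha_{\tau J}$ in $P_i$, a differential invariant. Infinitesimals. For each group coordinate $a_j$, the infinitesimal vector field $\mathbf{v}_j$ has component $\zeta^j_z=\frac{\partial\widetilde z}{\partial a_j}\big|_{g=e}$ along each coordinate $z$ of $M$. For each $\alpha$, the matrix of infinitesimals $\Omega^\alpha(z)$ has rows indexed by the group parameters $j=1,\dots,r$ and columns indexed by multi-indices $J$, with entry $\frac{\partial\widetilde{u^\alpha_J}}{\partial a_j}\big|_{g=e}$. $\Omega^\alpha(I)$ is obtained by replacing each coordinate $z$ in the entries by its invariantisation $I(z)$. Adjoint representation. $G$ acts on vector fields on $M$ by $Ad_g(\mathbf{v})(z)=Tg^{-1}\,\mathbf{v}(g\cdot z)$, i.e. if $\mathbf{v}=\sum_j f_j(z)\partial_{z_j}$ then $Ad_g(\mathbf{v})$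 has coefficient vector $\left(\frac{\partial\widetilde z}{\partial z}\right)^{-1}\mathbf{f}(\widetilde z)$. This preserves the span of $\mathbf{v}_1,\dots,\mathbf{v}_r$, and $\mathcal{A}d(g)$ is the $r\times r$ matrix with $Ad_g(\mathbf{v}_i)=\sum_j\mathcal{A}d(g)^i_j\,\mathbf{v}_j$ ($i$ the row index, $j$ the column index). $\mathcal{A}d(\rho)$ is $\mathcal{A}d(g)$ evaluated at $g=\rho(z)$. Noether's conservation laws. The $j$-th conservation law ($j=1,\dots,r$) is $\sum_iD_iP_i=0$, valid on solutions of the Euler--Lagrange system, in which the variation is given by the $j$-th infinitesimal: $u^\alpha_\tau=\frac{\partial\widetilde{u^\alpha}}{\partial a_j}\big|_{g=e}$, and correspondingly $u^\alpha_{\tau J}=\frac{\partial\widetilde{u^\alpha_J}}{\partial a_j}\big|_{g=e}$. The $j$-th row of the vector equation in the claim is the $j$-th conservation law. *)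

(* Defs.v *)
From HB Require Import structures.
From mathcomp Require Import all_boot all_order all_algebra.
From mathcomp Require Import all_classical all_reals all_analysis.

Set Implicit Arguments.
Unset Strict Implicit.
Unset Printing Implicit Defensive.

Import Order.TTheory GRing.Theory Num.Theory.
Import numFieldNormedType.Exports.

Local Open Scope classical_set_scope.
Local Open Scope ring_scope.

(* Smooth functions on [I -> R].  All smooth functions below depend on finitely
   many coordinates, those of a finite set [S] of indices; topological notions
   are therefore those of R^S, pulled back to [I -> R] along the projection.  In
   particular a set that is [open_in S] is a cylinder over an open set of R^S,
   and a function that is [cont_in S] factors through R^S. *)
Section Calculus.
Context {R : realType} {I : choiceType}.
Implicit Types (S : set I) (A : set (I -> R)) (F : (I -> R) -> R).

Definition upd (z : I -> R) (c : I) (t : R) : I -> R :=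
  fun c' => if c' == c then t else z c'.

Definition pder (c : I) F : (I -> R) -> R :=
  fun z => derive1 (fun t : R => F (upd z c t)) (z c).

Definition diff_at F (z w : I -> R) : R :=
  \sum_(c \in [set: I]) pder c F z * w c.

Definition near_in S (eps : R) (z w : I -> R) : Prop :=
  forall c, S c -> `|w c - z c| < eps.

Definition open_in S A : Prop :=
  forall z, A z -> exists2 eps : R, 0 < eps & near_in S eps z `<=` A.

Definition cont_in S A F : Prop :=
  forall z, A z -> forall eps : R, 0 < eps -> exists2 del : R, 0 < del &
    forall w, A w -> near_in S del z w -> `|F w - F z| < eps.

(* C^oo on an open set: every iterated partial derivative exists and is
   continuous. *)
Definition smooth_on S A F : Prop :=
  forall cs : seq I, cont_in S A (foldr pder F cs) /\
    forall (c : I) z, A z ->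
      derivable (fun t : R => foldr pder F cs (upd z c t)) (z c) 1.

End Calculus.

(* Lie groups of dimension r, with a countable atlas (so that the manifold is
   second countable). *)
Record chart (R : realType) (r : nat) (T : Type) := Chart {
  cdom : set T;
  cmap : T -> 'I_r -> R;
  cinv : ('I_r -> R) -> T }.

Definition cimg (R : realType) r T (a : chart R r T) : set ('I_r -> R) :=
  cmap a @` cdom a.

Definition smooth_to (R : realType) (r : nat) (T : Type) (atlas : nat -> chart R r T)
    (I : choiceType) (S : set I) (A : set (I -> R)) (f : (I -> R) -> T) : Prop :=
  forall k, let A' := A `&` f @^-1` cdom (atlas k) in
    open_in S A' /\ forall j, smooth_on S A' (fun z => cmap (atlas k) (f z) j).

Definition chart_open (R : realType) r T (atlas : nat -> chart R r T) (V : set T) :=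
  forall k, open_in [set: 'I_r] (cmap (atlas k) @` (cdom (atlas k) `&` V)).

Record lieGroup (R : realType) (r : nat) := LieGroup {
  lg_sort :> groupType;
  atlas : nat -> chart R r lg_sort;
  lg_cover : forall g, exists k, cdom (atlas k) g;
  lg_chartK : forall k g, cdom (atlas k) g -> cinv (atlas k) (cmap (atlas k) g) = g;
  lg_compat : forall k, smooth_to atlas [set: 'I_r] (cimg (atlas k)) (cinv (atlas k));
  lg_hausdorff : forall g h, g <> h -> exists V W : set lg_sort,
    [/\ chart_open atlas V, chart_open atlas W, V g, W h & V `&` W = set0];
  lg_mul : forall k l, smooth_to atlas [set: 'I_r + 'I_r]
    [set s : 'I_r + 'I_r -> R | cimg (atlas k) (s \o inl) /\ cimg (atlas l) (s \o inr)]
    (fun s => cinv (atlas k) (s \o inl) * cinv (atlas l) (s \o inr))%g;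
  lg_inv : forall k, smooth_to atlas [set: 'I_r] (cimg (atlas k))
    (fun s => (cinv (atlas k) s)^-1%g) }.

(* Jets.  The independent variables are indexed by a finite type X, which is
   ['I_p] or, once tau has been added, [option 'I_p] with tau = None.  A point
   of [jet R X q] carries coordinates of all orders; objects living on the n-th
   jet space are those that only involve the coordinates in [ord_le n]. *)
Section Jets.
Context {R : realType} {X : finType} {q : nat}.

Definition mi := {ffun X -> nat}.
Definition msize (K : mi) : nat := (\sum_i K i)%N.
Definition mi0 : mi := [ffun=> 0%N].
Definition mi_succ (K : mi) (i : X) : mi := [ffun j => (K j + (j == i))%N].

Definition coord := (X + 'I_q * mi)%type.
Definition ord_le (m : nat) : set coord :=
  [set c | if c is inr k then (msize k.2 <= m)%N else true].

Definition jet := coord -> R.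

(* D_i; the sum is finite on functions of finite order *)
Definition tder (i : X) (F : jet -> R) : jet -> R := fun z =>
  pder (inl i) F z +
  \sum_(k \in [set: 'I_q * mi]) z (inr (k.1, mi_succ k.2 i)) * pder (inr k) F z.

(* D_K, for commuting operators D_i *)
Definition iterd (T : Type) (D : X -> (T -> R) -> T -> R) (K : mi) (F : T -> R) :
  T -> R := foldr (fun i => iter (K i) (D i)) F (enum X).

(* Prolongation of u |-> f(x, u).  The x_i being invariant, the operators of
   differentiation with respect to the transformed x_i are the D_i. *)
Definition prol (f : 'I_q -> jet -> R) (z : jet) : jet := fun c =>
  match c with
  | inl i => z (inl i)
  | inr (al, K) => iterd tder K (f al) z
  end.

(* the jet at y of the section u *)
Definition jsec (u : 'I_q -> (X -> R) -> R) (y : X -> R) : jet := fun c =>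
  match c with
  | inl i => y i
  | inr (al, K) => iterd pder K (u al) y
  end.

End Jets.
Arguments mi X : clear implicits.
Arguments coord X q : clear implicits.
Arguments jet R X q : clear implicits.

Section Tau.
Context {R : realType} {p q : nat}.

Definition xmi (k : nat) (J : mi 'I_p) : mi (option 'I_p) :=
  [ffun o => if o is Some i then J i else k].

Definition res (z : jet R (option 'I_p) q) : jet R 'I_p q := fun c =>
  match c with
  | inl i => z (inl (Some i))
  | inr (al, J) => z (inr (al, xmi 0 J))
  end.

Definition base (z : jet R 'I_p q) : 'I_p + 'I_q -> R := fun c =>
  match c with
  | inl i => z (inl i)
  | inr al => z (inr (al, mi0))
  end.

Definition xtau (x : 'I_p -> R) (tau : R) : option 'I_p -> R :=
  fun o => if o is Some i then x i else tau.

(* integral over the box prod_i [a_i, b_i], as an iterated Lebesgue integral *)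
Definition box_int (a b : 'I_p -> R) (F : ('I_p -> R) -> R) : R :=
  foldr (fun i (Gi : ('I_p -> R) -> R) x =>
           Rintegral lebesgue_measure `[a i, b i] (fun t : R => Gi (upd x i t)))
        F (enum 'I_p) (fun=> 0).

End Tau.

(* A smooth left action g . (x, u) = (x, act g (x, u)) on an open domain of
   X x U. *)
Definition base_act (R : realType) (p q : nat) (T : Type)
    (act : T -> ('I_p + 'I_q -> R) -> 'I_q -> R) (g : T) (y : 'I_p + 'I_q -> R) :
    'I_p + 'I_q -> R :=
  fun c => match c with inl i => y (inl i) | inr al => act g y al end.

Record smooth_action (R : realType) (r : nat) (G : lieGroup R r) (p q : nat) :=
  SmoothAction {
  adom : set ('I_p + 'I_q -> R);
  act : G -> ('I_p + 'I_q -> R) -> 'I_q -> R;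
  act_open : open_in setT adom;
  act_dom : forall g y, adom y -> adom (base_act act g y);
  act_1 : forall y, adom y -> base_act act 1%g y = y;
  act_M : forall g h y, adom y ->
    base_act act (g * h)%g y = base_act act g (base_act act h y);
  act_smooth : forall k al, smooth_on [set: 'I_r + ('I_p + 'I_q)]
    [set s : 'I_r + ('I_p + 'I_q) -> R | cimg (atlas G k) (s \o inl) /\ adom (s \o inr)]
    (fun s => act (cinv (atlas G k) (s \o inl)) (s \o inr) al) }.

Section Frame.
Context {R : realType} {r p q : nat} {G : lieGroup R r}.
Variables (A : smooth_action G p q).
Local Notation J := (jet R 'I_p q).
Local Notation Jtau := (jet R (option 'I_p) q).

(* prolonged actions, without and with tau *)
Definition pact (g : G) : J -> J := prol (fun al z => act A g (base z) al).
Definition pact_tau (g : G) : Jtau -> Jtau :=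
  prol (fun al z => act A g (base (res z)) al).

(* Infinitesimals, for the coordinates of G given by the [e]-th chart. *)
Variable e : nat.

Definition zeta (j : 'I_r) (z : J) (c : coord 'I_p q) : R :=
  pder j (fun s => pact (cinv (atlas G e) s) z c) (cmap (atlas G e) 1%g).

Variables (n : nat) (U : set J).

Definition free_on : Prop := forall g z, U z ->
  (forall c, ord_le n c -> pact g z c = z c) -> g = 1%g.

(* The tangent space at z to the orbit of z in the n-th jet space is spanned by
   the vectors [zeta j z], so the orbit has dimension r = dim G exactly when
   these are linearly independent. *)
Definition orbits_dim : Prop := forall z, U z -> forall b : 'I_r -> R,
  (forall c, ord_le n c -> \sum_j b j * zeta j z c = 0) -> forall j, b j = 0.

Definition cross_section (K : set J) : Prop :=
  [/\ K `<=` U,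
      (* submanifold of codimension r, locally {psi = 0}, transverse to orbits *)
      forall z, K z -> exists (V : set J) (psi : 'I_r -> J -> R),
        [/\ open_in (ord_le n) V /\ V z,
            forall k, smooth_on (ord_le n) V (psi k),
            forall w, V w -> K w <-> (forall k, psi k w = 0),
            forall b : 'I_r -> R,
              (forall c, \sum_k b k * pder c (psi k) z = 0) -> forall k, b k = 0 &
            forall w : J, exists b : 'I_r -> R, forall k,
              diff_at (psi k) z (fun c => w c - \sum_j b j * zeta j z c) = 0],
      forall z, U z -> exists g, K (pact g z) &
      forall z g h, U z -> K (pact g z) -> K (pact h z) ->
        forall c, ord_le n c -> pact g z c = pact h z c].

(* A moving frame is a smooth map; for a cross-section as above the smoothness of
   the map defined by the first two clauses follows from the implicit function
   theorem. *)
Definition right_moving_frame (K : set J) (rho : J -> G) : Prop :=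
  [/\ forall z, U z -> K (pact (rho z) z),
      forall z g, U z -> K (pact g z) -> g = rho z &
      smooth_to (atlas G) (ord_le n) U rho].

(* differential invariants, of any finite order *)
Definition diff_invariant (F : J -> R) : Prop :=
  (exists m, smooth_on (ord_le m) U F) /\
  forall g z, U z -> U (pact g z) -> F (pact g z) = F z.

Variable rho : J -> G.

Definition inv_jet (z : J) : J := pact (rho z) z.

Definition kappa (N : nat) (idx : 'I_N -> 'I_q * mi 'I_p) (j : 'I_N) (z : J) : R :=
  inv_jet z (inr (idx j)).

(* I^al_{tau K} *)
Definition Itau (al : 'I_q) (K : mi 'I_p) (z : Jtau) : R :=
  pact_tau (rho (res z)) z (inr (al, xmi 1 K)).

Definition tangent_act (g : G) (z : J) (v : J) : J :=
  fun c => diff_at (fun w => pact g w c) z v.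

(* Ad_g(v_i)(z) = T g^{-1} v_i(g . z) = sum_j Ad(g)^i_j v_j(z) *)
Definition adjoint_matrix (Ad : G -> 'M[R]_r) : Prop :=
  forall g z i c, adom A (base z) -> ord_le n c ->
    tangent_act g^-1%g (pact g z) (zeta i (pact g z)) c =
    \sum_j Ad g i j * zeta j z c.

(* The tau-jet over z of the variation by the j-th infinitesimal,
   u^al_{tau K} = zeta^j_{al,K}.  The quantities evaluated at it are of order at
   most one in tau and do not involve tau itself, so that the coordinates set
   to 0 are irrelevant. *)
Definition var_jet (j : 'I_r) (z : J) : Jtau := fun c =>
  match c with
  | inl (Some i) => z (inl i)
  | inl None => 0
  | inr (al, K) =>
      let K' : mi 'I_p := [ffun i => K (Some i)] in
      match K None with
      | 0%N => z (inr (al, K'))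
      | 1%N => zeta j z (inr (al, K'))
      | _ => 0
      end
  end.

Section Lagrangian.
Context {N : nat}.
Variable kap : 'I_N -> J -> R.

(* x and all the D_K kappa_j, arranged as a jet with N dependent variables *)
Definition kjet (z : J) : jet R 'I_p N := fun c =>
  match c with
  | inl i => z (inl i)
  | inr (j, K) => iterd tder K (kap j) z
  end.

Definition generating : Prop := forall F, diff_invariant F ->
  exists (m : nat) (Phi : jet R 'I_p N -> R),
    (forall k k', (forall c, ord_le m c -> k c = k' c) -> Phi k = Phi k') /\
    forall z, U z -> F z = Phi (kjet z).

(* D_tau kappa_j = sum_al H_{j,al} I^al_tau, where H_{j,al} = sum_K h_{j,al,K} D_K
   has finite order and differential invariants as coefficients. *)
Definition syzygies (h : 'I_N -> 'I_q -> mi 'I_p -> J -> R) : Prop :=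
  [/\ forall j al K, diff_invariant (h j al K),
      exists m, forall j al K z, (m < msize K)%N -> h j al K z = 0 &
      forall j z, U (res z) ->
        tder None (kap j \o res) z =
        \sum_al \sum_(K \in [set: mi 'I_p])
          h j al K (res z) * iterd tder (xmi 0 K) (Itau al mi0) z].

(* L is a smooth function, on an open set containing all the values taken, of
   the D_K kappa_j with |K| <= m. *)
Definition lagrangian (L : jet R 'I_p N -> R) : Prop :=
  exists (m : nat) (V : set (jet R 'I_p N)),
    let S := [set c | if c is inr k then (msize k.2 <= m)%N else false] in
    [/\ open_in S V, smooth_on S V L & forall z, U z -> V (kjet z)].

Variables (h : 'I_N -> 'I_q -> mi 'I_p -> J -> R) (L : jet R 'I_p N -> R).

(* E^j(L) *)
Definition euler_kap (j : 'I_N) (z : J) : R :=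
  \sum_(K \in [set: mi 'I_p])
    (-1) ^+ msize K * iterd tder K (fun w => pder (inr (j, K)) L (kjet w)) z.

(* E^al(L) = sum_j H_{j,al}^* E^j(L) *)
Definition euler (al : 'I_q) (z : J) : R :=
  \sum_j \sum_(K \in [set: mi 'I_p])
    (-1) ^+ msize K * iterd tder K (fun w => h j al K w * euler_kap j w) z.

(* C^al_{i,K} is [C i al K]. *)
Variable C : 'I_p -> 'I_q -> mi 'I_p -> J -> R.

Definition Pdiv (i : 'I_p) (z : Jtau) : R :=
  \sum_al \sum_(K \in [set: mi 'I_p]) Itau al K z * C i al K (res z).

Definition by_parts : Prop :=
  [/\ forall i al K, diff_invariant (C i al K),
      exists m, forall i al K z, (m < msize K)%N -> C i al K z = 0 &
      forall z, U (res z) ->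
        tder None (L \o kjet \o res) z =
        \sum_al euler al (res z) * Itau al mi0 z + \sum_i tder (Some i) (Pdiv i) z].

(* d/dtau int L dx = int [sum_al E^al(L) I^al_tau + Div P] dx over boxes, along a
   family u(x, tau) *)
Definition variation_formula : Prop :=
  forall (W : set (option 'I_p -> R)) (u : 'I_q -> (option 'I_p -> R) -> R)
    (a b : 'I_p -> R) (tau0 eps : R),
  open_in setT W -> (forall al, smooth_on setT W (u al)) ->
  (forall y, W y -> U (res (jsec u y))) ->
  0 < eps -> (forall i, a i <= b i) ->
  (forall x tau, (forall i, a i <= x i <= b i) -> `|tau - tau0| < eps ->
     W (xtau x tau)) ->
  is_derive tau0 (1 : R)
    (fun tau : R => box_int a b (fun x => L (kjet (res (jsec u (xtau x tau))))))
    (box_int a b (fun x => let z := jsec u (xtau x tau0) in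
       \sum_al euler al (res z) * Itau al mi0 z + \sum_i tder (Some i) (Pdiv i) z)).

(* upsilon_i(I) = sum_al Omega^al(I) C^al_i, where Omega^al(z) has the entries
   zeta^j_{al,K}(z) *)
Definition upsilon (i : 'I_p) (z : J) : 'cV[R]_r :=
  \col_j \sum_al \sum_(K \in [set: mi 'I_p])
    zeta j (inv_jet z) (inr (al, K)) * C i al K z.

End Lagrangian.
End Frame.

(* Main.v *)
Require Import Defs.
From mathcomp Require Import all_boot all_order all_algebra.
From mathcomp Require Import all_classical all_reals all_analysis.
From mathcomp Require Import ring.

(* Derivations along vector fields -- total derivatives, infinitesimals, the
   derivative in tau -- are all written [diff_at F z (v z)], and their commutation
   relations come from one formula for the commutator of two vector fields, i.e.
   from the symmetry of second derivatives.  In particular the prolonged action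
   and the infinitesimals commute with the [D_i].

   Hence the Adjoint relation propagates from order 0 to all orders, by applying
   the [D_K].  At [g = rho z], where the infinitesimals at [g . z] are linearly
   independent, [Ad g] is invertible and the relation says that
   [T_g v_j (z) = sum_l (Ad g)^-1_jl v_l (g . z)].  The left-hand side lists the
   values of the [I_{tau K}] on the variation by the j-th infinitesimal, so that
   [P_i] becomes the j-th row of [Ad(rho)^-1 Omega(I) C_i].  The divergence of P
   vanishes on solutions because the Lagrangian is invariant, so that its
   derivative along an infinitesimal is 0.

   Integration by parts produces [P_i] that are linear in the tau-derivatives and
   invariant under the prolonged action with tau.  Such a function is a combination
   of the [I_{tau K}], the coefficients being its values on the tau-jets whose
   [I_tau]-coordinates form the standard basis; invariance of the function is
   then invariance of the coefficients. *)

Set Implicit Arguments.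
Unset Strict Implicit.
Unset Printing Implicit Defensive.

Import Order.TTheory GRing.Theory Num.Theory.
Import numFieldNormedType.Exports.

Local Open Scope classical_set_scope.
Local Open Scope ring_scope.

(* [coord] would otherwise be the coordinate function of [vector]. *)
Local Notation coord := Defs.coord.

(** * Locality and one-variable calculus *)

(** A jet has infinitely many coordinates, and smoothness is given only as continuity of partial
    derivatives in finite blocks of them, so there is no normed space to differentiate in. The total
    differential is therefore rebuilt from partial derivatives, as a sum that is finite for each
    function. Every [D_i] may enlarge the block, which is why the working notion [fsm] hides it.

    The second obstacle is the frame: [rho] takes values in a group known only through charts, so
    [rho z] can be inserted into the action only locally, and different charts may produce different
    blocks. They are made uniform by a bound on the order: the component [K] of the prolonged action
    never looks beyond order [|K|].

    Since the [x_i] do not move, prolongation has no correction terms: transformed derivatives are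
    [D_K] of the transformed [u], and infinitesimals obey [zeta_{Ki} = D_i zeta_K]. Finally, the
    identity in [by_parts] is pointwise on tau-jets, so it can be evaluated on a jet built by hand
    from the infinitesimals, without exhibiting a family of sections. *)

Lemma sum_fsT (R : realType) (I : choiceType) (s : seq I) (f : I -> R) :
  uniq s -> (forall c, c \notin s -> f c = 0) ->
  \sum_(c \in [set: I]) f c = \sum_(c <- s) f c.
Proof.
move=> us f0; rewrite (@fsbigE _ _ _ _ [set: I] s) //; last by move=> i _; exact: f0.
by under eq_bigl do rewrite in_setT.
Qed.

Section Locality.
Context {R : realType} {I : choiceType}.
Implicit Types (S : set I) (A : set (I -> R)) (F G : (I -> R) -> R) (z w : I -> R).

Lemma upd_id z c : upd z c (z c) = z.
Proof. by apply/funext => d; rewrite /upd; case: eqP => // ->. Qed.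

Lemma upd_eq z c (t : R) : upd z c t c = t.
Proof. by rewrite /upd eqxx. Qed.

Lemma upd_neq z c (t : R) d : d != c -> upd z c t d = z d.
Proof. by rewrite /upd => /negbTE ->. Qed.

Lemma upd_upd z c (s t : R) : upd (upd z c s) c t = upd z c t.
Proof. by apply/funext => d; rewrite /upd; case: eqP. Qed.

Lemma updC z c d (s t : R) : c != d -> upd (upd z c s) d t = upd (upd z d t) c s.
Proof.
move=> cd; apply/funext => x; rewrite /upd; case: eqP => // ->.
by rewrite eq_sym (negbTE cd).
Qed.

Lemma near_in_refl S (e : R) z : 0 < e -> near_in S e z z.
Proof. by move=> e0 c _; rewrite subrr normr0. Qed.

Lemma near_in_upd S (e : R) z c t : 0 < e -> `|t - z c| < e ->
  near_in S e z (upd z c t).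
Proof. by move=> e0 te d _; rewrite /upd; case: eqP => [->|]; rewrite // subrr normr0. Qed.

Lemma near_in_agree S (e : R) z w : 0 < e -> (forall c, S c -> z c = w c) ->
  near_in S e z w.
Proof. by move=> e0 zw c Sc; rewrite zw // subrr normr0. Qed.

Lemma near_in_sub S S' (e e' : R) z : S `<=` S' -> e' <= e ->
  near_in S' e' z `<=` near_in S e z.
Proof. by move=> SS ee w wz c Sc; apply: lt_le_trans ee; apply: wz; exact: SS. Qed.

Lemma open_in_sub S S' A : S `<=` S' -> open_in S A -> open_in S' A.
Proof.
move=> SS oA z Az; have [e e0 eA] := oA z Az; exists e => //.
by apply: subset_trans eA; apply: near_in_sub.
Qed.

Lemma open_inI S A B : open_in S A -> open_in S B -> open_in S (A `&` B).
Proof.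
move=> oA oB z [Az Bz]; have [e e0 eA] := oA z Az; have [d d0 dB] := oB z Bz.
exists (Num.min e d); first by rewrite lt_min e0.
move=> w wz; split; [apply: eA|apply: dB]; apply: near_in_sub wz => //.
  by rewrite ge_min lexx.
by rewrite ge_min lexx orbT.
Qed.

Lemma open_in_agree S A z w : open_in S A -> A z -> (forall c, S c -> z c = w c) -> A w.
Proof. by move=> oA Az zw; have [e e0] := oA z Az; apply; exact: near_in_agree. Qed.

Lemma open_upd S A z c : open_in S A -> A z -> \forall t \near z c, A (upd z c t).
Proof.
move=> oA Az; have [e e0 eA] := oA z Az; exists e => // t /= te.
by apply/eA/near_in_upd => //; rewrite distrC.
Qed.

Lemma derivable_near (f g : R -> R) t : (\forall s \near t, f s = g s) ->
  derivable f t 1 -> derivable g t 1.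
Proof. exact: near_eq_derivable. Qed.

Lemma derive1_near (f g : R -> R) t : (\forall s \near t, f s = g s) ->
  derive1 f t = derive1 g t.
Proof. by move=> fg; rewrite !derive1E; exact: near_eq_derive. Qed.

Lemma pder_ext S A F G c z : open_in S A -> {in A, F =1 G} -> A z ->
  pder c F z = pder c G z.
Proof.
move=> oA FG Az; apply: derive1_near; apply: filterS (open_upd c oA Az) => t At.
by apply: FG; rewrite inE.
Qed.

Lemma pder_local F c z w : z c = w c ->
  (\forall t \near z c, F (upd z c t) = F (upd w c t)) -> pder c F z = pder c F w.
Proof. by move=> zw H; rewrite /pder -zw; exact: derive1_near. Qed.

Lemma pder_const F c z : (forall t, F (upd z c t) = F z) -> pder c F z = 0.
Proof.
by move=> Fc; rewrite /pder (_ : (fun t => _) = cst (F z)) ?derive1_cst //; exact/funext.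
Qed.

Lemma pder_agree S S' A F c z : open_in S' A -> A z -> 
  (forall w, A w -> (forall d, S d -> z d = w d) -> F w = F z) -> ~ S c -> pder c F z = 0.
Proof.
move=> oA Az FS Sc; rewrite /pder -[RHS](derive1_cst (F z) (z c)).
apply: derive1_near; apply: filterS (open_upd c oA Az) => t At.
by apply: FS => // d Sd; rewrite upd_neq //; apply: contra_not_neq Sc => <-.
Qed.

End Locality.

Section RealFunctions.
Context {R : realType}.
Implicit Types (f df : R -> R) (t x y l : R).

(** The form symmetric in [x] and [y] spares later proofs a case split on their order. All that is
    retained about the intermediate point is its distance to [x], which is what the estimates
    use. *)
Lemma mean_value f df x y :
  (forall t, `|t - x| <= `|y - x| -> is_derive t 1 f (df t)) ->
  exists2 t, `|t - x| <= `|y - x| & f y - f x = df t * (y - x).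
Proof.
move=> fd; have [xy|yx] := leP x y.
  have b t : t \in `[x, y] -> `|t - x| <= `|y - x|.
    by rewrite in_itv /= => /andP[xt ty]; rewrite !ger0_norm ?subr_ge0 // lerD2r.
  have [t txy e] := @MVT_segment R f df x y xy
    (fun t tI => fd t (b t (subset_itv_oo_cc tI)))
    (derivable_within_continuous (fun t tI => @ex_derive _ _ _ _ _ _ _ (fd t (b t tI)))).
  by exists t => //; exact: b.
have b t : t \in `[y, x] -> `|t - x| <= `|y - x|.
  rewrite in_itv /= => /andP[xt ty].
  by rewrite !ler0_norm ?subr_le0 ?(ltW yx) // lerN2 lerD2r.
have [t txy e] := @MVT_segment R f df y x (ltW yx)
  (fun t tI => fd t (b t (subset_itv_oo_cc tI)))
  (derivable_within_continuous (fun t tI => @ex_derive _ _ _ _ _ _ _ (fd t (b t tI)))).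
by exists t; [exact: b|rewrite -opprB e -mulrN opprB].
Qed.

(** The bound without a quotient needs no exclusion of [s = t], and such bounds can be added over
    finitely many coordinates. *)
Lemma is_derive_epsP f t l : is_derive t 1 f l <->
  forall e : R, 0 < e -> exists2 d : R, 0 < d &
    forall s, `|s - t| < d -> `|f s - f t - l * (s - t)| <= e * `|s - t|.
Proof.
split=> [[fd fl] e e0|fe].
  have /cvgrPdist_le /(_ e e0) : h^-1 *: ((f \o shift t) (h *: 1) - f t) @[h --> 0^'] --> l.
    by rewrite -fl; exact: fd.
  case=> d /= d0 de; exists d => // s sd.
  have [->|st] := eqVneq s t; first by rewrite !subrr mulr0 subr0 normr0 mulr0.
  have := de (s - t); rewrite /ball_ /= sub0r normrN subr_eq0 => /(_ sd st).
  rewrite /= (_ : _ *: 1 = s - t) ?subrK => [H|]; last exact: mulr1.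
  have -> : f s - f t - l * (s - t) = - ((l - (s - t)^-1 * (f s - f t)) * (s - t)).
    by rewrite mulrBl mulrAC mulVf ?subr_eq0 // mul1r opprB.
  by rewrite normrN normrM ler_wpM2r.
have H : h^-1 *: ((f \o shift t) (h *: 1) - f t) @[h --> 0^'] --> l.
  apply/cvgrPdist_le => e e0; have [d d0 de] := fe e e0; exists d => //= h.
  rewrite /ball_ /= sub0r normrN => hd h0.
  have := de (h + t); rewrite addrK => /(_ hd) H.
  have -> : h *: (1 : R) = h by exact: mulr1.
  rewrite /= distrC -(ler_pM2r (_ : 0 < `|h|)) ?normr_gt0 // -normrM.
  by rewrite mulrBl mulrAC mulVf // mul1r.
by split; [apply/cvg_ex; exists l|exact: cvg_lim].
Qed.

End RealFunctions.

(** * Classes C^k and smoothness in a given set of coordinates *)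

Section Smooth.
Context {R : realType} {I : choiceType}.
Implicit Types (S : set I) (A : set (I -> R)) (F G : (I -> R) -> R) (z w : I -> R).

Lemma pder_is_derive F c z l :
  is_derive (z c) 1 (fun t => F (upd z c t)) l -> pder c F z = l.
Proof. by move=> H; rewrite /pder derive1E; exact: derive_val. Qed.

Lemma derivable_pder F c z : derivable (fun t => F (upd z c t)) (z c) 1 ->
  is_derive (z c) 1 (fun t => F (upd z c t)) (pder c F z).
Proof. by move=> /derivableP; rewrite /pder derive1E. Qed.

(** Neighbourhoods of [z] within [A] for the topology pulled back from R^S. As a filter, it gives
    access to the limit laws for sums and products. *)
Definition nb_in S A z : set_system (I -> R) :=
  filter_from [set e : R | 0 < e] (fun e => near_in S e z `&` A).

Global Instance nb_in_filter S A z : Filter (nb_in S A z).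
Proof.
apply: filter_from_filter; first by exists 1; exact: ltr01.
move=> e d /= e0 d0; exists (Num.min e d); first by rewrite lt_min e0.
move=> w [wz Aw]; split; split=> //; apply: near_in_sub wz => //.
  by rewrite ge_min lexx.
by rewrite ge_min lexx orbT.
Qed.

Lemma cont_inP S A F : cont_in S A F <->
  forall z, A z -> F w @[w --> nb_in S A z] --> F z.
Proof.
split=> [cF z Az|cF z Az e e0].
  apply/cvgrPdist_lt => e e0; have [d d0 de] := cF z Az e e0.
  by exists d => // w [wz Aw] /=; rewrite distrC; apply: de.
have /cvgrPdist_lt /(_ e e0) [d d0 de] := cF z Az.
by exists d => // w Aw wz; rewrite distrC; apply: de.
Qed.

(** Points that agree on [S] lie in every [S]-neighbourhood of each other, so the two values differ
    by less than any [e]. *)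
Lemma cont_in_agree S A F z w : cont_in S A F -> A z -> A w ->
  (forall c, S c -> z c = w c) -> F z = F w.
Proof.
move=> cF Az Aw zw; apply/eqP; rewrite -subr_eq0 -normr_eq0 eq_le normr_ge0 andbT.
apply/ler_addgt0Pl => e e0; rewrite addr0; have [d d0 de] := cF z Az e e0.
by rewrite distrC ltW // de //; exact: near_in_agree.
Qed.

Lemma cont_in_sub S S' A A' F : S `<=` S' -> A' `<=` A -> cont_in S A F -> cont_in S' A' F.
Proof.
move=> SS AA cF z Az e e0; have [d d0 de] := cF z (AA z Az) e e0.
by exists d => // w Aw wz; apply: de; [exact: AA|apply: near_in_sub wz].
Qed.

Lemma cont_in_ext S A F G : {in A, F =1 G} -> cont_in S A F -> cont_in S A G.
Proof.
move=> FG cF z Az e e0; have [d d0 de] := cF z Az e e0.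
by exists d => // w Aw wz; rewrite -!FG ?inE //; exact: de.
Qed.

(** [smooth_on] runs over sequences of derivatives, a shape that products and compositions do not
    preserve. Here one derivative lowers [k] by one, and the derivative of a product or a
    composition is again a sum of products, so induction on [k] goes through. *)
Fixpoint Ck k S A F : Prop :=
  cont_in S A F /\ if k is k'.+1 then forall c,
    (forall z, A z -> derivable (fun t => F (upd z c t)) (z c) 1) /\
    Ck k' S A (pder c F) else True.

Lemma Ck_cont k S A F : Ck k S A F -> cont_in S A F.
Proof. by case: k => [|k] []. Qed.

Lemma CkS k S A F : Ck k.+1 S A F -> Ck k S A F.
Proof.
elim: k F => [|k IH] F [cF dF]; first by split.
by split=> // c; have [dcF CF] := dF c; split=> //; exact: IH.
Qed.

Lemma Ck_is_derive k S A F c z : Ck k.+1 S A F -> A z ->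
  is_derive (z c) 1 (fun t => F (upd z c t)) (pder c F z).
Proof. by move=> [_ /(_ c)[dF _]] Az; apply: derivable_pder; exact: dF. Qed.

Lemma smooth_pder S A F c : smooth_on S A F -> smooth_on S A (pder c F).
Proof. by move=> sF cs; have := sF (rcons cs c); rewrite foldr_rcons. Qed.

Lemma smooth_onP S A F : smooth_on S A F <-> forall k, Ck k S A F.
Proof.
split=> [sF k|].
  elim: k F sF => [|k IH] F sF; first by split=> //; have [] := sF [::].
  split; first by have [] := sF [::].
  move=> c; split; first by have [_ /(_ c)] := sF [::].
  exact/IH/smooth_pder.
move=> CF cs; elim/last_ind: cs F CF => [|cs c IH] F CF.
  by have [cF dF] := CF 1; split=> // c; have [] := dF c.
by rewrite foldr_rcons; apply: IH => k; have [_ /(_ c)[]] := CF k.+1.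
Qed.

Lemma Ck_ext k S S' A F G : open_in S' A -> {in A, F =1 G} -> Ck k S A F -> Ck k S A G.
Proof.
move=> oA; elim: k F G => [|k IH] F G FG [cF dF].
  by split=> //; exact: cont_in_ext cF.
split; first exact: cont_in_ext cF.
move=> c; have [dcF CF] := dF c; split.
  move=> z Az; apply: derivable_near (dcF z Az); apply: filterS (open_upd c oA Az) => t At.
  by apply: FG; rewrite inE.
by apply: IH CF => z; rewrite inE => Az; exact: pder_ext oA FG Az.
Qed.

Lemma Ck_sub k S S' A A' F : S `<=` S' -> A' `<=` A -> Ck k S A F -> Ck k S' A' F.
Proof.
move=> SS AA; elim: k F => [|k IH] F [cF dF]; first by split=> //; exact: cont_in_sub cF.
split; first exact: cont_in_sub cF.
by move=> c; have [dcF CF] := dF c; split=> [z Az|]; [apply/dcF/AA|exact: IH].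
Qed.

Lemma Ck_cst k S A (a : R) : Ck k S A (fun=> a).
Proof.
have cc b : cont_in S A (fun=> b : R).
  by move=> z Az e e0; exists 1 => // *; rewrite subrr normr0.
elim: k a => [|k IH] a; split=> // c; split=> [z _|]; first exact: derivable_cst.
rewrite (_ : pder c _ = fun=> 0) //; apply/funext => z.
exact: pder_const.
Qed.

Lemma Ck_coord k S A c : S c -> Ck k S A (fun z => z c).
Proof.
move=> Sc; have cc : cont_in S A (fun z => z c).
  by move=> z Az e e0; exists e => // w Aw; apply.
case: k => [|k]; split=> // d.
have H z : is_derive (z d) 1 (fun t : R => upd z d t c) (c == d)%:R.
  rewrite /upd; case: eqP => [_|_]; [exact: is_derive_id|exact: is_derive_cst].
split=> [z _|]; first exact: ex_derive.
rewrite (_ : pder d _ = fun=> (c == d)%:R); first exact: Ck_cst.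
by apply/funext => z; exact: pder_is_derive.
Qed.

Lemma Ck_add k S S' A F G : open_in S' A -> Ck k S A F -> Ck k S A G ->
  Ck k S A (fun z => F z + G z).
Proof.
move=> oA; elim: k F G => [|k IH] F G CF CG; split=> //;
  try (apply/cont_inP => z Az; apply: cvgD;
       [by move: (Ck_cont CF) => /cont_inP; apply|by move: (Ck_cont CG) => /cont_inP; apply]).
move=> c.
have H z : A z -> is_derive (z c) 1 (fun t => F (upd z c t) + G (upd z c t))
    (pder c F z + pder c G z).
  by move=> Az; apply: is_deriveD; apply: Ck_is_derive; eassumption.
split=> [z Az|]; first by apply: ex_derive; exact: H.
apply: (@Ck_ext _ _ S' _ (fun z => pder c F z + pder c G z)) => //.
  by move=> z; rewrite inE => Az; apply/esym/pder_is_derive/H.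
by apply: IH; [case: CF|case: CG] => _ /(_ c)[].
Qed.

Lemma Ck_mul k S S' A F G : open_in S' A -> Ck k S A F -> Ck k S A G ->
  Ck k S A (fun z => F z * G z).
Proof.
move=> oA; elim: k F G => [|k IH] F G CF CG; split=> //;
  try (apply/cont_inP => z Az; apply: cvgM;
       [by move: (Ck_cont CF) => /cont_inP; apply|by move: (Ck_cont CG) => /cont_inP; apply]).
move=> c.
have H z : A z -> is_derive (z c) 1 (fun t => F (upd z c t) * G (upd z c t))
    (pder c F z * G z + F z * pder c G z).
  move=> Az; apply: is_derive_eq.
    by apply: is_deriveM; apply: Ck_is_derive; eassumption.
  by rewrite /= !upd_id addrC /GRing.scale /= mulrC.
split=> [z Az|]; first by apply: ex_derive; exact: H.
apply: (@Ck_ext _ _ S' _ (fun z => pder c F z * G z + F z * pder c G z)) => //.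
  by move=> z; rewrite inE => Az; apply/esym/pder_is_derive/H.
apply: (Ck_add oA); apply: IH; try exact: CkS.
  by case: CF => _ /(_ c)[].
by case: CG => _ /(_ c)[].
Qed.

End Smooth.

(** * The chain rule *)

Section ChainRule.
Context {R : realType} {I : choiceType}.
Implicit Types (S : set I) (A : set (I -> R)) (F G : (I -> R) -> R) (z w : I -> R).

(** Finitely many radii are replaced by their minimum, which needs [Q c] to be stable under
    shrinking. *)
Lemma seq_delta (T : eqType) (s : seq T) (Q : T -> R -> Prop) :
  (forall c d d', d' <= d -> Q c d -> Q c d') ->
  (forall c, c \in s -> exists2 d : R, 0 < d & Q c d) ->
  exists2 d : R, 0 < d & forall c, c \in s -> Q c d.
Proof.
move=> Qle; elim: s => [|c s IH] H; first by exists 1.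
have [d d0 Qd] := IH (fun c' c's => H c' (@mem_behead _ (c :: s) _ c's)).
have [e e0 Qe] := H c (mem_head _ _).
exists (Num.min d e); first by rewrite lt_min d0.
move=> c'; rewrite inE => /orP[/eqP ->|c's].
  by apply: Qle Qe; rewrite ge_min lexx orbT.
by apply: Qle (Qd _ c's); rewrite ge_min lexx.
Qed.

Lemma minl_lt (x y t : R) : t < Num.min x y -> t < x.
Proof. by rewrite lt_min => /andP[]. Qed.

(** The intermediate points of a path from [z] to [w] that changes one coordinate at a time. *)
Definition mix (s : seq I) z w : I -> R := fun c => if c \in s then w c else z c.

(** Continuous partial derivatives give a total differential: each move along one coordinate is a
    mean value step, and continuity of the partial derivative at [z] replaces its value at the
    intermediate point at the cost of [e]. *)
Lemma Ck_total_differential S A F (s : seq I) z : open_in S A -> Ck 1 S A F -> uniq s ->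
  A z -> forall e : R, 0 < e -> exists2 d : R, 0 < d &
    forall w, (forall c, c \in s -> `|w c - z c| < d) ->
      `|F (mix s z w) - F z - \sum_(c <- s) pder c F z * (w c - z c)| <=
      e * \sum_(c <- s) `|w c - z c|.
Proof.
move=> oA CF us Az e e0; elim: s us => [_|c s IH /= /andP[cs us]].
  by exists 1 => // w _; rewrite !big_nil (_ : mix _ _ _ = z) // subrr subr0 normr0 mulr0.
have [d1 d10 H1] := IH us.
have [d2 d20 H2] := (proj1 (proj2 (proj2 CF c))) z Az e e0.
have [d3 d30 H3] := oA z Az.
exists (Num.min d1 (Num.min d2 d3)); first by rewrite !lt_min d10 d20.
move=> w wz; have wzs c' : c' \in s -> `|w c' - z c'| < Num.min d1 (Num.min d2 d3).
  by move=> c's; apply: wz; rewrite inE c's orbT.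
have {}IH := H1 w (fun c' c's => minl_lt (wzs c' c's)).
set v := mix s z w.
have vc : v c = z c by rewrite /v /mix (negbTE cs).
have -> : mix (c :: s) z w = upd v c (w c).
  by apply/funext => c'; rewrite /mix /upd inE; case: eqP => [->|].
have near t : `|t - z c| <= `|w c - z c| ->
    near_in S (Num.min d2 d3) z (upd v c t).
  move=> tz c' _; rewrite /upd; case: eqP => [->|_].
    by apply: le_lt_trans tz _; have := wz c (mem_head _ _); rewrite lt_min => /andP[].
  rewrite /v /mix; case: ifP => [/wzs|_]; first by rewrite lt_min => /andP[].
  by rewrite subrr normr0 lt_min d20.
have nearA t : `|t - z c| <= `|w c - z c| -> A (upd v c t).
  by move=> /near tn; apply: H3; apply: near_in_sub tn => //; rewrite ge_min lexx orbT.
have [t tz Et] : exists2 t, `|t - z c| <= `|w c - z c| &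
    F (upd v c (w c)) - F v = pder c F (upd v c t) * (w c - z c).
  rewrite -[in F v](upd_id v c) vc.
  apply: (@mean_value _ (fun t => F (upd v c t)) (fun t => pder c F (upd v c t))) => t tz.
  have := Ck_is_derive c CF (nearA t tz).
  by rewrite upd_eq; under eq_fun do rewrite upd_upd.
rewrite !big_cons [e * (_ + _)]mulrDr.
have -> : F (upd v c (w c)) - F z -
    (pder c F z * (w c - z c) + \sum_(j <- s) pder j F z * (w j - z j)) =
  (pder c F (upd v c t) - pder c F z) * (w c - z c) +
    (F v - F z - \sum_(j <- s) pder j F z * (w j - z j)).
  by rewrite mulrBl -Et; ring.
apply: le_trans (ler_normD _ _) (lerD _ IH).
rewrite normrM ler_wpM2r // ltW // H2 //; first exact: nearA.
by apply: near_in_sub (near t tz) => //; rewrite ge_min lexx.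
Qed.

(** The increment of [F] is its differential on the increment of [g], up to an error relative to
    that increment; the latter is linear in [t - t0], up to a second error. Each error receives half
    of [e]. *)
Lemma chain_curve (s : seq I) A F (g : R -> I -> R) t0 (dg : I -> R) :
  open_in [set` s] A -> Ck 1 [set` s] A F -> uniq s -> A (g t0) ->
  (forall c, c \in s -> is_derive t0 1 (g ^~ c) (dg c)) ->
  is_derive t0 1 (fun t => F (g t)) (\sum_(c <- s) pder c F (g t0) * dg c).
Proof.
move=> oA CF us Ag dgP; apply/is_derive_epsP => e e0.
(* [M] bounds the total increment of the coordinates in [s] per unit of time, [P] the total size of
   the partial derivatives. The summand 1 keeps both positive when [s] is empty. *)
set M := 1 + \sum_(c <- s) (`|dg c| + 1).
set P := 1 + \sum_(c <- s) `|pder c F (g t0)|.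
have M0 : 0 < M by rewrite ltr_pwDl // sumr_ge0 // => c _; rewrite addr_ge0.
have P0 : 0 < P by rewrite ltr_pwDl // sumr_ge0.
have [d1 d10 H1] : exists2 d : R, 0 < d & forall w, (forall c, c \in s -> `|w c - g t0 c| < d) ->
      `|F (mix s (g t0) w) - F (g t0) - \sum_(c <- s) pder c F (g t0) * (w c - g t0 c)| <=
      e / 2 / M * \sum_(c <- s) `|w c - g t0 c|.
  by apply: Ck_total_differential oA CF us Ag _ _; rewrite !divr_gt0.
have [d2 d20 H2] := oA _ Ag.
(* The bound 1 yields the Lipschitz estimate with constant [|dg c| + 1]; the bound [e / 2 / P] makes
   the weighted errors of the coordinates sum to at most half of [e]. *)
set e2 := Num.min 1 (e / 2 / P).
have e20 : 0 < e2 by rewrite lt_min ltr01 !divr_gt0.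
have [d3 d30 H3] : exists2 d : R, 0 < d & forall c, c \in s -> forall t, `|t - t0| < d ->
    `|g t c - g t0 c - dg c * (t - t0)| <= e2 * `|t - t0|.
  apply: (@seq_delta _ s (fun c d => forall t, `|t - t0| < d ->
    `|g t c - g t0 c - dg c * (t - t0)| <= e2 * `|t - t0|)).
    by move=> c d d' dd H t td; apply: H; exact: lt_le_trans td dd.
  by move=> c cs; have /is_derive_epsP /(_ _ e20) := dgP c cs.
have H4 c t : c \in s -> `|t - t0| < d3 -> `|g t c - g t0 c| <= (`|dg c| + 1) * `|t - t0|.
  move=> cs td; have := H3 c cs t td.
  rewrite -[X in `|X| <= (_ + 1) * _](subrK (dg c * (t - t0))) => H.
  apply: le_trans (ler_normD _ _) _; rewrite normrM mulrDl addrC lerD2l mul1r.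
  by apply: le_trans H _; rewrite ler_piMl // ge_min lexx.
exists (Num.min d3 (Num.min d1 d2 / M)).
  by rewrite lt_min d30 divr_gt0 // lt_min d10.
move=> t; rewrite lt_min => /andP[td3 tdM].
have gt c : c \in s -> `|g t c - g t0 c| < Num.min d1 d2.
  move=> cs; apply: le_lt_trans (H4 c t cs td3) _.
  apply: le_lt_trans (_ : _ <= M * `|t - t0|) _; last first.
    by rewrite mulrC -ltr_pdivlMr.
  rewrite ler_wpM2r // /M (big_rem c cs) /= addrCA lerDl addr_ge0 // sumr_ge0 // => c' _.
have Agt : A (g t).
  by apply: H2 => c cs; have := gt c cs; rewrite lt_min => /andP[].
(* [mix] leaves the coordinates outside [s] at [g t0], but [F] does not see them. *)
have Fmix : F (mix s (g t0) (g t)) = F (g t).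
  have Am : A (mix s (g t0) (g t)).
    by apply: (open_in_agree oA Agt) => c cs; rewrite /mix cs.
  by apply: (cont_in_agree (Ck_cont CF)) => // c /= cs; rewrite /mix cs.
have := H1 (g t) (fun c cs => minl_lt (gt c cs)); rewrite Fmix => {}H1.
have -> : F (g t) - F (g t0) - (\sum_(c <- s) pder c F (g t0) * dg c) * (t - t0) =
  (F (g t) - F (g t0) - \sum_(c <- s) pder c F (g t0) * (g t c - g t0 c)) +
  \sum_(c <- s) pder c F (g t0) * (g t c - g t0 c - dg c * (t - t0)).
  rewrite -[RHS]addrA; congr (_ + _); rewrite mulr_suml -!sumrN -big_split /=.
  by apply: eq_bigr => c _; ring.
apply: le_trans (ler_normD _ _) _; rewrite [e in e * _](splitr e) mulrDl; apply: lerD.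
  have -> : e / 2 * `|t - t0| = e / 2 / M * (M * `|t - t0|).
    by rewrite mulrA divfK ?lt0r_neq0.
  apply: le_trans H1 _.
  rewrite ler_wpM2l //; first by rewrite !divr_ge0 // ltW.
  apply: le_trans (_ : \sum_(c <- s) (`|dg c| + 1) * `|t - t0| <= _).
    by rewrite big_seq [X in _ <= X]big_seq; apply: ler_sum => c cs; exact: H4.
  by rewrite -mulr_suml ler_wpM2r // lerDr.
apply: le_trans (ler_norm_sum _ _ _) _.
apply: le_trans (_ : \sum_(c <- s) `|pder c F (g t0)| * (e / 2 / P * `|t - t0|) <= _).
  rewrite big_seq [X in _ <= X]big_seq; apply: ler_sum => c cs; rewrite normrM ler_wpM2l //.
  apply: le_trans (H3 c cs t td3) _; rewrite ler_wpM2r //.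
  by rewrite ge_min lexx orbT.
rewrite -mulr_suml mulrA ler_wpM2r // mulrCA ler_piMr //; first by rewrite divr_ge0 // ltW.
by rewrite ler_pdivrMr // mul1r lerDr.
Qed.

End ChainRule.

(** * Composition and symmetry of second derivatives *)

Local Opaque pder.

Section Composition.
Context {R : realType} {I I' : choiceType}.
Implicit Types (S : set I) (A : set (I -> R)) (F G : (I -> R) -> R).

(** By the chain rule a partial derivative of [F \o g] is a sum of products of [pder d F \o g],
    covered by the induction hypothesis, with partial derivatives of the components of [g]. *)
Lemma Ck_comp k (s : seq I) A F (S' : set I') (A' : set (I' -> R))
    (g : (I' -> R) -> I -> R) :
  uniq s -> open_in [set` s] A -> Ck k [set` s] A F -> open_in S' A' ->
  (forall d, d \in s -> Ck k S' A' (g ^~ d)) -> (forall z, A' z -> A (g z)) ->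
  Ck k S' A' (F \o g).
Proof.
move=> us oA CF oA' Cg gA.
have cont k' F' : Ck k' [set` s] A F' -> cont_in S' A' (F' \o g).
  move=> CF' z Az e e0; have [d d0 de] := Ck_cont CF' (gA z Az) e0.
  have [d' d'0 dd'] : exists2 d' : R, 0 < d' & forall c, c \in s -> forall w, A' w ->
      near_in S' d' z w -> `|g w c - g z c| < d.
    apply: (@seq_delta R _ s (fun c d' => forall w, A' w ->
      near_in S' d' z w -> `|g w c - g z c| < d)).
      by move=> c x y yx H w Aw wz; apply: H => //; apply: near_in_sub wz.
    by move=> c cs; have [d' d'0 H] := Ck_cont (Cg c cs) Az d0; exists d'.
  exists d' => // w Aw wz; apply: de; first exact: gA.
  by move=> c /= cs; exact: dd'.
elim: k F CF Cg => [|k IH] F CF Cg; first by split=> //; exact: cont CF.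
split; first exact: cont CF.
move=> c.
have H z : A' z -> is_derive (z c) 1 (fun t => F (g (upd z c t)))
    (\sum_(d <- s) pder d F (g z) * pder c (g ^~ d) z).
  move=> Az; have [F0 F1] : Ck k.+1 [set` s] A F by [].
  have := @chain_curve _ _ s A F (fun t => g (upd z c t)) (z c)
    (fun d => pder c (g ^~ d) z) oA _ us; rewrite /= upd_id; apply.
  - by split=> // d; have [dF cF] := F1 d; split=> //; split=> //; exact: Ck_cont cF.
  - exact: gA.
  - by move=> d ds; apply: Ck_is_derive (Cg d ds) Az.
split=> [z Az|]; first by apply: ex_derive; exact: H.
apply: (@Ck_ext _ _ _ _ S' _ (fun z => \sum_(d <- s) pder d F (g z) * pder c (g ^~ d) z)) => //.
  by move=> z; rewrite inE => Az; apply/esym/pder_is_derive/H.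
have Hs (l : seq I) : {subset l <= s} ->
    Ck k S' A' (fun z => \sum_(d <- l) pder d F (g z) * pder c (g ^~ d) z).
  elim: l => [|d l IHl] ls.
    by apply: (Ck_ext oA' _ (Ck_cst k S' A' 0)) => z _; rewrite big_nil.
  have dl : {subset l <= s} by move=> x xl; apply: ls; rewrite inE xl orbT.
  apply: (Ck_ext oA' _ (Ck_add oA' (Ck_mul oA' (IH (pder d F) _ _) _) (IHl dl))).
  - by move=> z _; rewrite big_cons.
  - by have [_ /(_ d)[]] := CF.
  - by move=> d' d's; exact: CkS (Cg d' d's).
  - by have [_ /(_ c)[]] := Cg d (ls d (mem_head _ _)).
exact: Hs.
Qed.

End Composition.

Section Schwarz.
Context {R : realType} {I : choiceType}.
Implicit Types (S : set I) (A : set (I -> R)) (F G : (I -> R) -> R) (z w : I -> R).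

(** The mean value theorem in direction [c], applied to the difference of [F] at the two heights
    [z d + h] and [z d], and then in direction [d]. *)
Lemma second_difference k S A F z c d (e h : R) : Ck k.+2 S A F -> c != d ->
  near_in S e z `<=` A -> 0 < h -> h < e -> exists w,
    [/\ A w, near_in S e z w &
      F (upd (upd z c (z c + h)) d (z d + h)) - F (upd z c (z c + h)) -
      (F (upd z d (z d + h)) - F z) = pder d (pder c F) w * h * h].
Proof.
move=> CF cd eA h0 he; have e0 : 0 < e by exact: lt_trans he.
have N s t : `|s - z c| <= h -> `|t - z d| <= h ->
    near_in S e z (upd (upd z d t) c s).
  move=> sh th x _; rewrite /upd; case: eqP => [->|_]; first exact: le_lt_trans he.
  by case: eqP => [->|_]; [exact: le_lt_trans he|rewrite subrr normr0].
have dF s t : `|s - z c| <= h -> `|t - z d| <= h ->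
    is_derive s 1 (fun s => F (upd (upd z d t) c s)) (pder c F (upd (upd z d t) c s)).
  move=> sh th; have := Ck_is_derive c CF (eA _ (N s t sh th)).
  by rewrite upd_eq; under eq_fun do rewrite upd_upd.
have hE x : `|x + h - x| = h by rewrite addrC addKr gtr0_norm.
have h0' x : `|x - x : R| <= h by rewrite subrr normr0 ltW.
have [s sh E1] : exists2 s, `|s - z c| <= `|z c + h - z c| &
    (F (upd (upd z d (z d + h)) c (z c + h)) - F (upd (upd z d (z d)) c (z c + h))) -
    (F (upd (upd z d (z d + h)) c (z c)) - F (upd (upd z d (z d)) c (z c))) =
    (pder c F (upd (upd z d (z d + h)) c s) - pder c F (upd (upd z d (z d)) c s)) *
    (z c + h - z c).
  apply: (@mean_value R
    (fun s => F (upd (upd z d (z d + h)) c s) - F (upd (upd z d (z d)) c s))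
    (fun s => pder c F (upd (upd z d (z d + h)) c s) - pder c F (upd (upd z d (z d)) c s))).
  move=> s; rewrite hE => sh; apply: is_deriveB; apply: dF => //.
  by rewrite hE.
rewrite hE in sh.
have [t th E2] : exists2 t, `|t - z d| <= `|z d + h - z d| &
    pder c F (upd (upd z d (z d + h)) c s) - pder c F (upd (upd z d (z d)) c s) =
    pder d (pder c F) (upd (upd z d t) c s) * (z d + h - z d).
  apply: (@mean_value R (fun t => pder c F (upd (upd z d t) c s))
    (fun t => pder d (pder c F) (upd (upd z d t) c s))) => t; rewrite hE => th.
  have [_ /(_ c)[_ Cc]] := CF.
  have := Ck_is_derive d Cc (eA _ (N s t sh th)).
  have dc : d != c by rewrite eq_sym.
  rewrite (upd_neq (upd z d t) s dc) upd_eq.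
  by under eq_fun do rewrite (updC _ _ _ cd) upd_upd.
rewrite hE in th.
exists (upd (upd z d t) c s); split; [exact/eA/N|exact: N|].
have Ez : upd (upd z d (z d + h)) c (z c) = upd z d (z d + h).
  by rewrite -[X in upd _ c X](upd_neq z (z d + h) cd) upd_id.
have hh x : x + h - x = h by rewrite addrC addKr.
rewrite E2 !hh Ez (upd_id z d) (upd_id z c) in E1.
by rewrite -E1 (updC z _ _ cd).
Qed.

(** The second difference is symmetric in [c] and [d], so the two mixed derivatives take a common
    value at points [v] and [w] as near to [z] as desired; continuity brings both to [z]. *)
Lemma Ck_schwarz k S A F z c d : open_in S A -> Ck k.+2 S A F -> A z ->
  pder c (pder d F) z = pder d (pder c F) z.
Proof.
move=> oA CF Az; have [->//|cd] := eqVneq c d.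
apply/eqP; rewrite -subr_eq0 -normr_eq0 eq_le normr_ge0 andbT.
apply/ler_addgt0Pl => e' e'0; rewrite addr0; have e0 : 0 < e' / 2 by rewrite divr_gt0.
move: (e' / 2) (splitr e') e0 => e -> e0.
have [d1 d10 H1] := oA _ Az.
have C2 x y : cont_in S A (pder x (pder y F)).
  by have [_ /(_ y)[_ [_ /(_ x)[_ /Ck_cont]]]] := CF.
have [d2 d20 H2] := C2 c d z Az e e0; have [d3 d30 H3] := C2 d c z Az e e0.
set m := Num.min d1 (Num.min d2 d3).
have m0 : 0 < m by rewrite !lt_min d10 d20.
have mA : near_in S m z `<=` A.
  by move=> w wz; apply: H1; apply: near_in_sub wz => //; rewrite ge_min lexx.
have h0 : 0 < m / 2 by rewrite divr_gt0.
have hm : m / 2 < m by rewrite [X in _ < X](splitr m) ltrDl.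
have [w [Aw wz Ew]] := second_difference CF cd mA h0 hm.
rewrite eq_sym in cd; have [v [Av vz Ev]] := second_difference CF cd mA h0 hm.
have : pder c (pder d F) v = pder d (pder c F) w.
  apply: (mulIf (lt0r_neq0 h0)); apply: (mulIf (lt0r_neq0 h0)).
  have sub4 (a b x y : R) : a - b - (x - y) = a - x - (b - y) by ring.
  rewrite (updC z _ _ cd) sub4 in Ev; exact: etrans (esym Ev) Ew.
have {}H2 : `|pder c (pder d F) v - pder c (pder d F) z| < e.
  by apply: H2 => //; apply: near_in_sub vz => //; rewrite /m !ge_min lexx orbT.
have {}H3 : `|pder d (pder c F) w - pder d (pder c F) z| < e.
  by apply: H3 => //; apply: near_in_sub wz => //; rewrite /m !ge_min lexx !orbT.
move=> E; rewrite E distrC in H2.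
have -> : pder c (pder d F) z - pder d (pder c F) z =
  (pder c (pder d F) z - pder d (pder c F) w) + (pder d (pder c F) w - pder d (pder c F) z).
  by rewrite addrA subrK.
by apply: le_trans (ler_normD _ _) _; exact: lerD (ltW H2) (ltW H3).
Qed.

End Schwarz.

(** * Smooth functions of finitely many coordinates *)

Section FinSmooth.
Context {R : realType}.

Section Def.
Context {I : choiceType}.
Implicit Types (S : set I) (s : seq I) (A : set (I -> R)) (F G : (I -> R) -> R) (z w : I -> R).

Definition fopen A : Prop := exists s, uniq s /\ open_in [set` s] A.

(* Smoothness with an unspecified finite set of coordinates, so that orders need
   not be tracked. *)
Definition fsm A F : Prop := exists s,
  [/\ uniq s, open_in [set` s] A & forall k, Ck k [set` s] A F].

Lemma fsm_fopen A F : fsm A F -> fopen A.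
Proof. by case=> s [us oA _]; exists s. Qed.

Lemma finite_uniq_seq S : finite_set S -> exists s, uniq s /\ S = [set` s].
Proof.
move=> /finite_seqP[s ->]; exists (undup s); split; first exact: undup_uniq.
by apply/seteqP; split=> x /=; rewrite mem_undup.
Qed.

Lemma fopen_fin S A : finite_set S -> open_in S A -> fopen A.
Proof. by move=> /finite_uniq_seq[s [us ->]] oA; exists s. Qed.

Lemma fsm_fin S A F : finite_set S -> open_in S A -> smooth_on S A F -> fsm A F.
Proof.
by move=> /finite_uniq_seq[s [us ->]] oA /smooth_onP sF; exists s.
Qed.

Lemma fsm_common A (T : eqType) (l : seq T) (F : T -> (I -> R) -> R) : fopen A ->
  (forall d, d \in l -> fsm A (F d)) -> exists s, [/\ uniq s, open_in [set` s] A &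
    forall d, d \in l -> forall k, Ck k [set` s] A (F d)].
Proof.
move=> [s [us oA]]; elim: l => [|d l IH] H; first by exists s.
have [s1 [us1 oA1 C1]] := IH (fun c cl => H c (@mem_behead _ (d :: l) _ cl)).
have [s2 [us2 oA2 C2]] := H d (mem_head _ _).
have i1 : [set` s1] `<=` [set` undup (s1 ++ s2)].
  by move=> x /=; rewrite mem_undup mem_cat => ->.
have i2 : [set` s2] `<=` [set` undup (s1 ++ s2)].
  by move=> x /=; rewrite mem_undup mem_cat => ->; rewrite orbT.
exists (undup (s1 ++ s2)); split; first exact: undup_uniq.
  exact: open_in_sub oA1.
move=> c; rewrite inE => /orP[/eqP -> k|cl k].
  exact: Ck_sub (C2 k).
exact: Ck_sub (C1 c cl k).
Qed.

Lemma fsm_pair A F G : fsm A F -> fsm A G -> exists s, [/\ uniq s, open_in [set` s] A,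
  (forall k, Ck k [set` s] A F) & forall k, Ck k [set` s] A G].
Proof.
move=> fF fG; have [//||s [us oA H]] := @fsm_common A _ [:: true; false]
  (fun b => if b then F else G).
  exact: fsm_fopen fF.
  by case.
by exists s; split=> // k; [apply: (H true)|apply: (H false)].
Qed.

Lemma fopenI A B : fopen A -> fopen B -> fopen (A `&` B).
Proof.
move=> [s [us oA]] [s' [us' oB]]; exists (undup (s ++ s')); split; first exact: undup_uniq.
apply: open_inI; [apply: open_in_sub oA|apply: open_in_sub oB] => x /=;
  by rewrite mem_undup mem_cat => ->; rewrite ?orbT.
Qed.

Lemma fsm_sub A B F : fopen B -> B `<=` A -> fsm A F -> fsm B F.
Proof.
move=> [s [us oB]] BA [s' [us' oA CF]].
exists (undup (s ++ s')); split; first exact: undup_uniq.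
  by apply: open_in_sub oB => x /=; rewrite mem_undup mem_cat => ->.
by move=> k; apply: Ck_sub (CF k) => // x /=; rewrite mem_undup mem_cat orbC => ->.
Qed.

Lemma fsm_ext A F G : {in A, F =1 G} -> fsm A F -> fsm A G.
Proof. by move=> FG [s [us oA CF]]; exists s; split=> // k; exact: Ck_ext oA FG (CF k). Qed.

Lemma fsm_cst A (a : R) : fopen A -> fsm A (fun=> a).
Proof. by case=> s [us oA]; exists s; split=> // k; exact: Ck_cst. Qed.

Lemma fsm_coord A c : fopen A -> fsm A (fun z => z c).
Proof.
case=> s [us oA]; exists (undup (c :: s)); split; first exact: undup_uniq.
  apply: open_in_sub oA => x /= xs.
  have: x \in undup (c :: s) by rewrite mem_undup inE xs orbT.
  exact: id.
have cs : c \in undup (c :: s) by rewrite mem_undup mem_head.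
by move=> k; exact: (@Ck_coord _ _ k [set` undup (c :: s)] A c cs).
Qed.

Lemma fsmD A F G : fsm A F -> fsm A G -> fsm A (fun z => F z + G z).
Proof.
move=> fF fG; have [s [us oA CF CG]] := fsm_pair fF fG.
by exists s; split=> // k; exact: (Ck_add oA).
Qed.

Lemma fsmM A F G : fsm A F -> fsm A G -> fsm A (fun z => F z * G z).
Proof.
move=> fF fG; have [s [us oA CF CG]] := fsm_pair fF fG.
by exists s; split=> // k; exact: (Ck_mul oA).
Qed.

Lemma fsm_sum A (T : eqType) (l : seq T) (P : pred T) (F : T -> (I -> R) -> R) : fopen A ->
  (forall i, i \in l -> P i -> fsm A (F i)) -> fsm A (fun z => \sum_(i <- l | P i) F i z).
Proof.
move=> oA; elim: l => [|i l IH] H.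
  by apply: (fsm_ext _ (fsm_cst 0 oA)) => z _; rewrite big_nil.
have {}IH := IH (fun j jl => H j (@mem_behead _ (i :: l) _ jl)).
case Pi: (P i).
  apply: (fsm_ext _ (fsmD (H i (mem_head _ _) Pi) IH)) => z _.
  by rewrite big_cons Pi.
by apply: (fsm_ext _ IH) => z _; rewrite big_cons Pi.
Qed.

Lemma fsm_pder A F c : fsm A F -> fsm A (pder c F).
Proof.
by case=> s [us oA CF]; exists s; split=> // k; have [_ /(_ c)[]] := CF k.+1.
Qed.

Lemma fsm_schwarz A F c d z : fsm A F -> A z ->
  pder c (pder d F) z = pder d (pder c F) z.
Proof. by case=> s [us oA CF] Az; exact: (Ck_schwarz c d oA (CF 2) Az). Qed.

Lemma fsm_is_derive A F c z : fsm A F -> A z ->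
  is_derive (z c) 1 (fun t => F (upd z c t)) (pder c F z).
Proof. by case=> s [us oA CF] Az; exact: Ck_is_derive (CF 1) Az. Qed.

Lemma fsm_pder_ext A F G c z : fopen A -> {in A, F =1 G} -> A z ->
  pder c F z = pder c G z.
Proof. by case=> s [us oA] FG Az; exact: pder_ext oA FG Az. Qed.

(** The vanishing outside [s] is what turns [diff_at], a sum over all coordinates, into a finite
    sum. *)
Lemma fsmP A F : fsm A F -> exists s, [/\ uniq s, open_in [set` s] A,
  (forall k, Ck k [set` s] A F) & forall z, A z -> forall c, c \notin s -> pder c F z = 0].
Proof.
case=> s [us oA CF]; exists s; split=> // z Az c cs.
apply: (pder_agree (S := [set` s]) oA Az _ (negP cs)) => w Aw zw.
exact: (esym (cont_in_agree (Ck_cont (CF 0)) Az Aw zw)).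
Qed.

Lemma diff_atE F z w s : uniq s -> (forall c, c \notin s -> pder c F z = 0) ->
  diff_at F z w = \sum_(c <- s) pder c F z * w c.
Proof. by move=> us F0; apply: sum_fsT => // c cs; rewrite F0 ?mul0r. Qed.

Lemma diff_at_seq A (T : eqType) (l : seq T) (F : T -> (I -> R) -> R) : fopen A ->
  (forall d, d \in l -> fsm A (F d)) -> exists s, uniq s /\
  forall d, d \in l -> forall z, A z ->
    (forall c, c \notin s -> pder c (F d) z = 0) /\
    forall w, diff_at (F d) z w = \sum_(c <- s) pder c (F d) z * w c.
Proof.
move=> oA H; have [s [us oA' CF]] := fsm_common oA H.
exists s; split=> // d dl z Az.
have p0 c : c \notin s -> pder c (F d) z = 0.
  move=> cs; apply: (pder_agree (S := [set` s]) oA' Az _ (negP cs)) => w Aw zw.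
  exact: (esym (cont_in_agree (Ck_cont (CF d dl 0)) Az Aw zw)).
by split=> // w; exact: diff_atE.
Qed.

Lemma diff_at_curve A F (g : R -> I -> R) t0 (dg : I -> R) : fsm A F -> A (g t0) ->
  (forall c, is_derive t0 1 (g ^~ c) (dg c)) ->
  is_derive t0 1 (fun t => F (g t)) (diff_at F (g t0) dg).
Proof.
move=> /fsmP[s [us oA CF F0]] Ag dgP; rewrite (diff_atE _ us) ?(F0 _ Ag) //; last exact: F0.
exact: (chain_curve oA (CF 1)).
Qed.

Lemma diff_at_ext A F G z w : fopen A -> {in A, F =1 G} -> A z ->
  diff_at F z w = diff_at G z w.
Proof.
move=> oA FG Az; apply: eq_fsbigr => c _.
by rewrite (fsm_pder_ext c oA FG Az).
Qed.

Lemma diff_at_coord c z w : diff_at (fun y => y c) z w = w c.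
Proof.
rewrite (@diff_atE _ _ _ [:: c]) // ?big_seq1; last first.
  by move=> d; rewrite inE => dc; apply: pder_const => t; rewrite upd_neq // eq_sym.
suff -> : pder c (fun y => y c) z = 1 by rewrite mul1r.
by apply: pder_is_derive; under eq_fun do rewrite upd_eq; exact: is_derive_id.
Qed.

Lemma diff_at_cst (a : R) z w : diff_at (fun=> a) z w = 0.
Proof. by rewrite (@diff_atE _ _ _ [::]) ?big_nil // => c _; exact: pder_const. Qed.

Lemma diff_at_delta F z c : diff_at F z (fun d => (d == c)%:R) = pder c F z.
Proof.
rewrite /diff_at (@sum_fsT _ _ [:: c]) ?big_seq1 ?eqxx ?mulr1 // => d.
by rewrite inE => /negbTE ->; rewrite mulr0.
Qed.

Lemma diff_at_0 F z : diff_at F z (fun=> 0) = 0.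
Proof. by rewrite /diff_at fsbig1 // => c _; rewrite mulr0. Qed.

Lemma pderD A F G c z : fsm A F -> fsm A G -> A z ->
  pder c (fun y => F y + G y) z = pder c F z + pder c G z.
Proof.
move=> fF fG Az; apply: pder_is_derive.
by apply: is_deriveD; apply: fsm_is_derive; eassumption.
Qed.

Lemma pderM A F G c z : fsm A F -> fsm A G -> A z ->
  pder c (fun y => F y * G y) z = pder c F z * G z + F z * pder c G z.
Proof.
move=> fF fG Az; apply: pder_is_derive; apply: is_derive_eq.
  by apply: is_deriveM; apply: fsm_is_derive; eassumption.
by rewrite /= !upd_id addrC /GRing.scale /= mulrC.
Qed.

Lemma diff_atD A F G z w : fsm A F -> fsm A G -> A z ->
  diff_at (fun y => F y + G y) z w = diff_at F z w + diff_at G z w.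
Proof.
move=> fF fG Az.
have [||s [us H]] := @diff_at_seq A _ [:: true; false] (fun b => if b then F else G).
- exact: fsm_fopen fF.
- by case.
have [F0 ->] := H true isT z Az; have [G0 ->] := H false isT z Az.
rewrite (@diff_atE _ _ _ s) //; last first.
  by move=> c cs; rewrite (pderD c fF fG Az) F0 // G0 // addr0.
rewrite -big_split /=; apply: eq_bigr => c _; rewrite (pderD c fF fG Az).
by rewrite mulrDl.
Qed.

Lemma diff_atM A F G z w : fsm A F -> fsm A G -> A z ->
  diff_at (fun y => F y * G y) z w = diff_at F z w * G z + F z * diff_at G z w.
Proof.
move=> fF fG Az.
have [||s [us H]] := @diff_at_seq A _ [:: true; false] (fun b => if b then F else G).
- exact: fsm_fopen fF.
- by case.
have [F0 ->] := H true isT z Az; have [G0 ->] := H false isT z Az.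
rewrite (@diff_atE _ _ _ s) //; last first.
  by move=> c cs; rewrite (pderM c fF fG Az) F0 // G0 // mul0r mulr0 addr0.
rewrite mulr_suml mulr_sumr -big_split /=; apply: eq_bigr => c _.
by rewrite (pderM c fF fG Az); ring.
Qed.

Lemma diff_at_sum A (T : eqType) (l : seq T) (P : pred T) (F : T -> (I -> R) -> R) z w :
  fopen A -> (forall i, i \in l -> P i -> fsm A (F i)) -> A z ->
  diff_at (fun y => \sum_(i <- l | P i) F i y) z w = \sum_(i <- l | P i) diff_at (F i) z w.
Proof.
move=> oA; elim: l => [|i l IH] H Az.
  rewrite big_nil (diff_at_ext w oA (_ : {in A, _ =1 (fun=> 0)}) Az) ?diff_at_cst // => y _.
  by rewrite big_nil.
have {}H' := fun j jl => H j (@mem_behead _ (i :: l) _ jl).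
have {}IH := IH H' Az.
have E G G' : {in A, G =1 G'} -> diff_at G z w = diff_at G' z w.
  by move=> GG; exact: diff_at_ext oA GG Az.
rewrite big_cons; case Pi: (P i).
  rewrite (E (fun y => \sum_(j <- i :: l | P j) F j y)
    (fun y => F i y + \sum_(j <- l | P j) F j y)); last first.
    by move=> y _; rewrite big_cons Pi.
  by rewrite (diff_atD w (H i (mem_head _ _) Pi) _ Az) ?IH //; exact: fsm_sum.
by rewrite -IH; apply: E => y _; rewrite big_cons Pi.
Qed.

Lemma diff_at_linear A F z (a : R) w w' : fsm A F -> A z ->
  diff_at F z (fun c => a * w c + w' c) = a * diff_at F z w + diff_at F z w'.
Proof.
move=> /fsmP[s [us oA CF F0]] Az; rewrite !(@diff_atE _ _ _ s) //; try exact: F0.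
rewrite mulr_sumr -big_split /=; apply: eq_bigr => c _; ring.
Qed.

Lemma diff_at_lin_sum A F z (T : Type) (l : seq T) (P : pred T) (a : T -> R)
    (w : T -> I -> R) : fsm A F -> A z ->
  diff_at F z (fun c => \sum_(i <- l | P i) a i * w i c) =
  \sum_(i <- l | P i) a i * diff_at F z (w i).
Proof.
move=> fF Az; elim: l => [|i l IH].
  by rewrite big_nil -[RHS](diff_at_0 F z); congr diff_at; apply/funext => c; rewrite big_nil.
rewrite big_cons; case Pi: (P i); rewrite -IH -?(diff_at_linear (a i) _ _ fF Az);
  by congr diff_at; apply/funext => c; rewrite big_cons Pi.
Qed.

Lemma fsm_diff_at A F (v : (I -> R) -> I -> R) : fsm A F ->
  (forall c, fsm A (v ^~ c)) -> fsm A (fun z => diff_at F z (v z)).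
Proof.
move=> fF fv; have [s [us oA CF F0]] := fsmP fF.
apply: (@fsm_ext _ (fun z => \sum_(c <- s) pder c F z * v z c)).
  by move=> z; rewrite inE => Az; rewrite (diff_atE _ us) //; exact: F0.
apply: fsm_sum; first exact: fsm_fopen fF.
by move=> c _ _; apply: fsmM => //; exact: fsm_pder.
Qed.

(** Expanding both iterated derivatives gives the same second-order terms by symmetry of second
    derivatives; they cancel, and only derivatives of the components of the fields remain. *)
Lemma vector_field_commutator A F (a b : (I -> R) -> I -> R) z : fsm A F ->
  (forall c, fsm A (a ^~ c)) -> (forall c, fsm A (b ^~ c)) -> A z ->
  diff_at (fun w => diff_at F w (b w)) z (a z) - diff_at (fun w => diff_at F w (a w)) z (b z) =
  diff_at F z (fun c => diff_at (b ^~ c) z (a z) - diff_at (a ^~ c) z (b z)).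
Proof.
move=> fF fa fb Az; have oA := fsm_fopen fF; have [s [us oA' CF F0]] := fsmP fF.
have E (x y : (I -> R) -> I -> R) : (forall c, fsm A (x ^~ c)) -> (forall c, fsm A (y ^~ c)) ->
    diff_at (fun w => diff_at F w (y w)) z (x z) =
    \sum_(c <- s) (diff_at (pder c F) z (x z) * y z c + pder c F z * diff_at (y ^~ c) z (x z)).
  move=> fx fy.
  have XY : {in A, (fun w => diff_at F w (y w)) =1 (fun w => \sum_(c <- s) pder c F w * y w c)}.
    by move=> w; rewrite inE => Aw; rewrite (diff_atE _ us) //; exact: F0.
  rewrite (diff_at_ext _ oA XY Az) (diff_at_sum _ oA _ Az); last first.
    by move=> c _ _; apply: fsmM => //; exact: fsm_pder.
  by apply: eq_bigr => c _; rewrite (diff_atM _ (fsm_pder c fF) (fy c) Az).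
rewrite !E // !big_split /= (diff_atE _ us); last exact: F0.
have [s' [us' H]] := @diff_at_seq A _ s (fun c => pder c F) oA (fun c _ => fsm_pder c fF).
(* The inner differential of [pder c F] can also be restricted to [s]: for [d] outside [s],
   exchanging the derivatives leaves a derivative of [pder d F = 0]. *)
have S (x y : I -> R) : \sum_(c <- s) diff_at (pder c F) z x * y c =
    \sum_(c <- s) \sum_(d <- s) pder d (pder c F) z * x d * y c.
  rewrite big_seq [RHS]big_seq; apply: eq_bigr => c cs; rewrite -mulr_suml.
  congr (_ * _); apply: diff_atE us _ => d ds.
  rewrite (fsm_schwarz _ _ fF Az).
  have Z : {in A, pder d F =1 (fun=> 0)} by move=> w; rewrite inE => Aw; exact: F0.
  by rewrite (fsm_pder_ext c oA Z Az); exact: pder_const.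
rewrite !S [X in _ - (X + _)]exchange_big /=.
under [X in _ - (X + _)]eq_bigr => c _ do
  (under eq_bigr => d _ do rewrite (fsm_schwarz _ _ fF Az) mulrAC).
by rewrite opprD addrACA subrr add0r -sumrB; apply: eq_bigr => c _; rewrite mulrBr.
Qed.

End Def.
End FinSmooth.

(** * Multi-indices *)

Section FinSmoothComp.
Context {R : realType} {I I' : choiceType}.
Variables (A : set (I -> R)) (A' : set (I' -> R)) (F : (I -> R) -> R)
  (g : (I' -> R) -> I -> R).

(** [A] is a cylinder over finitely many coordinates, so only finitely many components of [g] have
    to be controlled. *)
Lemma fopen_preim : fopen A -> fopen A' -> (forall d, fsm A' (g ^~ d)) ->
  fopen (A' `&` g @^-1` A).
Proof.
move=> [s [us oA]] oA' fg.
have [s' [us' oA2 Cg]] := fsm_common oA' (fun d (_ : d \in s) => fg d).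
exists s'; split=> // z [Az Agz].
have [e1 e10 H1] := oA2 z Az; have [e2 e20 H2] := oA _ Agz.
have [d d0 H] : exists2 d : R, 0 < d & forall c, c \in s -> forall w, A' w ->
    near_in [set` s'] d z w -> `|g w c - g z c| < e2.
  apply: (@seq_delta R _ s (fun c d => forall w, A' w ->
    near_in [set` s'] d z w -> `|g w c - g z c| < e2)).
    by move=> c x y yx K w Aw wz; apply: K => //; apply: near_in_sub wz.
  by move=> c cs; have [d d0 K] := Ck_cont (Cg c cs 0) Az e20; exists d.
exists (Num.min d e1); first by rewrite lt_min d0.
move=> w wz; have Aw : A' w.
  by apply: H1; apply: near_in_sub wz => //; rewrite ge_min lexx orbT.
split=> //; apply: H2 => c cs; apply: H => //.
by apply: near_in_sub wz => //; rewrite ge_min lexx.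
Qed.

Hypotheses (fF : fsm A F) (fg : forall d, fsm A' (g ^~ d)).

Lemma fsm_comp : fopen A' -> (forall z, A' z -> A (g z)) -> fsm A' (F \o g).
Proof.
move=> oA' gA; have [s [us oA CF]] := fF.
have [s' [us' oA2 Cg]] := fsm_common oA' (fun d (_ : d \in s) => fg d).
exists s'; split=> // k; apply: (Ck_comp us oA (CF k) oA2) => //.
by move=> d ds; exact: Cg.
Qed.

Lemma diff_at_comp z v : fopen A' -> A' z -> A (g z) ->
  diff_at (F \o g) z v = diff_at F (g z) (fun d => diff_at (g ^~ d) z v).
Proof.
move=> oA' Az Agz; have [s [us oA CF F0]] := fsmP fF.
have [s' [us' H]] := diff_at_seq oA' (fun d (_ : d \in s) => fg d).
have P c : pder c (F \o g) z = \sum_(d <- s) pder d F (g z) * pder c (g ^~ d) z.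
  apply: pder_is_derive.
  have := @chain_curve _ _ s A F (fun t => g (upd z c t)) (z c)
    (fun d => pder c (g ^~ d) z) oA (CF 1) us; rewrite /= upd_id; apply=> //.
  by move=> d ds; exact: fsm_is_derive (fg d) Az.
rewrite (diff_atE _ us); last by move=> c; exact: F0.
rewrite (diff_atE _ us') => [|c cs]; last first.
  by rewrite P big1_seq // => d /= ds; have [-> //] := H d ds z Az; rewrite mulr0.
under eq_bigr do rewrite P mulr_suml.
rewrite exchange_big /= big_seq [RHS]big_seq; apply: eq_bigr => d ds.
have [_ ->] := H d ds z Az; rewrite mulr_sumr.
by apply: eq_bigr => c _; rewrite mulrA.
Qed.

End FinSmoothComp.

Lemma fopenT (R : realType) (I : choiceType) : fopen [set: I -> R].
Proof. by exists [::]; split=> // z _; exists 1. Qed.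

Section MultiIndex.
Context {X : finType}.
Implicit Types (K : mi X).

Lemma mi_succC K i j : mi_succ (mi_succ K i) j = mi_succ (mi_succ K j) i.
Proof. by apply/ffunP => x; rewrite !ffunE addnAC. Qed.

Lemma msize_succ K i : msize (mi_succ K i) = (msize K).+1.
Proof.
rewrite /msize; under eq_bigr do rewrite ffunE.
rewrite big_split /= -[RHS]addn1; congr (_ + _)%N.
by rewrite (bigD1 i) //= eqxx big1 ?addn0 // => j /negbTE ->.
Qed.

(** Reduces statements at all orders to the addition of one derivative, although [iterd] groups the
    derivatives by variable. *)
Lemma mi_ind (P : mi X -> Prop) : P (mi0 : mi X) ->
  (forall K i, P K -> P (mi_succ K i)) -> forall K, P K.
Proof.
move=> P0 PS K; move: {2}(msize K) (erefl (msize K)) => n.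
elim: n K => [|n IH] K nK.
  suff -> : K = mi0 by [].
  apply/ffunP => i; rewrite ffunE; apply/eqP; rewrite -leqn0 -nK /msize.
  by rewrite (bigD1 i) //= leq_addr.
have [i Ki] : exists i, (0 < K i)%N.
  apply: contrapT => H; move: nK; rewrite /msize big1 // => i _.
  by apply/eqP; rewrite -leqn0 leqNgt; apply/negP => Ki; apply: H; exists i.
set K' : mi X := [ffun j => (K j - (j == i))%N].
have KE : K = mi_succ K' i.
  apply/ffunP => j; rewrite !ffunE; case: eqP => [->|_]; last by rewrite subn0 addn0.
  by rewrite subnK.
rewrite KE; apply/PS/IH/eqP; rewrite -eqSS -(msize_succ _ i) -KE.
exact/eqP.
Qed.

Section Iterd.
Context {R : realType} {T : Type}.
Variables (A : set T) (P : (T -> R) -> Prop) (D : X -> (T -> R) -> T -> R).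
Hypotheses (PD : forall i F, P F -> P (D i F))
  (Dext : forall i F G, {in A, F =1 G} -> {in A, D i F =1 D i G})
  (DC : forall i j F, P F -> {in A, D i (D j F) =1 D j (D i F)}).

Lemma iterd0 F : iterd D (mi0 : mi X) F = F.
Proof.
by rewrite /iterd; elim: (enum X) => //= i s ->; rewrite ffunE.
Qed.

Let P_iter i n F : P F -> P (iter n (D i) F).
Proof. by move=> PF; elim: n => //= n IH; exact: PD. Qed.

Let iter_ext i n F G : {in A, F =1 G} -> {in A, iter n (D i) F =1 iter n (D i) G}.
Proof. by move=> FG; elim: n => //= n IH; exact: Dext. Qed.

Lemma iterd_class K F : P F -> P (iterd D K F).
Proof. by move=> PF; rewrite /iterd; elim: (enum X) => //= i s; exact: P_iter. Qed.

Lemma iterd_ext K F G : {in A, F =1 G} -> {in A, iterd D K F =1 iterd D K G}.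
Proof. by move=> FG; rewrite /iterd; elim: (enum X) => //= i s; exact: iter_ext. Qed.

Let iter_comm i j n F : P F -> {in A, iter n (D j) (D i F) =1 D i (iter n (D j) F)}.
Proof.
move=> PF; elim: n => //= n IH z zA.
by rewrite (Dext _ IH) // DC //; exact: P_iter.
Qed.

(** [iterd] applies the operators in the order of [enum X], so the additional [D i] sits in the
    middle and is commuted outwards past the [D j] listed before [i]. The class [P] keeps every
    function met on the way in the domain where commutation holds. *)
Lemma iterd_succ K i F : P F -> {in A, iterd D (mi_succ K i) F =1 D i (iterd D K F)}.
Proof.
move=> PF; rewrite /iterd.
have Pf s : P (foldr (fun i => iter (K i) (D i)) F s).
  by elim: s => //= j s; exact: P_iter.
have H (s : seq X) : uniq s ->
    (i \notin s -> foldr (fun i0 => iter (mi_succ K i i0) (D i0)) F s =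
                   foldr (fun i => iter (K i) (D i)) F s) /\
    (i \in s -> {in A, foldr (fun i0 => iter (mi_succ K i i0) (D i0)) F s =1
                  D i (foldr (fun i => iter (K i) (D i)) F s)}).
  elim: s => //= j s IH /andP[js us]; have [IH1 IH2] := IH us.
  rewrite !inE; split.
    rewrite negb_or => /andP[ij /IH1 ->].
    by rewrite ffunE eq_sym (negbTE ij) addn0.
  have [-> _|ij /= iis z zA] := eqVneq i j.
    rewrite ffunE eqxx addn1 iterS.
    suff -> : foldr (fun i0 => iter (mi_succ K j i0) (D i0)) F s =
              foldr (fun i => iter (K i) (D i)) F s by [].
    have: {in s, forall x, mi_succ K j x = K x}.
      move=> x xs; rewrite ffunE; case: eqP => [xj|]; last by rewrite addn0.
      by rewrite -xj xs in js.
    elim: (s) => //= x l IHl H; rewrite H ?mem_head // IHl // => y yl.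
    by apply: H; rewrite inE yl orbT.
  rewrite ffunE eq_sym (negbTE ij) addn0 (iter_ext _ _ (IH2 iis)) //.
  by rewrite iter_comm.
by have [_] := H (enum X) (enum_uniq _); apply; rewrite mem_enum.
Qed.

Lemma iterd_succr K i F : P F -> {in A, iterd D (mi_succ K i) F =1 iterd D K (D i F)}.
Proof.
move=> PF; elim/mi_ind: K => [|K j IH] z zA.
  by rewrite iterd_succ // !iterd0.
rewrite mi_succC iterd_succ // (Dext _ IH) // -iterd_succ //; exact: PD.
Qed.

End Iterd.
End MultiIndex.

(** * Total derivatives *)

Section JetCalculus.
Context {R : realType} {X : finType} {q : nat}.
Local Notation J := (jet R X q).
Implicit Types (A : set J) (F G : J -> R).

Lemma finite_ord_le m : finite_set (@ord_le X q m).
Proof.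
pose f (t : (X + 'I_q * {ffun X -> 'I_m.+1})%type) : coord X q :=
  match t with inl i => inl i | inr (al, K) => inr (al, [ffun i => K i : nat]) end.
apply: (@sub_finite_set _ _ (f @` [set: _])); last first.
  exact/finite_image/finite_finset.
move=> [i|[al K]] /= Km; first by exists (inl i).
exists (inr (al, [ffun i => inord (K i)])) => //=; congr (inr (_, _)).
apply/ffunP => i; rewrite !ffunE inordK // ltnS; apply: leq_trans Km.
by rewrite /msize (bigD1 i) //= leq_addr.
Qed.

Lemma ord_le_sub m m' : (m <= m')%N -> @ord_le X q m `<=` ord_le m'.
Proof. by move=> mm [i|[al K]] //= /leq_trans; apply. Qed.

Lemma seq_ord_le (s : seq (coord X q)) : exists m, [set` s] `<=` ord_le m.
Proof.
elim: s => [|c s [m H]]; first by exists 0%N.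
pose k := if c is inr k then msize k.2 else 0%N.
exists (maxn k m) => x /=; rewrite inE => /orP[/eqP ->|xs].
  by rewrite /k; case: (c) => //= -[al K]; rewrite leq_max leqnn.
by apply: ord_le_sub (H x xs); rewrite leq_max leqnn orbT.
Qed.

Lemma fsm_ord_le A F : fsm A F -> exists m0, forall m, (m0 <= m)%N ->
  open_in (ord_le m) A /\ smooth_on (ord_le m) A F.
Proof.
move=> [s [us oA CF]]; have [m0 sm] := seq_ord_le s; exists m0 => m mm.
have sm' : [set` s] `<=` @ord_le X q m by apply: subset_trans sm _; exact: ord_le_sub.
split; first exact: open_in_sub oA.
by apply/smooth_onP => k; apply: Ck_sub (CF k).
Qed.

Lemma smooth_on_fsm m A F : fopen A -> smooth_on (ord_le m) A F -> fsm A F.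
Proof.
move=> [s [us oA]] /smooth_onP CF; have [t [ut E]] := finite_uniq_seq (finite_ord_le m).
exists (undup (s ++ t)); split; first exact: undup_uniq.
  by apply: open_in_sub oA => x /=; rewrite mem_undup mem_cat => ->.
by move=> k; apply: Ck_sub (CF k) => // x; rewrite E /= mem_undup mem_cat orbC => ->.
Qed.

Definition shift_coord (i : X) (c : coord X q) : coord X q :=
  match c with inl j => inl j | inr (al, K) => inr (al, mi_succ K i) end.

Definition Dvec (i : X) (z : J) : coord X q -> R := fun c =>
  match c with inl j => (j == i)%:R | inr _ => z (shift_coord i c) end.

Lemma tderE A F i z : fsm A F -> A z -> tder i F z = diff_at F z (Dvec i z).
Proof.
move=> /fsmP[s [us oA CF F0]] Az.
pose t : seq ('I_q * mi X) := undup (pmap (fun c => if c is inr k then Some k else None) s).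
have ut : uniq t by exact: undup_uniq.
have tP k : k \notin t -> pder (inr k) F z = 0.
  rewrite mem_undup => kt; apply: F0 => //; apply: contra kt => ks.
  by rewrite mem_pmap; apply/mapP; exists (inr k).
rewrite /tder (@sum_fsT _ _ t) //; last by move=> k /tP ->; rewrite mulr0.
rewrite (@diff_atE _ _ _ _ _ (map inl (enum X) ++ map inr t)); last first.
- move=> [j|k]; rewrite mem_cat negb_or => /andP[H1 H2].
    by case/negP: H1; apply/mapP; exists j; rewrite ?mem_enum.
  by apply: tP; apply: contra H2 => kt; apply/mapP; exists k.
- have u1 : uniq (map inl (enum X) : seq (coord X q)).
    by rewrite map_inj_uniq ?enum_uniq // => ? ? [].
  have u2 : uniq (map inr t : seq (coord X q)) by rewrite map_inj_uniq // => ? ? [].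
  rewrite cat_uniq u1 u2 andbT /=.
  by apply/hasPn => c /mapP[k _ ->]; apply/negP => /mapP[].
rewrite big_cat /= !big_map; congr (_ + _).
  rewrite -enumT big_enum (bigD1 i) //= eqxx mulr1 big1 ?addr0 // => j /negbTE ->.
  by rewrite mulr0.
by apply: eq_bigr => -[al K] _; rewrite mulrC.
Qed.

Lemma fsm_Dvec A i c : fopen A -> fsm A (Dvec i ^~ c).
Proof. by case: c => [j|[al K]] oA; [exact: fsm_cst|exact: fsm_coord]. Qed.

Lemma fsm_tder A i F : fsm A F -> fsm A (tder i F).
Proof.
move=> fF; apply: (@fsm_ext _ _ _ (fun z => diff_at F z (Dvec i z))).
  by move=> z; rewrite inE => Az; rewrite (tderE _ fF Az).
by apply: fsm_diff_at => // c; apply: fsm_Dvec; exact: fsm_fopen fF.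
Qed.

Lemma tder_ext A i F G : fopen A -> {in A, F =1 G} -> {in A, tder i F =1 tder i G}.
Proof.
move=> oA FG z; rewrite inE => Az; rewrite /tder (fsm_pder_ext _ oA FG Az); congr (_ + _).
by apply: eq_fsbigr => k _; rewrite (fsm_pder_ext _ oA FG Az).
Qed.

Lemma tderD A i F G z : fsm A F -> fsm A G -> A z ->
  tder i (fun y => F y + G y) z = tder i F z + tder i G z.
Proof.
move=> fF fG Az; rewrite !(tderE _ _ Az) ?(diff_atD _ fF fG Az) //.
exact: fsmD.
Qed.

Lemma tderM A i F G z : fsm A F -> fsm A G -> A z ->
  tder i (fun y => F y * G y) z = tder i F z * G z + F z * tder i G z.
Proof.
move=> fF fG Az; rewrite !(tderE _ _ Az) ?(diff_atM _ fF fG Az) //.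
exact: fsmM.
Qed.

Lemma tder_sum A i (T : eqType) (l : seq T) (P : pred T) (F : T -> J -> R) z :
  fopen A -> (forall t, t \in l -> P t -> fsm A (F t)) -> A z ->
  tder i (fun y => \sum_(t <- l | P t) F t y) z = \sum_(t <- l | P t) tder i (F t) z.
Proof.
move=> oA H Az; rewrite (tderE _ (fsm_sum oA H) Az) (diff_at_sum _ oA H Az).
rewrite big_seq_cond [RHS]big_seq_cond; apply: eq_bigr => t /andP[tl Pt].
by rewrite (tderE _ (H t tl Pt) Az).
Qed.

(** On [x] both fields are constant. Along [u_K] the commutator is the difference of the coordinates
    reached by adding [i] and [j] to [K] in either order, hence 0. *)
Lemma tder_comm A i j F z : fsm A F -> A z -> tder i (tder j F) z = tder j (tder i F) z.
Proof.
move=> fF Az; have oA := fsm_fopen fF.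
have E k : {in A, tder k F =1 (fun w => diff_at F w (Dvec k w))}.
  by move=> w; rewrite inE => Aw; exact: tderE fF Aw.
have fD k c := fsm_Dvec k c oA.
have fDF k := fsm_diff_at fF (fD k).
rewrite (tder_ext i oA (E j)) ?inE // (tder_ext j oA (E i)) ?inE //.
rewrite !(tderE _ (fDF _) Az); apply/eqP; rewrite -subr_eq0.
rewrite (vector_field_commutator fF (fD i) (fD j) Az); apply/eqP.
rewrite -[RHS](diff_at_0 F z); congr diff_at; apply/funext => -[k|[al K]].
  by rewrite !diff_at_cst subrr.
rewrite !diff_at_coord /= mi_succC subrr //.
Qed.

Section IterdTder.
Context {A : set J}.
Hypothesis oA : fopen A.

Lemma fsm_iterd K F : fsm A F -> fsm A (iterd tder K F).
Proof. by apply: iterd_class => i G; exact: fsm_tder. Qed.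

Lemma iterd_tder_ext K F G : {in A, F =1 G} -> {in A, iterd tder K F =1 iterd tder K G}.
Proof. by apply: iterd_ext => i F' G'; exact: tder_ext. Qed.

Lemma iterd_tder_succ K i F z : fsm A F -> A z ->
  iterd tder (mi_succ K i) F z = tder i (iterd tder K F) z.
Proof.
move=> fF Az.
have C j k G : fsm A G -> {in A, tder j (tder k G) =1 tder k (tder j G)}.
  by move=> fG w; rewrite inE => Aw; exact: tder_comm fG Aw.
exact: (iterd_succ (@fsm_tder A) (fun j G G' => @tder_ext A j G G' oA) C K i fF (mem_set Az)).
Qed.

Lemma iterd_tder_succr K i F z : fsm A F -> A z ->
  iterd tder (mi_succ K i) F z = iterd tder K (tder i F) z.
Proof.
move=> fF Az.
have C j k G : fsm A G -> {in A, tder j (tder k G) =1 tder k (tder j G)}.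
  by move=> fG w; rewrite inE => Aw; exact: tder_comm fG Aw.
exact: (iterd_succr (@fsm_tder A) (fun j G G' => @tder_ext A j G G' oA) C K i fF (mem_set Az)).
Qed.

End IterdTder.

Section Prolongation.
Variables (A' : set J) (f : 'I_q -> J -> R).
Hypothesis ff : forall al, fsm A' (f al).
Hypothesis oA' : fopen A'.

Lemma fsm_prol c : fsm A' (prol f ^~ c).
Proof. by case: c => [i|[al K]]; [exact: fsm_coord|exact: fsm_iterd]. Qed.

Lemma prol_succ al K i z : A' z ->
  prol f z (inr (al, mi_succ K i)) = tder i (fun w => prol f w (inr (al, K))) z.
Proof. exact: iterd_tder_succ. Qed.

(** The differential of [prol f] carries the vector [D_i] at [z] to the vector [D_i] at [prol f z];
    along [u_K] this is the recursion [prol_succ]. *)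
Lemma tder_prol A F i z : fsm A F -> A' z -> A (prol f z) ->
  tder i (F \o prol f) z = tder i F (prol f z).
Proof.
move=> fF Az Afz; have oA := fsm_fopen fF.
have oB := fopen_preim oA oA' fsm_prol.
have fB d : fsm (A' `&` prol f @^-1` A) (prol f ^~ d).
  by apply: fsm_sub (fsm_prol d) => // w [].
have fFB := fsm_comp fF fB oB (fun w (H : (A' `&` prol f @^-1` A) w) => proj2 H).
rewrite (tderE _ fFB) // (tderE _ fF) // (diff_at_comp fF fsm_prol) //.
congr diff_at; apply/funext => -[j|[al K]]; first by rewrite diff_at_coord.
by rewrite -(tderE _ (fsm_prol _) Az) /= -prol_succ.
Qed.

End Prolongation.

Section Sections.
Variables (W : set (X -> R)) (u : 'I_q -> (X -> R) -> R).
Hypotheses (oW : fopen W) (fu : forall al, fsm W (u al)).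

Lemma fsm_iterd_pder K (f : (X -> R) -> R) : fsm W f -> fsm W (iterd pder K f).
Proof. by apply: iterd_class => i G; exact: fsm_pder. Qed.

Lemma iterd_pder_succ K i (f : (X -> R) -> R) y : fsm W f -> W y ->
  iterd pder (mi_succ K i) f y = pder i (iterd pder K f) y.
Proof.
move=> ff Wy.
have E j (G G' : (X -> R) -> R) : {in W, G =1 G'} -> {in W, pder j G =1 pder j G'}.
  by move=> GG w; rewrite inE => Ww; exact: fsm_pder_ext oW GG Ww.
have C j k (G : (X -> R) -> R) : fsm W G -> {in W, pder j (pder k G) =1 pder k (pder j G)}.
  by move=> fG w; rewrite inE => Ww; exact: fsm_schwarz fG Ww.
have P j (G : (X -> R) -> R) : fsm W G -> fsm W (pder j G) by exact: fsm_pder.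
have := @iterd_succ X R (X -> R) W (fsm W) pder P E C K i f ff y (mem_set Wy).
by [].
Qed.

Lemma fsm_jsec c : fsm W (jsec u ^~ c).
Proof. by case: c => [i|[al K]]; [exact: fsm_coord|exact: fsm_iterd_pder]. Qed.

(** The graph [y |-> jsec u y] has [D_i] as its velocity in direction [y_i]. *)
Lemma pder_jsec A F i y : fsm A F -> W y -> A (jsec u y) ->
  pder i (F \o jsec u) y = tder i F (jsec u y).
Proof.
move=> fF Wy Auy; rewrite -diff_at_delta (diff_at_comp fF fsm_jsec) // (tderE _ fF) //.
congr diff_at; apply/funext => -[j|[al K]]; first by rewrite diff_at_coord.
by rewrite diff_at_delta /= iterd_pder_succ.
Qed.

End Sections.

End JetCalculus.

(** * Jets with the additional variable tau *)

Section TauJets.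
Context {R : realType} {p q : nat}.
Local Notation J := (jet R 'I_p q).
Local Notation Jtau := (jet R (option 'I_p) q).
Implicit Types (A : set J) (F : J -> R).

Lemma xmi_succ k (K : mi 'I_p) i : xmi k (mi_succ K i) = mi_succ (xmi k K) (Some i).
Proof. by apply/ffunP => -[j|]; rewrite !ffunE ?addn0 //= (inj_eq Some_inj). Qed.

Lemma xmi_succN k (K : mi 'I_p) : xmi k.+1 K = mi_succ (xmi k K) None.
Proof. by apply/ffunP => -[j|]; rewrite !ffunE /= ?addn0 ?addn1. Qed.

Lemma xmi0 : xmi 0 (mi0 : mi 'I_p) = mi0.
Proof. by apply/ffunP => -[j|]; rewrite !ffunE. Qed.

Definition res_coord (c : coord 'I_p q) : coord (option 'I_p) q :=
  match c with inl i => inl (Some i) | inr (al, K) => inr (al, xmi 0 K) end.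

Lemma resE (z : Jtau) c : res z c = z (res_coord c).
Proof. by case: c => [i|[al K]]. Qed.

Lemma fsm_res (B : set Jtau) c : fopen B -> fsm B (@res R p q ^~ c).
Proof. by case: c => [i|[al K]] oB; exact: fsm_coord. Qed.

Lemma fopen_res A : fopen A -> fopen (@res R p q @^-1` A).
Proof.
move=> oA; rewrite -[_ @^-1` _]setTI; apply: fopen_preim => //; first exact: fopenT.
by move=> d; apply: fsm_res; exact: fopenT.
Qed.

Lemma fsm_comp_res A F : fsm A F -> fsm (@res R p q @^-1` A) (F \o res).
Proof.
move=> fF; have oA := fopen_res (fsm_fopen fF).
by apply: (fsm_comp fF) => // c; exact: fsm_res.
Qed.

(** The first tau-derivatives read as a tangent vector at [res z]: the velocity of a family of jets,
    with no component along [x] because [x] does not vary with tau. *)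
Definition tau_vec (z : Jtau) : coord 'I_p q -> R := fun c =>
  match c with inl i => 0 | inr (al, K) => z (inr (al, xmi 1 K)) end.

Lemma tder_res_Some A F i z : fsm A F -> A (res z) ->
  tder (Some i) (F \o res) z = tder i F (res z).
Proof.
move=> fF Az; have oA := fopen_res (fsm_fopen fF).
rewrite (tderE _ (fsm_comp_res fF)) // (tderE _ fF) //.
rewrite (diff_at_comp (A' := setT) fF _ _ (fopenT _ _)) //; last first.
  by move=> c; apply: fsm_res; exact: fopenT.
congr diff_at; apply/funext => c; have -> : @res R p q ^~ c = @^~ (res_coord c).
  by apply/funext => w; rewrite resE.
rewrite diff_at_coord; case: c => [j|[al K]] /=; first by rewrite (inj_eq Some_inj).
by rewrite xmi_succ.
Qed.

Lemma tder_res_None A F z : fsm A F -> A (res z) ->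
  tder None (F \o res) z = diff_at F (res z) (tau_vec z).
Proof.
move=> fF Az; have oA := fopen_res (fsm_fopen fF).
rewrite (tderE _ (fsm_comp_res fF)) //.
rewrite (diff_at_comp (A' := setT) fF _ _ (fopenT _ _)) //; last first.
  by move=> c; apply: fsm_res; exact: fopenT.
congr diff_at; apply/funext => c; have -> : @res R p q ^~ c = @^~ (res_coord c).
  by apply/funext => w; rewrite resE.
by rewrite diff_at_coord; case: c => [j|[al K]] //=; rewrite -xmi_succN.
Qed.

Lemma iterd_res A F K z : fsm A F -> A (res z) ->
  iterd tder (xmi 0 K) (F \o res) z = iterd tder K F (res z).
Proof.
move=> fF; elim/(@mi_ind 'I_p): K z => [|K i IH] z Az; first by rewrite xmi0 !iterd0.
have oA := fsm_fopen fF; have oA' := fopen_res oA.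
rewrite xmi_succ (iterd_tder_succ oA' _ _ (fsm_comp_res fF)) //.
rewrite (iterd_tder_succ oA) // -(tder_res_Some _ (fsm_iterd K fF)) //.
by apply: (tder_ext _ oA') => [w|]; rewrite inE //; exact: IH.
Qed.

(** The tau-derivative may be taken after [D_K], where it acts on a function of [res z] and is a
    differential along [tau_vec z]. *)
Lemma iterd_res1 A F K z : fsm A F -> A (res z) ->
  iterd tder (xmi 1 K) (F \o res) z = diff_at (iterd tder K F) (res z) (tau_vec z).
Proof.
move=> fF Az; have oA := fsm_fopen fF; have oA' := fopen_res oA.
rewrite xmi_succN (iterd_tder_succ oA' _ _ (fsm_comp_res fF)) //.
rewrite -(tder_res_None (fsm_iterd K fF)) //.
by apply: (tder_ext _ oA') => [w|]; rewrite inE // => Aw; exact: iterd_res fF Aw.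
Qed.

End TauJets.

(** * Gluing of locally smooth functions *)

Section LocalSmooth.
Context {R : realType} {I : choiceType}.
Implicit Types (S : set I) (A U : set (I -> R)) (F : (I -> R) -> R).

Definition depends_on S U F := forall z w, U z -> U w -> (forall c, S c -> z c = w c) ->
  F z = F w.

Lemma depends_on_pder S U F c : open_in S U -> depends_on S U F ->
  depends_on S U (pder c F).
Proof.
move=> oU dF z w Uz Uw zw; have [Sc|Sc] := pselect (S c); last first.
  by rewrite (pder_agree oU Uz _ Sc) ?(pder_agree oU Uw _ Sc) // => v Uv H; exact/esym/dF.
apply: pder_local (zw c Sc) _.
have := open_upd c oU Uw; rewrite -(zw c Sc) => Uw'.
near=> t; apply: dF.
- by near: t; exact: open_upd oU Uz.
- by near: t.
- by move=> d Sd; rewrite /upd; case: eqP => // _; exact: zw.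
Unshelve. all: by end_near. Qed.

(* The coordinates involved may vary from one local domain to the other; the
   dependence on [S] alone makes them uniform. *)
Lemma local_Ck k S U F : open_in S U -> depends_on S U F ->
  (forall z, U z -> exists B, [/\ B z, B `<=` U & fsm B F]) -> Ck k S U F.
Proof.
move=> oU; have lc F' : depends_on S U F' ->
    (forall z, U z -> exists B, [/\ B z, B `<=` U & fsm B F']) -> cont_in S U F'.
  move=> dF lF z Uz e e0; have [B [Bz BU [s [us oB CF]]]] := lF z Uz.
  have [d1 d10 H1] := oB z Bz; have [d2 d20 H2] := Ck_cont (CF 0) Bz e0.
  have [d3 d30 H3] := oU z Uz.
  have m0 : 0 < Num.min d1 (Num.min d2 d3) by rewrite !lt_min d10 d20.
  exists (Num.min d1 (Num.min d2 d3)) => // w Uw wz.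
  (* [w] is close to [z] only in the coordinates of [S], while [B] may constrain others. The point
     [v] follows [w] on [S] and [z] elsewhere: it lies in [B], and [F'] does not distinguish it from
     [w]. *)
  pose v c := if `[< S c >] then w c else z c.
  have vz S' : near_in S' (Num.min d1 (Num.min d2 d3)) z v.
    move=> c _; rewrite /v; case: asboolP => [Sc|_]; first exact: wz.
    by rewrite subrr normr0.
  have Bv : B v by apply: H1; apply: near_in_sub (vz [set` s]); rewrite // ge_min lexx.
  have -> : F' w = F' v by apply: dF => // [|c Sc]; [exact: BU|rewrite /v asboolT].
  apply: H2 => //; apply: near_in_sub (vz [set` s]) => //.
  by rewrite !ge_min lexx orbT.
elim: k F => [|k IH] F dF lF; first by split=> //; exact: lc.
split; first exact: lc.
move=> c; split=> [z Uz|].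
  by have [B [Bz BU fB]] := lF z Uz; apply: ex_derive; exact: fsm_is_derive fB Bz.
apply: IH; first exact: depends_on_pder.
by move=> z Uz; have [B [Bz BU fB]] := lF z Uz; exists B; split=> //; exact: fsm_pder.
Qed.

Lemma local_smooth S U F : open_in S U -> depends_on S U F ->
  (forall z, U z -> exists B, [/\ B z, B `<=` U & fsm B F]) -> smooth_on S U F.
Proof. by move=> oU dF lF; apply/smooth_onP => k; exact: local_Ck. Qed.

Lemma local_fsm S U F : finite_set S -> open_in S U -> depends_on S U F ->
  (forall z, U z -> exists B, [/\ B z, B `<=` U & fsm B F]) -> fsm U F.
Proof. by move=> fS oU dF lF; apply: (fsm_fin fS oU); exact: local_smooth. Qed.

Lemma smooth_depends S U F : smooth_on S U F -> depends_on S U F.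
Proof.
move=> sF z w Uz Uw zw; have [cF _] := sF [::].
exact: cont_in_agree cF Uz Uw zw.
Qed.

End LocalSmooth.

(** * Functions of two groups of variables, one of them frozen *)

Section Join.
Context {R : realType} {I1 I2 : choiceType}.

Definition join (s : I1 -> R) (z : I2 -> R) : (I1 + I2)%type -> R :=
  fun c => match c with inl a => s a | inr b => z b end.

Lemma join_split (x : (I1 + I2)%type -> R) : join (x \o inl) (x \o inr) = x.
Proof. by apply/funext => -[]. Qed.

Lemma fsm_join_r (B : set (I2 -> R)) s c : fopen B -> fsm B ((fun z => join s z) ^~ c).
Proof. by case: c => [a|b] oB; [exact: fsm_cst|exact: fsm_coord]. Qed.

Lemma fsm_join_l (B : set (I1 -> R)) z c : fopen B -> fsm B ((fun s => join s z) ^~ c).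
Proof. by case: c => [a|b] oB; [exact: fsm_coord|exact: fsm_cst]. Qed.

Variables (A : set ((I1 + I2)%type -> R)) (F : ((I1 + I2)%type -> R) -> R).
Hypothesis fF : fsm A F.

Lemma diff_at_join_r s z v : A (join s z) ->
  diff_at (fun z => F (join s z)) z v = diff_at F (join s z) (join (fun=> 0) v).
Proof.
move=> Az; have := diff_at_comp (A' := setT) (g := fun z => join s z) (z := z) fF
  (fun c => fsm_join_r s c (fopenT R I2)) v (fopenT R I2) Logic.I Az.
move=> ->; congr diff_at; apply/funext => -[a|b].
  by rewrite diff_at_cst.
by rewrite diff_at_coord.
Qed.

Lemma diff_at_join_l s z v : A (join s z) ->
  diff_at (fun s => F (join s z)) s v = diff_at F (join s z) (join v (fun=> 0)).
Proof.
move=> Az; have := diff_at_comp (A' := setT) (g := fun s => join s z) (z := s) fF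
  (fun c => fsm_join_l z c (fopenT R I1)) v (fopenT R I1) Logic.I Az.
move=> ->; congr diff_at; apply/funext => -[a|b].
  by rewrite diff_at_coord.
by rewrite diff_at_cst.
Qed.

Lemma pder_join_l s z a : A (join s z) ->
  pder a (fun s => F (join s z)) s = pder (inl a) F (join s z).
Proof.
move=> Az; rewrite -!diff_at_delta diff_at_join_l //; congr diff_at.
by apply/funext => -[].
Qed.

Lemma pder_join_r s z b : A (join s z) ->
  pder b (fun z => F (join s z)) z = pder (inr b) F (join s z).
Proof.
move=> Az; rewrite -!diff_at_delta diff_at_join_r //; congr diff_at.
by apply/funext => -[].
Qed.

Lemma fsm_slice_r s (B : set (I2 -> R)) : fopen B -> (forall z, B z -> A (join s z)) ->
  fsm B (fun z => F (join s z)).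
Proof. by move=> oB BA; apply: (fsm_comp fF) => // c; exact: fsm_join_r. Qed.

Lemma fsm_slice_l z (B : set (I1 -> R)) : fopen B -> (forall s, B s -> A (join s z)) ->
  fsm B (fun s => F (join s z)).
Proof. by move=> oB BA; apply: (fsm_comp fF) => // c; exact: fsm_join_l. Qed.

End Join.

Lemma fopen_join (R : realType) (I1 I2 : choiceType) (B : set (I1 -> R)) (C : set (I2 -> R)) :
  fopen B -> fopen C ->
  fopen [set s : (I1 + I2)%type -> R | B (s \o inl) /\ C (s \o inr)].
Proof.
move=> oB oC.
have H1 : fopen (setT `&` (fun s : (I1 + I2)%type -> R => s \o inl) @^-1` B).
  by apply: fopen_preim => // [|d]; [exact: fopenT|apply: fsm_coord; exact: fopenT].
have H2 : fopen (setT `&` (fun s : (I1 + I2)%type -> R => s \o inr) @^-1` C).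
  by apply: fopen_preim => // [|d]; [exact: fopenT|apply: fsm_coord; exact: fopenT].
have := fopenI H1 H2; rewrite !setTI; congr (fopen _).
Qed.

Section IterdProl.
Context {R : realType} {X : finType} {q : nat}.
Local Notation J := (jet R X q).
Variables (A' : set J) (f : 'I_q -> J -> R).
Hypothesis ff : forall al, fsm A' (f al).
Hypothesis oA' : fopen A'.

Lemma iterd_prol (A : set J) F K z : fsm A F -> A' z -> A (prol f z) ->
  iterd tder K (F \o prol f) z = iterd tder K F (prol f z).
Proof.
move=> fF; have oA := fsm_fopen fF; have fp := fsm_prol ff oA'.
have oB := fopen_preim oA oA' fp.
have fB : fsm (A' `&` prol f @^-1` A) (F \o prol f).
  by apply: (fsm_comp fF) => // [d|w []//]; apply: fsm_sub (fp d) => // w [].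
elim/(@mi_ind X): K z => [|K i IH] z Az Afz; first by rewrite !iterd0.
rewrite (iterd_tder_succ oB _ _ fB) // (iterd_tder_succ oA _ _ fF) //.
rewrite -(tder_prol ff oA' _ (fsm_iterd K fF)) //.
apply: (tder_ext i oB); last by rewrite inE.
by move=> w; rewrite inE => -[Aw Afw]; exact: IH.
Qed.

End IterdProl.

(** * The prolonged action *)

Section Action.
Context {R : realType} {r p q : nat} {G : lieGroup R r} (A : smooth_action G p q).
Local Notation J := (jet R 'I_p q).

Definition jdom : set J := [set z | adom A (base z)].

Lemma fopen_adom : fopen (adom A).
Proof. by apply: (fopen_fin (S := setT)); [exact: finite_finset|exact: act_open]. Qed.

Lemma fsm_base (B : set J) d : fopen B -> fsm B (@base R p q ^~ d).
Proof. by case: d => [i|al] oB; exact: fsm_coord. Qed.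

Lemma fopen_jdom : fopen jdom.
Proof.
rewrite -[jdom]setTI; apply: fopen_preim fopen_adom _ _; first exact: fopenT.
by move=> d; apply: fsm_base; exact: fopenT.
Qed.

(** The transition from a chart to itself has the whole chart image as its domain, which [lg_compat]
    declares open. *)
Lemma open_cimg k : open_in setT (cimg (atlas G k)).
Proof.
have [oC _] := lg_compat G k k; move: oC; congr (open_in _ _).
apply/seteqP; split=> [s []//|_ [g kg <-]]; split; first by exists g.
by rewrite /preimage /= lg_chartK.
Qed.

Lemma fopen_cimg k : fopen (cimg (atlas G k)).
Proof. by apply: (fopen_fin (S := setT)); [exact: finite_finset|exact: open_cimg]. Qed.

Lemma fsm_act_joint k al :
  fsm [set s : ('I_r + ('I_p + 'I_q))%type -> R | cimg (atlas G k) (s \o inl) /\ adom A (s \o inr)]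
    (fun s => act A (cinv (atlas G k) (s \o inl)) (s \o inr) al).
Proof.
have [s [us oA]] := fopen_join (fopen_cimg k) fopen_adom.
apply: (fsm_fin (S := setT)); [exact: finite_finset|exact: open_in_sub oA|].
exact: act_smooth.
Qed.

Definition act_jet (g : G) : 'I_q -> J -> R := fun al z => act A g (base z) al.

(** The prolonged action as a function of chart coordinates and jet coordinates together. Both the
    infinitesimals and the smoothness of [z |-> rho z . z] are derived from it. *)
Definition joint (k : nat) (c : coord 'I_p q) (s : ('I_r + coord 'I_p q)%type -> R) : R :=
  pact A (cinv (atlas G k) (s \o inl)) (s \o inr) c.

Definition joint_dom (k : nat) : set (('I_r + coord 'I_p q)%type -> R) :=
  [set s : ('I_r + coord 'I_p q)%type -> R | cimg (atlas G k) (s \o inl) /\ jdom (s \o inr)].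

Lemma fopen_joint_dom k : fopen (joint_dom k).
Proof. exact: fopen_join (fopen_cimg k) fopen_jdom. Qed.

Lemma fsm_joint0 k al : fsm (joint_dom k) (joint k (inr (al, mi0))).
Proof.
have E (s : ('I_r + coord 'I_p q)%type -> R) : joint k (inr (al, mi0)) s =
    act A (cinv (atlas G k) (s \o inl)) (base (s \o inr)) al.
  by rewrite /joint /= iterd0.
pose g (s : ('I_r + coord 'I_p q)%type -> R) := join (s \o inl) (base (s \o inr)).
rewrite (_ : joint _ _ = (fun s => act A (cinv (atlas G k) (s \o inl)) (s \o inr) al) \o g).
  apply: (fsm_comp (fsm_act_joint k al)) => //; last exact: fopen_joint_dom.
  by move=> [a|[i|be]]; apply: fsm_coord; exact: fopen_joint_dom.
by apply/funext => s; rewrite E.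
Qed.

Lemma chart_of (g : G) : exists k s, cimg (atlas G k) s /\ cinv (atlas G k) s = g.
Proof.
have [k kg] := lg_cover g; exists k, (cmap (atlas G k) g).
by split; [exists g|exact: lg_chartK].
Qed.

Lemma fsm_act_jet g al : fsm jdom (act_jet g al).
Proof.
have [k [s [ks <-]]] := chart_of g.
have := fsm_slice_r (fsm_joint0 k al) (s := s) fopen_jdom (fun z jz => conj ks jz).
apply: fsm_ext => z _; by rewrite /joint /= iterd0.
Qed.

Lemma fsm_pact g c : fsm jdom (pact A g ^~ c).
Proof. exact: (fsm_prol (fsm_act_jet g) fopen_jdom). Qed.

Lemma base_pact g z : base (pact A g z) = base_act (act A) g (base z).
Proof. by apply/funext => -[i|al] //=; rewrite iterd0. Qed.

Lemma jdom_pact g z : jdom z -> jdom (pact A g z).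
Proof. by rewrite /jdom /= base_pact; exact: act_dom. Qed.

Lemma pact_succ g al K i z : jdom z ->
  pact A g z (inr (al, mi_succ K i)) = tder i (fun w => pact A g w (inr (al, K))) z.
Proof. exact: (prol_succ (fsm_act_jet g) fopen_jdom). Qed.

Lemma tder_pact B F g i z : fsm B F -> jdom z -> B (pact A g z) ->
  tder i (F \o pact A g) z = tder i F (pact A g z).
Proof. exact: (tder_prol (fsm_act_jet g) fopen_jdom). Qed.

Lemma iterd_pact B F g K z : fsm B F -> jdom z -> B (pact A g z) ->
  iterd tder K (F \o pact A g) z = iterd tder K F (pact A g z).
Proof. exact: (iterd_prol (fsm_act_jet g) fopen_jdom). Qed.

(** The law is given for the dependent variables only; applying [D_K] to it, and moving [D_K]
    through the prolongation of [h], yields it for all derivatives. *)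
Lemma pactM g h z : jdom z -> pact A (g * h)%g z = pact A g (pact A h z).
Proof.
move=> jz; apply/funext => -[i|[al K]] //=.
rewrite -(iterd_pact _ (fsm_act_jet g al) jz); last exact: jdom_pact.
have H : {in jdom, act_jet (g * h)%g al =1 act_jet g al \o pact A h}.
  move=> w; rewrite inE => jw; rewrite /act_jet /= base_pact.
  by have := congr1 (fun f => f (inr al)) (act_M g h jw).
exact: (iterd_tder_ext fopen_jdom K H (mem_set jz)).
Qed.

Lemma iterd_coord al K (z : J) :
  iterd tder K (fun w : J => w (inr (al, mi0))) z = z (inr (al, K)).
Proof.
have oT := fopenT R (coord 'I_p q).
have fc := fsm_coord (inr (al, mi0)) oT.
elim/(@mi_ind 'I_p): K z => [|K i IH] z; first by rewrite iterd0.
rewrite (iterd_tder_succ oT _ _ fc) //.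
rewrite (tder_ext i oT (_ : {in setT, _ =1 @^~ (inr (al, K))})) ?inE //.
by rewrite (tderE _ (fsm_coord _ oT)) // diff_at_coord.
Qed.

Lemma pact1 z : jdom z -> pact A 1%g z = z.
Proof.
move=> jz; apply/funext => -[i|[al K]] //=; rewrite -[RHS]iterd_coord.
have H : {in jdom, act_jet 1%g al =1 (fun w : J => w (inr (al, mi0)))}.
  by move=> w; rewrite inE => jw; have := congr1 (fun f => f (inr al)) (act_1 jw).
exact: (iterd_tder_ext fopen_jdom K H (mem_set jz)).
Qed.

Lemma pactK g z : jdom z -> pact A g^-1%g (pact A g z) = z.
Proof. by move=> jz; rewrite -pactM // mulVg pact1. Qed.

(** Each further order is the derivative of the previous one along the field [D_i], extended by 0 in
    the group directions, so joint smoothness is inherited. *)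
Lemma fsm_joint k c : fsm (joint_dom k) (joint k c).
Proof.
case: c => [i|[al K]]; first by apply: fsm_coord; exact: fopen_joint_dom.
elim/(@mi_ind 'I_p): K => [|K i IH]; first exact: fsm_joint0.
apply: (@fsm_ext _ _ _ (fun s => diff_at (joint k (inr (al, K))) s
    (join (fun=> 0) (Dvec i (s \o inr))))).
  move=> s; rewrite inE => -[ks js]; rewrite /joint pact_succ //.
  rewrite (tderE _ (fsm_pact _ _) js).
  have := diff_at_join_r IH (s := s \o inl) (z := s \o inr) (Dvec i (s \o inr)).
  by rewrite join_split => <- //.
apply: fsm_diff_at => // -[a|c]; first by apply: fsm_cst; exact: fopen_joint_dom.
case: c => [j|[be L]]; first by apply: fsm_cst; exact: fopen_joint_dom.
by apply: fsm_coord; exact: fopen_joint_dom.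
Qed.

Section Infinitesimals.
Variable e : nat.
Hypothesis he : cdom (atlas G e) 1%g.
Local Notation s0 := (cmap (atlas G e) 1%g).

Lemma cimg_s0 : cimg (atlas G e) s0.
Proof. by exists 1%g. Qed.

Lemma joint_dom_s0 z : jdom z -> joint_dom e (join s0 z).
Proof. by split => //; exact: cimg_s0. Qed.

Lemma zetaE j z c : jdom z -> zeta A e j z c = pder (inl j) (joint e c) (join s0 z).
Proof.
by move=> jz; rewrite -(pder_join_l (fsm_joint e c)) //; exact: joint_dom_s0.
Qed.

Lemma fsm_zeta j c : fsm jdom (zeta A e j ^~ c).
Proof.
apply: (@fsm_ext _ _ _ (fun z => pder (inl j) (joint e c) (join s0 z))).
  by move=> z; rewrite inE => jz; rewrite zetaE.
apply: (fsm_slice_r (fsm_pder _ (fsm_joint e c)) fopen_jdom) => z.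
exact: joint_dom_s0.
Qed.

Lemma zeta_inl j z i : zeta A e j z (inl i) = 0.
Proof. exact: pder_const. Qed.

(** The prolongation formula for an infinitesimal that fixes [x]. On the product of chart and jet
    coordinates, the derivative in [a_j] commutes with [D_i], because the components of [D_i] do not
    involve the group coordinates. *)
Lemma zeta_succ j z al K i : jdom z ->
  zeta A e j z (inr (al, mi_succ K i)) = tder i (fun w => zeta A e j w (inr (al, K))) z.
Proof.
move=> jz; rewrite zetaE // (tderE _ (fsm_zeta _ _) jz).
have fo := fopen_joint_dom e; have jd := joint_dom_s0 jz.
set F := joint e (inr (al, K)); have fF : fsm (joint_dom e) F by exact: fsm_joint.
pose V (s : ('I_r + coord 'I_p q)%type -> R) := join (fun _ : 'I_r => 0) (Dvec i (s \o inr)).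
have fV c : fsm (joint_dom e) (V ^~ c).
  case: c => [a|[b|[be L]]]; [exact: fsm_cst|exact: fsm_cst|exact: fsm_coord].
have EF : {in joint_dom e, joint e (inr (al, mi_succ K i)) =1 (fun s => diff_at F s (V s))}.
  move=> s; rewrite inE => -[ks js]; rewrite {1}/joint pact_succ //.
  rewrite (tderE _ (fsm_pact _ _) js).
  have := diff_at_join_r fF (s := s \o inl) (z := s \o inr) (Dvec i (s \o inr)).
  by rewrite join_split => <- //.
rewrite (fsm_pder_ext _ fo EF jd) -diff_at_delta.
have fd c : fsm (joint_dom e) ((fun _ d => (d == inl j :> 'I_r + coord 'I_p q)%:R) ^~ c).
  exact: fsm_cst.
have := vector_field_commutator fF fd fV jd.
rewrite (_ : (fun c : ('I_r + coord 'I_p q)%type => _ - _) = fun=> 0); last first.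
  apply/funext => -[a|[b|[be L]]]; rewrite !diff_at_cst ?subrr //.
  by rewrite diff_at_coord subrr.
rewrite diff_at_0 => /subr0_eq ->.
have -> : (fun w => diff_at F w (fun d => (d == inl j)%:R)) = pder (inl j) F.
  by apply/funext => w; rewrite diff_at_delta.
have EZ : {in jdom, (fun w => zeta A e j w (inr (al, K))) =1
    (fun w => pder (inl j) F (join s0 w))}.
  by move=> w; rewrite inE => jw; rewrite zetaE.
rewrite (diff_at_ext _ fopen_jdom EZ jz).
by rewrite (diff_at_join_r (fsm_pder (inl j) fF)).
Qed.

End Infinitesimals.

End Action.

(** * Moving frames and the Adjoint representation *)

Lemma finite_mi (X : finType) m :
  exists s : seq (mi X), uniq s /\ forall K, (K \in s) = (msize K <= m)%N.
Proof.
have fS : finite_set [set K : mi X | (msize K <= m)%N].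
  pose f (K : {ffun X -> 'I_m.+1}) : mi X := [ffun i => K i : nat].
  apply: (@sub_finite_set _ _ (f @` [set: _])); last exact/finite_image/finite_finset.
  move=> K /= Km; exists [ffun i => inord (K i)] => //.
  apply/ffunP => i; rewrite !ffunE inordK // ltnS; apply: leq_trans Km.
  by rewrite /msize (bigD1 i) //= leq_addr.
have [s [us E]] := finite_uniq_seq fS; exists s; split=> // K.
apply/idP/idP => [Ks|Km]; first by have: [set` s] K by []; rewrite -E.
by have: [set K : mi X | (msize K <= m)%N] K by []; rewrite E.
Qed.

(** A term with [|K| <= m] involves [u_{Ki}], of order at most [m + 1]; for larger [K] the partial
    derivative vanishes. *)
Lemma tder_depends (R : realType) (X : finType) (q : nat) (A : set (jet R X q)) m F i :
  open_in (ord_le m) A -> depends_on (ord_le m) A F ->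
  depends_on (ord_le m.+1) A (tder i F).
Proof.
move=> oA dF z w Az Aw zw; rewrite /tder.
have zw' c : ord_le m c -> z c = w c by move=> /(ord_le_sub (leqnSn m)); exact: zw.
rewrite (depends_on_pder (inl i) oA dF Az Aw zw'); congr (_ + _).
apply: eq_fsbigr => -[al K] _ /=.
have [Km|Km] := leqP (msize K) m.
  rewrite (depends_on_pder _ oA dF Az Aw zw'); congr (_ * _); apply: zw => /=.
  by rewrite msize_succ.
have nS : ~ @ord_le X q m (inr (al, K)) by move=> /=; rewrite leqNgt Km.
rewrite (pder_agree oA Az _ nS) ?(pder_agree oA Aw _ nS) ?mulr0 // => v Av H;
  exact/esym/dF.
Qed.

Section Frame.
Context {R : realType} {r p q : nat} {G : lieGroup R r} (A : smooth_action G p q).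
Local Notation J := (jet R 'I_p q).

Lemma open_jdom m : open_in (ord_le m) (jdom A).
Proof.
move=> z Az; have [e e0 H] := act_open Az; exists e => // w wz; apply: H => -[i|al] _.
  by apply: (wz (inl i)).
apply: (wz (inr (al, mi0))) => /=.
by rewrite /msize big1 // => i _; rewrite ffunE.
Qed.

Lemma pact_depends g al K :
  depends_on (ord_le (msize K)) (jdom A) (fun z => pact A g z (inr (al, K))).
Proof.
elim/(@mi_ind 'I_p): K => [|K i IH] z w jz jw zw.
  rewrite /= !iterd0; congr (act A g _ al); apply/funext => -[j|be] /=; first exact: zw.
  by apply: zw => /=.
rewrite !pact_succ //; rewrite msize_succ in zw.
exact: (tder_depends i (open_jdom (msize K)) IH jz jw zw).
Qed.

Variables (n : nat) (U : set J).
Hypothesis Uopen : open_in (ord_le n) U.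

(* Smoothness of a map into the group, in a form that is stable under inversion:
   the local domains need not be open in the coordinates of order at most [n]. *)
Definition lie_smooth (h : J -> G) : Prop :=
  (forall z w, U z -> U w -> (forall c, ord_le n c -> z c = w c) -> h z = h w) /\
  forall z, U z -> exists k B, [/\ B z, B `<=` U, fopen B,
    (forall w, B w -> cdom (atlas G k) (h w)) &
    forall j, fsm B (fun w => cmap (atlas G k) (h w) j)].

Lemma smooth_to_lie_smooth h : smooth_to (atlas G) (ord_le n) U h -> lie_smooth h.
Proof.
move=> sh; split=> [z w Uz Uw zw|z Uz].
  have [k kz] := lg_cover (h z); have [oB sB] := sh k.
  have Bz : (U `&` h @^-1` cdom (atlas G k)) z by [].
  (* The set where [h] lands in the chart [k] is a cylinder, so [h w] lies in the same chart as
     [h z] and their coordinates can be compared. *)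
  have Bw := open_in_agree oB Bz zw.
  rewrite -(lg_chartK kz) -(lg_chartK (proj2 Bw)); congr cinv.
  by apply/funext => j; exact: (smooth_depends (sB j) Bz Bw zw).
have [k kz] := lg_cover (h z); have [oB sB] := sh k.
exists k, (U `&` h @^-1` cdom (atlas G k)); split.
- by [].
- by move=> w [].
- exact: fopen_fin (finite_ord_le _) oB.
- by move=> w [].
- by move=> j; exact: fsm_fin (finite_ord_le _) oB (sB j).
Qed.

Lemma lie_smoothV h : lie_smooth h -> lie_smooth (fun z => (h z)^-1%g).
Proof.
move=> [dh lh]; split=> [z w Uz Uw zw|z Uz]; first by rewrite (dh z w).
have [k [B [Bz BU oB hB fB]]] := lh z Uz.
have [l lz] := lg_cover (h z)^-1%g; have [oD sD] := lg_inv G k l.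
set D := cimg _ `&` _ in oD sD.
have fD : finite_set [set: 'I_r] by exact: finite_finset.
have fB' d : fsm B ((fun w => cmap (atlas G k) (h w)) ^~ d) by exact: fB.
have oD' := fopen_fin fD oD; have oB' := fopen_preim oD' oB fB'.
exists l, (B `&` (fun w => cmap (atlas G k) (h w)) @^-1` D); split.
- split=> //; split; first by exists (h z) => //; exact: hB.
  by rewrite /preimage /= lg_chartK //; exact: hB.
- by move=> w [Bw _]; exact: BU.
- by [].
- by move=> w [Bw [_]]; rewrite /preimage /= lg_chartK //; exact: hB.
- move=> j; have fj := fsm_fin fD oD (sD j).
  apply: (@fsm_ext _ _ _ ((fun s => cmap (atlas G l) (cinv (atlas G k) s)^-1%g j) \o
    (fun w => cmap (atlas G k) (h w)))).
    by move=> w; rewrite inE => -[Bw _] /=; rewrite lg_chartK //; exact: hB.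
  apply: (fsm_comp fj) => // [d|w []//]; apply: fsm_sub (fB' d) => // w [].
Qed.

(** Inserting a group-valued map into a function of group element and jet is a composition in each
    chart, with a block of coordinates that depends on the chart. The order bound on [psi] gives one
    finite block for all of [U], and the local pieces glue. *)
Lemma fsm_frame (psi : G -> J -> R) m (h : J -> G) (ga : J -> J) :
  (forall k, fsm (joint_dom A k) (fun s => psi (cinv (atlas G k) (s \o inl)) (s \o inr))) ->
  (forall g, depends_on (ord_le m) (jdom A) (psi g)) ->
  lie_smooth h -> (forall c, fsm U (ga ^~ c)) -> (forall z, U z -> jdom A (ga z)) ->
  fsm U (fun z => psi (h z) (ga z)).
Proof.
move=> fpsi dpsi [dh lh] fga gaU.
have oU := fopen_fin (finite_ord_le n) Uopen.
have [t [ut Et]] := finite_uniq_seq (@finite_ord_le 'I_p q m).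
have [s [us oUs Cs]] := fsm_common oU (fun c (_ : c \in t) => fga c).
(* [M] covers the order [n] at which [h] is determined and the orders needed by the components of
   [ga] that [psi] can see. *)
have [M0 sM] := seq_ord_le s; pose M := maxn n M0.
have nM : @ord_le 'I_p q n `<=` ord_le M by apply: ord_le_sub; exact: leq_maxl.
have MM : @ord_le 'I_p q M0 `<=` ord_le M by apply: ord_le_sub; exact: leq_maxr.
apply: (local_fsm (finite_ord_le M) (open_in_sub nM Uopen)).
  move=> z w Uz Uw zw; rewrite (dh z w) // => [|c nc]; last by apply/zw/nM.
  apply: dpsi; [exact: gaU|exact: gaU|move=> c mc].
  have ct : c \in t by have: [set` t] c by rewrite -Et.
  by apply: (cont_in_agree (Ck_cont (Cs c ct 0))) => // d ds; apply/zw/MM/sM.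
move=> z Uz; have [k [B [Bz BU oB hB fB]]] := lh z Uz.
exists B; split=> //.
pose g w := join (cmap (atlas G k) (h w)) (ga w).
apply: (@fsm_ext _ _ _ ((fun s => psi (cinv (atlas G k) (s \o inl)) (s \o inr)) \o g)).
  move=> w; rewrite inE => Bw; rewrite /= -[X in psi _ X]/(ga w).
  by rewrite -[X in psi (cinv _ X) _]/(cmap (atlas G k) (h w)) lg_chartK //; exact: hB.
apply: (fsm_comp (fpsi k)) => //.
  by case=> [j|c]; [exact: fB|exact: fsm_sub (fga c)].
move=> w Bw; split; last by apply: gaU; exact: BU.
by exists (h w) => //; exact: hB.
Qed.

End Frame.

(** * Tangent maps of the prolonged action *)

Section Tangent.
Context {R : realType} {r p q : nat} {G : lieGroup R r} (A : smooth_action G p q).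
Local Notation J := (jet R 'I_p q).

Lemma tangent_comp g h z v : jdom A z ->
  tangent_act A (g * h)%g z v = tangent_act A g (pact A h z) (tangent_act A h z v).
Proof.
move=> jz; apply/funext => c; rewrite /tangent_act.
have E : {in jdom A, (fun w => pact A (g * h)%g w c) =1 (pact A g ^~ c) \o pact A h}.
  by move=> w; rewrite inE => jw; rewrite pactM.
rewrite (diff_at_ext v (fopen_jdom A) E jz).
by rewrite (diff_at_comp (fsm_pact A g c) (fsm_pact A h) v (fopen_jdom A) jz (jdom_pact h jz)).
Qed.

Lemma tangent1 z v : jdom A z -> tangent_act A 1%g z v = v.
Proof.
move=> jz; apply/funext => c; rewrite /tangent_act.
have E : {in jdom A, (fun w => pact A 1%g w c) =1 (fun w : J => w c)}.
  by move=> w; rewrite inE => jw; rewrite pact1.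
by rewrite (diff_at_ext v (fopen_jdom A) E jz) diff_at_coord.
Qed.

Lemma tangentK g z v : jdom A z ->
  tangent_act A g^-1%g (pact A g z) (tangent_act A g z v) = v.
Proof. by move=> jz; rewrite -tangent_comp // mulVg tangent1. Qed.

Lemma tangentVK g z v : jdom A z ->
  tangent_act A g z (tangent_act A g^-1%g (pact A g z) v) = v.
Proof.
move=> jz; rewrite -{1}(pactK g jz) -tangent_comp ?mulgV ?tangent1 //; exact: jdom_pact.
Qed.

Lemma tangent_lin_sum g z (T : Type) (l : seq T) (P : pred T) (a : T -> R) w c : jdom A z ->
  tangent_act A g z (fun d => \sum_(i <- l | P i) a i * w i d) c =
  \sum_(i <- l | P i) a i * tangent_act A g z (w i) c.
Proof. by move=> jz; exact: (diff_at_lin_sum _ _ _ _ (fsm_pact A g c) jz). Qed.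

Lemma tangent_inl g z v i : tangent_act A g z v (inl i) = v (inl i).
Proof. exact: diff_at_coord. Qed.

Variable e : nat.
Hypothesis he : cdom (atlas G e) 1%g.

(** The commutator of [D_i] and [v_j] is 0: [v_j] has no component along [x], and along [u_K] the
    two terms agree by [zeta_succ]. *)
Lemma tder_diff_zeta (B : set J) F i j z : fsm B F -> B `<=` jdom A -> B z ->
  tder i (fun w => diff_at F w (zeta A e j w)) z = diff_at (tder i F) z (zeta A e j z).
Proof.
move=> fF Bj Bz; have oB := fsm_fopen fF.
have fz c : fsm B ((fun w => zeta A e j w) ^~ c) by apply: fsm_sub (fsm_zeta A he j c).
have fD c := fsm_Dvec i c oB.
have E : {in B, tder i F =1 (fun w => diff_at F w (Dvec i w))}.
  by move=> w; rewrite inE => Bw; exact: tderE fF Bw.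
rewrite (diff_at_ext _ oB E Bz) (tderE _ (fsm_diff_at fF fz) Bz).
apply/eqP; rewrite -subr_eq0 (vector_field_commutator fF fD fz Bz); apply/eqP.
rewrite -[RHS](diff_at_0 F z); congr diff_at; apply/funext => -[k|[al K]].
  rewrite diff_at_cst subr0 (_ : (fun w => _) = fun=> 0) ?diff_at_cst //.
  by apply/funext => w; exact: zeta_inl.
rewrite diff_at_coord -(tderE _ (fz _) Bz) (zeta_succ he) ?subrr //; exact: Bj.
Qed.

Section Adjoint.
Variables (n : nat) (Ad : G -> 'M[R]_r).
Hypothesis AdP : adjoint_matrix A e n Ad.

Lemma adjoint_prolonged g z i c : jdom A z ->
  tangent_act A g^-1%g (pact A g z) (zeta A e i (pact A g z)) c =
  \sum_j Ad g i j * zeta A e j z c.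
Proof.
case: c => [k|[al K]] jz.
  rewrite tangent_inl zeta_inl big1 // => j _; by rewrite zeta_inl mulr0.
elim/(@mi_ind 'I_p): K z jz => [|K k IH] z jz.
  (* Order 0 lies within the hypothesis whatever [n] is. *)
  by apply: AdP => //=; rewrite /msize big1 // => x _; rewrite ffunE.
set F := fun w : J => pact A g^-1%g w (inr (al, K)).
have fF : fsm (jdom A) F by exact: fsm_pact.
have jgz := jdom_pact g jz.
have E : {in jdom A, (fun w => pact A g^-1%g w (inr (al, mi_succ K k))) =1 tder k F}.
  by move=> w; rewrite inE => jw; exact: pact_succ.
rewrite /tangent_act (diff_at_ext _ (fopen_jdom A) E jgz).
(* [D_k] leaves first the derivative along [v_i], then the pullback by [g]. It then acts on the
   relation of lower order, whose coefficients [Ad g i j] do not depend on the jet. *)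
rewrite -(tder_diff_zeta _ _ fF) //.
have fH : fsm (jdom A) (fun w => diff_at F w (zeta A e i w)).
  by apply: fsm_diff_at => // c; exact: fsm_zeta.
rewrite -(tder_pact _ fH) //.
have E2 : {in jdom A, (fun w => diff_at F w (zeta A e i w)) \o pact A g =1
    (fun w => \sum_j Ad g i j * zeta A e j w (inr (al, K)))}.
  by move=> w; rewrite inE => jw; rewrite -IH.
rewrite (tder_ext k (fopen_jdom A) E2 (mem_set jz)).
have fj j : fsm (jdom A) (fun w => Ad g i j * zeta A e j w (inr (al, K))).
  by apply: fsmM; [apply: fsm_cst; exact: fopen_jdom|exact: fsm_zeta].
rewrite (tder_sum k (fopen_jdom A) (fun j _ _ => fj j) jz).
apply: eq_bigr => j _.
rewrite (tderM k (fsm_cst _ (fopen_jdom A)) (fsm_zeta A he j _) jz) zeta_succ //.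
by rewrite (tderE _ (fsm_cst _ (fopen_jdom A)) jz) diff_at_cst mul0r add0r.
Qed.

Lemma zeta_pact g z i c : jdom A z ->
  zeta A e i (pact A g z) c = \sum_j Ad g i j * tangent_act A g z (zeta A e j z) c.
Proof.
move=> jz; rewrite -tangent_lin_sum // -[LHS](congr1 (@^~ c) (tangentVK g _ jz)).
congr (tangent_act A g z _ c); apply/funext => d; exact: adjoint_prolonged.
Qed.

(** A row vector [b] with [b *m Ad g = 0] is a linear relation between the infinitesimals at
    [g . z], up to order [n], which [orbits_dim] excludes. *)
Lemma adjoint_unit (U : set J) g z : orbits_dim A e n U -> jdom A z -> U (pact A g z) ->
  Ad g \in unitmx.
Proof.
move=> Uorb jz Ugz; rewrite -row_free_unit -kermx_eq0; apply/eqP/eqP/rowV0P => b.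
rewrite sub_kermx => /eqP bAd; apply/rowP => i; rewrite mxE.
apply: (Uorb _ Ugz (b 0)) => c _.
under eq_bigr do rewrite zeta_pact // mulr_sumr.
rewrite exchange_big /= big1 // => j _.
under eq_bigr do rewrite mulrA.
rewrite -mulr_suml; have := congr1 (fun M : 'rV_r => M 0 j) bAd; rewrite !mxE => ->.
by rewrite mul0r.
Qed.

Lemma tangent_zeta g z j c : jdom A z -> Ad g \in unitmx ->
  tangent_act A g z (zeta A e j z) c =
  \sum_l invmx (Ad g) j l * zeta A e l (pact A g z) c.
Proof.
move=> jz Au; under eq_bigr do rewrite zeta_pact // mulr_sumr.
rewrite exchange_big /=.
have E k x : \sum_l invmx (Ad g) j l * (Ad g l k * x) = (j == k)%:R * x.
  have := congr1 (fun M : 'M[R]_r => M j k) (mulVmx Au); rewrite !mxE => <-.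
  by rewrite mulr_suml; apply: eq_bigr => l _; rewrite mulrA.
under eq_bigr do rewrite E.
rewrite (bigD1 j) //= eqxx mul1r big1 ?addr0 // => k /negbTE.
by rewrite eq_sym => ->; rewrite mul0r.
Qed.

End Adjoint.
End Tangent.

(** * Invariant forms in the variation *)

Section FrameCalculus.
Context {R : realType} {r p q : nat} {G : lieGroup R r} (A : smooth_action G p q).
Local Notation J := (jet R 'I_p q).
Local Notation Jtau := (jet R (option 'I_p) q).
Variables (n : nat) (U : set J) (K : set J) (rho : J -> G).
Hypothesis Uopen : open_in (ord_le n) U.
Hypothesis Udom : forall z, U z -> jdom A z.
Hypothesis KU : K `<=` U.
Hypothesis rhoP : right_moving_frame A n U K rho.

Lemma fopen_U : fopen U.
Proof. exact: fopen_fin (finite_ord_le n) Uopen. Qed.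

Lemma frame_smooth : lie_smooth n U rho.
Proof. by case: rhoP => _ _; exact: smooth_to_lie_smooth. Qed.

(** Equivariance of a right frame: [rho (g . z) * g] carries [z] into [K], and [rho z] is the only
    such element. *)
Lemma frame_pact g z : U z -> U (pact A g z) -> rho (pact A g z) = (rho z * g^-1)%g.
Proof.
move=> Uz Ugz; have [rK ru _] := rhoP; have jz := Udom Uz.
by rewrite -(ru z (rho (pact A g z) * g)%g Uz) ?mulgK // pactM //; exact: rK.
Qed.

Lemma U_inv_jet z : U z -> U (inv_jet A rho z).
Proof. by move=> Uz; apply: KU; case: rhoP => + _ _; apply. Qed.

Lemma inv_jet_pact g z : U z -> U (pact A g z) -> inv_jet A rho (pact A g z) = inv_jet A rho z.
Proof.
move=> Uz Ugz; have jz := Udom Uz.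
by rewrite /inv_jet frame_pact // pactM ?pactK //; exact: jdom_pact.
Qed.

Lemma fsm_inv_jet c : fsm U (inv_jet A rho ^~ c).
Proof.
case: c => [i|[al L]]; first by apply: fsm_coord; exact: fopen_U.
apply: (fsm_frame (A := A) Uopen (psi := fun g z => pact A g z (inr (al, L)))
  (m := msize L) (ga := id)) => //.
- by move=> k; exact: fsm_joint.
- by move=> g; exact: pact_depends.
- exact: frame_smooth.
- by move=> c; apply: fsm_coord; exact: fopen_U.
Qed.

(** Smoothness of the entries of the tangent maps [T_rho] at [z], for [I_{tau L}], and [T_rho^-1] at
    the invariantised jet, for the coefficients of the decomposition below. *)
Lemma fsm_pder_pact (h : J -> G) (ga : J -> J) al L d :
  lie_smooth n U h -> (forall c, fsm U (ga ^~ c)) -> (forall z, U z -> jdom A (ga z)) ->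
  fsm U (fun z => pder d (fun w => pact A (h z) w (inr (al, L))) (ga z)).
Proof.
move=> hs fga jga.
apply: (fsm_frame (A := A) Uopen
  (psi := fun g z => pder d (fun w => pact A g w (inr (al, L))) z) (m := msize L)) => //.
- move=> k; have fj := fsm_joint A k (inr (al, L)).
  apply: fsm_ext (fsm_pder (inr d) fj) => s; rewrite inE => ks.
  have := pder_join_r fj (s := s \o inl) (z := s \o inr) d.
  by rewrite join_split => /(_ ks) <-.
- move=> g; apply: depends_on_pder; [exact: open_jdom|exact: pact_depends].
Qed.

Lemma diff_invariantP F : diff_invariant A U F <->
  fsm U F /\ forall g z, U z -> U (pact A g z) -> F (pact A g z) = F z.
Proof.
split=> [[[m sF] FG]|[fF FG]]; split=> //; first exact: smooth_on_fsm fopen_U sF.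
by have [m H] := fsm_ord_le fF; exists m; have [] := H m (leqnn _).
Qed.

Lemma dinv_kappa c : diff_invariant A U (inv_jet A rho ^~ c).
Proof.
apply/diff_invariantP; split; first exact: fsm_inv_jet.
by move=> g z Uz Ugz; rewrite inv_jet_pact.
Qed.

Lemma dinv_tder i F : diff_invariant A U F -> diff_invariant A U (tder i F).
Proof.
move=> /diff_invariantP[fF FG]; apply/diff_invariantP; split; first exact: fsm_tder.
move=> g z Uz Ugz; rewrite -(tder_pact _ fF) //; last exact: Udom.
have fg d : fsm U (pact A g ^~ d).
  by apply: fsm_sub (fsm_pact A g d) => //; exact: fopen_U.
(* Invariance is known only where both [w] and [g . w] lie in [U]; this set is open, so total
   derivatives can be compared on it. *)
have oB := fopen_preim fopen_U fopen_U fg.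
apply: (tder_ext i oB); last by rewrite inE.
by move=> w; rewrite inE => -[Uw Ugw] /=; rewrite FG.
Qed.

Lemma dinv_iterd L F : diff_invariant A U F -> diff_invariant A U (iterd tder L F).
Proof. by apply: iterd_class => i H; exact: dinv_tder. Qed.

Lemma dinvM F H : diff_invariant A U F -> diff_invariant A U H ->
  diff_invariant A U (fun z => F z * H z).
Proof.
move=> /diff_invariantP[fF FG] /diff_invariantP[fH HG]; apply/diff_invariantP; split.
  exact: fsmM.
by move=> g z Uz Ugz; rewrite FG // HG.
Qed.

Lemma dinv_cst (a : R) : diff_invariant A U (fun=> a).
Proof. by apply/diff_invariantP; split=> //; apply: fsm_cst; exact: fopen_U. Qed.

Lemma dinv_sum (T : eqType) (l : seq T) (F : T -> J -> R) :
  (forall t, t \in l -> diff_invariant A U (F t)) ->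
  diff_invariant A U (fun z => \sum_(t <- l) F t z).
Proof.
move=> H; apply/diff_invariantP; split.
  by apply: fsm_sum fopen_U _ => t tl _; have /diff_invariantP[] := H t tl.
move=> g z Uz Ugz; rewrite big_seq [RHS]big_seq; apply: eq_bigr => t tl.
by have /diff_invariantP[_ ->] := H t tl.
Qed.

Lemma dinv_ext F H : {in U, F =1 H} -> diff_invariant A U F -> diff_invariant A U H.
Proof.
move=> FH /diff_invariantP[fF FG]; apply/diff_invariantP; split; first exact: fsm_ext fF.
by move=> g z Uz Ugz; rewrite -!FH ?inE // FG.
Qed.

Local Notation Utau := (@res R p q @^-1` U).

Lemma fopen_Utau : fopen Utau.
Proof. exact: fopen_res fopen_U. Qed.

Lemma fopen_jdom_tau : fopen (@res R p q @^-1` jdom A).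
Proof. exact: fopen_res (fopen_jdom A). Qed.

Lemma fsm_act_tau g al : fsm (@res R p q @^-1` jdom A) (fun z => act A g (base (res z)) al).
Proof. exact: (fsm_comp_res (fsm_act_jet A g al)). Qed.

Lemma pact_tau0 g (z : Jtau) : jdom A (res z) -> res (pact_tau A g z) = pact A g (res z).
Proof.
move=> jz; apply/funext => -[i|[al L]] //=.
exact: (iterd_res L (fsm_act_jet A g al) jz).
Qed.

(** On first tau-derivatives the action prolonged with tau is the tangent map. In particular the
    [I_{tau L}] are the components of [T_rho (tau_vec z)]. *)
Lemma pact_tau1 g (z : Jtau) al L : jdom A (res z) ->
  pact_tau A g z (inr (al, xmi 1 L)) =
  tangent_act A g (res z) (tau_vec z) (inr (al, L)).
Proof. by move=> jz; exact: (iterd_res1 L (fsm_act_jet A g al) jz). Qed.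

Lemma tau_vec_pact_tau g (z : Jtau) : jdom A (res z) ->
  tau_vec (pact_tau A g z) = tangent_act A g (res z) (tau_vec z).
Proof.
move=> jz; apply/funext => -[i|[al L]]; first by rewrite tangent_inl.
by rewrite /= -pact_tau1.
Qed.

Lemma ItauE al L (z : Jtau) : jdom A (res z) ->
  Itau A rho al L z = tangent_act A (rho (res z)) (res z) (tau_vec z) (inr (al, L)).
Proof. exact: pact_tau1. Qed.

Lemma tder_pact_tau B F g o z : fsm B F -> jdom A (res z) -> B (pact_tau A g z) ->
  tder o (F \o pact_tau A g) z = tder o F (pact_tau A g z).
Proof.
by move=> fF jz; apply: (tder_prol (fsm_act_tau g) fopen_jdom_tau o fF).
Qed.

(** Extends a jet and a tangent vector to a tau-jet. [var_jet] is the case where the vector is the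
    j-th infinitesimal. *)
Definition lift (z : J) (v : coord 'I_p q -> R) : Jtau := fun c =>
  match c with
  | inl (Some i) => z (inl i)
  | inl None => 0
  | inr (al, L) =>
      let L' : mi 'I_p := [ffun i => L (Some i)] in
      match L None with
      | 0%N => z (inr (al, L'))
      | 1%N => v (inr (al, L'))
      | _ => 0
      end
  end.

Lemma xmiK k (L : mi 'I_p) : [ffun i => xmi k L (Some i)] = L.
Proof. by apply/ffunP => i; rewrite !ffunE. Qed.

Lemma res_lift z v : res (lift z v) = z.
Proof. by apply/funext => -[i|[al L]] //=; rewrite xmiK ffunE. Qed.

Lemma lift_tau z v al L : lift z v (inr (al, xmi 1 L)) = v (inr (al, L)).
Proof. by rewrite /= xmiK ffunE. Qed.

Definition vertical (v : coord 'I_p q -> R) := forall i, v (inl i) = 0.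

Lemma tau_vec_lift z v : vertical v -> tau_vec (lift z v) = v.
Proof. by move=> v0; apply/funext => -[i|[al L]] //=; rewrite xmiK ffunE. Qed.

Lemma vertical_tangent g z v : vertical v -> vertical (tangent_act A g z v).
Proof. by move=> v0 i; rewrite tangent_inl. Qed.

Lemma diff_at_vertical F z w m (s : seq (mi 'I_p)) :
  uniq s -> (forall L, (L \in s) = (msize L <= m)%N) -> vertical w ->
  (forall al L, (m < msize L)%N -> pder (inr (al, L)) F z = 0) ->
  diff_at F z w = \sum_al \sum_(L <- s) pder (inr (al, L)) F z * w (inr (al, L)).
Proof.
move=> us sP w0 F0; pose t := [seq (inr (al, L) : coord 'I_p q) | al <- enum 'I_q, L <- s].
have ut : uniq t.
  by apply: allpairs_uniq => //; [exact: enum_uniq|move=> [? ?] [? ?] _ _ [-> ->]].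
rewrite /diff_at (sum_fsT ut) => [|[i|[al L]] ct]; last 2 first.
- by rewrite w0 mulr0.
- rewrite F0 ?mul0r // ltnNge -sP; apply: contra ct => Ls.
  by apply/allpairsP; exists (al, L); rewrite mem_enum.
by rewrite big_allpairs_dep /= big_enum.
Qed.

(** The tangent map is triangular with respect to the order, so finite truncations of a tangent
    vector are transformed among themselves. *)
Lemma pder_pact0 g z al L be M : jdom A z -> (msize L < msize M)%N ->
  pder (inr (be, M)) (fun w => pact A g w (inr (al, L))) z = 0.
Proof.
move=> jz LM; apply: (pder_agree (S := ord_le (msize L)) (open_jdom (A := A) 0) jz) => [w jw zw|].
  by apply: (pact_depends g al (K := L)) => // c cL; rewrite zw.
by move=> /=; rewrite leqNgt LM.
Qed.

Lemma tangent_vertical g z w al L m (s : seq (mi 'I_p)) :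
  uniq s -> (forall L, (L \in s) = (msize L <= m)%N) -> (msize L <= m)%N ->
  jdom A z -> vertical w ->
  tangent_act A g z w (inr (al, L)) = \sum_be \sum_(M <- s)
    w (inr (be, M)) * tangent_act A g z (fun d => (d == inr (be, M))%:R) (inr (al, L)).
Proof.
move=> us sP Lm jz w0; rewrite /tangent_act (diff_at_vertical us sP w0).
  apply: eq_bigr => be _; apply: eq_bigr => M _; by rewrite diff_at_delta mulrC.
by move=> be M mM; apply: pder_pact0 => //; exact: leq_ltn_trans mM.
Qed.

(* Functions that, over [U], are linear in the first tau-derivatives. *)
Inductive taulin : (Jtau -> R) -> Prop :=
| taulin_ext F H : (forall z, U (res z) -> F z = H z) -> taulin F -> taulin H
| taulin0 : taulin (fun=> 0)
| taulinD F H : taulin F -> taulin H -> taulin (fun z => F z + H z)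
| taulin_coord al L b : fsm U b -> taulin (fun z => z (inr (al, xmi 1 L)) * b (res z)).

Lemma fsm_taulin F : taulin F -> fsm Utau F.
Proof.
elim=> {F} [F H FH _|//|F H _ fF _ fH|al L b fb].
- by apply: fsm_ext => z; rewrite inE; exact: FH.
- by apply: fsm_cst; exact: fopen_Utau.
- exact: fsmD.
- by apply: fsmM; [apply: fsm_coord; exact: fopen_Utau|exact: (fsm_comp_res fb)].
Qed.

Lemma taulin_sum (T : eqType) (l : seq T) (F : T -> Jtau -> R) :
  (forall t, t \in l -> taulin (F t)) -> taulin (fun z => \sum_(t <- l) F t z).
Proof.
elim: l => [|t l IH] H.
  by apply: taulin_ext taulin0 => z _; rewrite big_nil.
have tl t' : t' \in l -> taulin (F t') by move=> t'l; apply: H; rewrite inE t'l orbT.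
apply: taulin_ext (taulinD (H t (mem_head _ _)) (IH tl)) => z _.
by rewrite big_cons.
Qed.

Lemma taulinM f F : fsm U f -> taulin F -> taulin (fun z => f (res z) * F z).
Proof.
move=> ff; elim=> {F} [F H FH _|//|F H _ IF _ IH|al L b fb].
- by apply: taulin_ext => z Uz; rewrite FH.
- by apply: taulin_ext taulin0 => z _; rewrite mulr0.
- by apply: taulin_ext (taulinD IF IH) => z _; rewrite mulrDr.
- apply: taulin_ext (taulin_coord al L (fsmM ff fb)) => z _.
  by rewrite mulrCA.
Qed.

Lemma taulin_tder i F : taulin F -> taulin (tder (Some i) F).
Proof.
elim=> {F} [F H FH tF|//|F H tF IF tH IH|al L b fb].
- apply: taulin_ext => z Uz; apply: (tder_ext _ fopen_Utau); rewrite ?inE //.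
  by move=> w; rewrite inE; exact: FH.
- apply: taulin_ext taulin0 => z Uz.
  by rewrite (tderE _ (fsm_cst _ fopen_Utau)) // diff_at_cst.
- apply: taulin_ext (taulinD IF IH) => z Uz.
  by rewrite (tderD _ (fsm_taulin tF) (fsm_taulin tH)).
- apply: taulin_ext (taulinD (taulin_coord al (mi_succ L i) fb)
    (taulin_coord al L (fsm_tder i fb))) => z Uz.
  have fc := fsm_coord (inr (al, xmi 1 L)) fopen_Utau.
  rewrite (tderM _ fc (fsm_comp_res fb)) //; congr (_ + _).
    by rewrite (tderE _ fc) // diff_at_coord /= xmi_succ.
  by rewrite (tder_res_Some _ fb).
Qed.

Lemma taulin_lift F : taulin F -> forall z, U (res z) -> F z = F (lift (res z) (tau_vec z)).
Proof.
elim=> {F} [F H FH _ IF|//|F H _ IF _ IH|al L b fb] z Uz //.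
- by rewrite -!FH ?res_lift //; exact: IF.
- by rewrite IF // IH.
- by rewrite lift_tau res_lift.
Qed.

Lemma taulin_linear F : taulin F -> forall z (T : Type) (l : seq T) (a : T -> R) w, U z ->
  F (lift z (fun d => \sum_(t <- l) a t * w t d)) = \sum_(t <- l) a t * F (lift z (w t)).
Proof.
elim=> {F} [F H FH _ IF|//|F H _ IF _ IH|al L b fb] z T l a w Uz.
- rewrite -FH ?res_lift // IF //; apply: eq_bigr => t _.
  by rewrite FH // res_lift.
- by rewrite big1 // => t _; rewrite mulr0.
- by rewrite IF // IH // -big_split /=; apply: eq_bigr => t _; rewrite mulrDr.
- rewrite lift_tau res_lift mulr_suml; apply: eq_bigr => t _.
  by rewrite lift_tau res_lift mulrA.
Qed.

(** Supplies the finite order at which a tangent vector may be truncated before it is expanded in a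
    basis. *)
Lemma taulin_order F : taulin F -> exists m, forall z v v', U z ->
  (forall al L, (msize L <= m)%N -> v (inr (al, L)) = v' (inr (al, L))) ->
  F (lift z v) = F (lift z v').
Proof.
elim=> {F} [F H FH _ [m IF]|//|F H _ [m IF] _ [m' IH]|al L b fb].
- by exists m => z v v' Uz vv; rewrite -!FH ?res_lift //; exact: IF.
- by exists 0%N.
- exists (maxn m m') => z v v' Uz vv; rewrite (IF z v v') ?(IH z v v') // => al L Lm;
    by apply: vv; rewrite leq_max Lm ?orbT.
- by exists (msize L) => z v v' Uz vv; rewrite !lift_tau vv // !res_lift.
Qed.

Lemma fsm_taulin_lift F (V : J -> coord 'I_p q -> R) : taulin F ->
  (forall al L, fsm U (V ^~ (inr (al, L)))) -> fsm U (fun z => F (lift z (V z))).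
Proof.
move=> + fV; elim=> {F} [F H FH _ IF|//|F H _ IF _ IH|al L b fb].
- by apply: fsm_ext IF => z; rewrite inE => Uz; rewrite FH // res_lift.
- by apply: fsm_cst; exact: fopen_U.
- exact: fsmD.
- apply: fsm_ext (fsmM (fV al L) fb) => z _.
  by rewrite lift_tau res_lift.
Qed.

Definition tau_invariant (F : Jtau -> R) : Prop := taulin F /\
  forall g z, U (res z) -> U (pact A g (res z)) -> F (pact_tau A g z) = F z.

Lemma tau_invariant_tder i F : tau_invariant F -> tau_invariant (tder (Some i) F).
Proof.
move=> [tF FG]; split; first exact: taulin_tder.
move=> g z Uz Ugz; have jz := Udom Uz.
have fF := fsm_taulin tF.
have Ut : Utau (pact_tau A g z) by rewrite /preimage /= pact_tau0.
rewrite -(tder_pact_tau _ fF) //.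
have fg d : fsm Utau (pact_tau A g ^~ d).
  by apply: fsm_sub (fsm_prol (fsm_act_tau g) fopen_jdom_tau d) => [|w /Udom //]; exact: fopen_Utau.
have oB := fopen_preim fopen_Utau fopen_Utau fg.
apply: (tder_ext _ oB); last by rewrite inE.
move=> w; rewrite inE => -[Uw Ugw] /=; apply: FG => //.
by rewrite -pact_tau0 //; exact: Udom.
Qed.

Lemma tau_invariantD F H : tau_invariant F -> tau_invariant H ->
  tau_invariant (fun z => F z + H z).
Proof.
by move=> [tF FG] [tH HG]; split=> [|g z Uz Ugz]; [exact: taulinD|rewrite FG // HG].
Qed.

Lemma tau_invariantM f F : diff_invariant A U f -> tau_invariant F ->
  tau_invariant (fun z => f (res z) * F z).
Proof.
move=> /diff_invariantP[ff fG] [tF FG]; split=> [|g z Uz Ugz]; first exact: taulinM.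
by rewrite FG // pact_tau0 ?fG //; exact: Udom.
Qed.

Lemma tau_invariant_ext F H : (forall z, U (res z) -> F z = H z) ->
  tau_invariant F -> tau_invariant H.
Proof.
move=> FH [tF FG]; split=> [|g z Uz Ugz]; first exact: taulin_ext tF.
by rewrite -!FH ?FG // pact_tau0 //; exact: Udom.
Qed.

Lemma tau_invariant0 : tau_invariant (fun=> 0).
Proof. by split=> //; exact: taulin0. Qed.

Lemma tau_invariant_sum (T : eqType) (l : seq T) (F : T -> Jtau -> R) :
  (forall t, t \in l -> tau_invariant (F t)) ->
  tau_invariant (fun z => \sum_(t <- l) F t z).
Proof.
move=> H; split; first by apply: taulin_sum => t tl; have [] := H t tl.
move=> g z Uz Ugz; rewrite big_seq [RHS]big_seq; apply: eq_bigr => t tl.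
by have [_ ->] := H t tl.
Qed.

(** Linearity comes from expanding [T_rho] on basis vectors. Invariance is
    [rho (g . z) = rho z * g^-1] combined with the chain rule: the factor [T_g] acquired by
    [tau_vec] is cancelled. *)
Lemma tau_invariant_Itau al L : tau_invariant (Itau A rho al L).
Proof.
have [s [us sP]] := finite_mi 'I_p (msize L).
split.
  apply: (@taulin_ext (fun z => \sum_be \sum_(M <- s)
      z (inr (be, xmi 1 M)) *
      pder (inr (be, M)) (fun w => pact A (rho (res z)) w (inr (al, L))) (res z))).
    move=> z Uz; have jz := Udom Uz.
    rewrite ItauE // (tangent_vertical _ al us sP (leqnn _) jz) //.
    by apply: eq_bigr => be _; apply: eq_bigr => M _; rewrite /tangent_act diff_at_delta.
  apply: taulin_sum => be _; apply: taulin_sum => M _.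
  apply: (taulin_coord _ _ (b := fun z =>
    pder (inr (be, M)) (fun w => pact A (rho z) w (inr (al, L))) z)).
  apply: (@fsm_pder_pact rho id) => //; first exact: frame_smooth.
  by move=> c; apply: fsm_coord; exact: fopen_U.
move=> g z Uz Ugz; have jz := Udom Uz.
rewrite !ItauE //; last by rewrite pact_tau0 //; exact: jdom_pact.
rewrite pact_tau0 // tau_vec_pact_tau // frame_pact //.
by rewrite -tangent_comp // mulgVK.
Qed.

Lemma tau_invariant_decomposition F : tau_invariant F ->
  exists (C : 'I_q -> mi 'I_p -> J -> R) (m : nat),
    [/\ forall al L, diff_invariant A U (C al L),
        forall al L z, (m < msize L)%N -> C al L z = 0 &
        forall z, U (res z) ->
          F z = \sum_al \sum_(L \in [set: mi 'I_p]) Itau A rho al L z * C al L (res z)].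
Proof.
move=> [tF FG]; have [m Fm] := taulin_order tF; have [s [us sP]] := finite_mi 'I_p m.
pose e k : coord 'I_p q -> R := fun d => (d == inr k)%:R.
(* the vertical vectors at [z] whose I_tau-coordinates are the basis vectors *)
pose V k z := tangent_act A (rho z)^-1%g (inv_jet A rho z) (e k).
pose C al L z := if (msize L <= m)%N then F (lift z (V (al, L) z)) else 0.
have jU z : U z -> jdom A (inv_jet A rho z) by move=> Uz; exact/Udom/U_inv_jet.
have vV k z : vertical (V k z) by apply: vertical_tangent.
exists C, m; split.
- move=> al L; rewrite /C; case: leqP => Lm; last exact: dinv_cst.
  apply/diff_invariantP; split.
    apply: fsm_taulin_lift => // be M.
    apply: (@fsm_ext _ _ _ (fun z => pder (inr (al, L))
      (fun w => pact A (rho z)^-1%g w (inr (be, M))) (inv_jet A rho z))).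
      by move=> z _; rewrite /V /tangent_act diff_at_delta.
    apply: (@fsm_pder_pact (fun z => (rho z)^-1%g)) => //; last exact: fsm_inv_jet.
    exact: lie_smoothV frame_smooth.
  move=> g z Uz Ugz; have jz := Udom Uz.
  (* The action of [g] turns the lift of [V (al, L) z] into a tau-jet over [g . z] with vector
     [T_g (V z)]. This is [V (g . z)], since the inverse frame changes to [g * (rho z)^-1] and
     [inv_jet] is unchanged. *)
  rewrite -(FG g (lift z (V (al, L) z))) ?res_lift //.
  rewrite [RHS](taulin_lift tF) ?pact_tau0 ?res_lift //.
  rewrite tau_vec_pact_tau ?res_lift // tau_vec_lift //.
  by rewrite /V inv_jet_pact // frame_pact // invgF tangent_comp ?pactK //; exact: jU.
- by move=> al L z; rewrite ltnNge /C => /negbTE ->.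
- move=> z Uz; set w := res z in Uz *; have jw := Udom Uz.
  rewrite (taulin_lift tF Uz) -/w.
  pose v := tangent_act A (rho w) w (tau_vec z).
  have vv : vertical v by exact: vertical_tangent.
  have Ew : tau_vec z = tangent_act A (rho w)^-1%g (inv_jet A rho w) v by rewrite tangentK.
  pose l := [seq (al, L) | al <- enum 'I_q, L <- s].
  (* The expansion of [tau_vec z] in the [V k] is truncated at order [m] and is correct only up to
     that order, which is all that [F] sees. *)
  rewrite (Fm _ _ (fun d => \sum_(k <- l) v (inr k) * V k w d)) //; last first.
    move=> al L Lm; rewrite Ew (tangent_vertical _ al us sP Lm (jU _ Uz) vv).
    by rewrite big_allpairs_dep /= big_enum.
  rewrite (taulin_linear tF) // big_allpairs_dep /= big_enum /=.
  apply: eq_bigr => al _; rewrite (sum_fsT us) => [|L]; last first.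
    by rewrite sP /C => /negbTE ->; rewrite mulr0.
  rewrite big_seq [RHS]big_seq; apply: eq_bigr => L; rewrite sP => Lm.
  by rewrite ItauE // /C Lm.
Qed.

End FrameCalculus.

(** * Conservation laws and integration by parts *)

Lemma sum_mi (R : realType) (X : finType) m : exists s : seq (mi X),
  (forall K, (K \in s) = (msize K <= m)%N) /\
  forall f : mi X -> R, (forall K, (m < msize K)%N -> f K = 0) ->
    \sum_(K \in [set: mi X]) f K = \sum_(K <- s) f K.
Proof.
have [s [us sP]] := finite_mi X m; exists s; split=> // f f0.
by apply: sum_fsT => // K; rewrite sP -ltnNge; exact: f0.
Qed.

Section ConservationLaws.
Context {R : realType} {r p q : nat} {G : lieGroup R r} (A : smooth_action G p q).
Local Notation J := (jet R 'I_p q).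
Local Notation Jtau := (jet R (option 'I_p) q).
Variables (n : nat) (U : set J) (K : set J) (rho : J -> G).
Hypothesis Uopen : open_in (ord_le n) U.
Hypothesis Udom : forall z, U z -> jdom A z.
Hypothesis KU : K `<=` U.
Hypothesis rhoP : right_moving_frame A n U K rho.
Variable e : nat.
Hypothesis he : cdom (atlas G e) 1%g.

Local Notation Utau := (@res R p q @^-1` U).
Local Notation dinv := (diff_invariant A U).
Let oU : fopen U := fopen_U Uopen.
Let oUtau : fopen Utau := fopen_Utau Uopen.

Lemma res_var_jet j z : res (var_jet A e j z) = z.
Proof. exact: (res_lift z (zeta A e j z)). Qed.

Lemma tau_vec_var_jet j z : tau_vec (var_jet A e j z) = zeta A e j z.
Proof. by apply: (tau_vec_lift z (v := zeta A e j z)) => i; exact: zeta_inl. Qed.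

Lemma fsm_var_jet j c : fsm U (var_jet A e j ^~ c).
Proof.
case: c => [[i|]|[al L]] /=; [exact: fsm_coord|exact: fsm_cst|].
case: (L None) => [|[|k]]; [exact: fsm_coord| |exact: fsm_cst].
by apply: fsm_sub (fsm_zeta A he j _).
Qed.

(** The map [z |-> var_jet A e j z] carries [D_i] to [D_i]: for the first tau-derivatives this is
    [zeta_succ]. Hence a divergence may be computed before or after substituting the variation. *)
Lemma tder_var_jet i j F z : fsm Utau F -> U z ->
  tder i (F \o var_jet A e j) z = tder (Some i) F (var_jet A e j z).
Proof.
move=> fF Uz; have Uv w : U w -> Utau (var_jet A e j w).
  by rewrite /preimage /= res_var_jet.
have fv := fsm_var_jet j.
rewrite (tderE _ (fsm_comp fF fv oU Uv) Uz) (tderE _ fF (Uv z Uz)).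
rewrite (diff_at_comp fF fv _ oU Uz (Uv z Uz)); congr diff_at.
apply/funext => -[[k|]|[al L]] /=.
- by rewrite diff_at_coord /= (inj_eq Some_inj).
- by rewrite diff_at_cst.
have -> : mi_succ L (Some i) None = L None by rewrite ffunE addn0.
have -> : [ffun k => mi_succ L (Some i) (Some k)] =
    mi_succ [ffun k => L (Some k)] i :> mi 'I_p.
  by apply/ffunP => k; rewrite !ffunE (inj_eq Some_inj).
case: (L None) => [|[|k]]; [by rewrite diff_at_coord| |by rewrite diff_at_cst].
have fz := fsm_zeta A he j (inr (al, [ffun k => L (Some k)])).
by rewrite -(tderE _ fz) -?zeta_succ //; exact: Udom.
Qed.

(** [v_j] at [z] is the velocity of the curve obtained by moving the j-th chart coordinate of the
    group element. Near the identity this curve stays in [U], where [F] is constant along it. *)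
Lemma dinv_zeta j F z : dinv F -> U z -> diff_at F z (zeta A e j z) = 0.
Proof.
move=> /(diff_invariantP A Uopen)[fF FG] Uz; have jz := Udom Uz.
pose g (s : 'I_r -> R) := pact A (cinv (atlas G e) s) z.
set s0 := cmap (atlas G e) 1%g.
have fg c : fsm (cimg (atlas G e)) (g ^~ c).
  by apply: (fsm_slice_l (fsm_joint A e c) (z := z)) => //; exact: fopen_cimg.
have g0 : g s0 = z by rewrite /g lg_chartK // pact1.
have i0 : cimg (atlas G e) s0 by exists 1%g.
have oB := fopen_preim oU (fopen_cimg e) fg.
have D : is_derive (s0 j) 1 (fun t => F (g (upd s0 j t))) (diff_at F z (zeta A e j z)).
  have := @diff_at_curve R _ U F (fun t => g (upd s0 j t)) (s0 j) (zeta A e j z) fF.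
  rewrite upd_id g0; apply=> // c; exact: (fsm_is_derive j (fg c) i0).
rewrite -(@derive_val _ _ _ _ _ _ _ D).
have [s [us oB']] := oB.
have N : \forall t \near s0 j, F (g (upd s0 j t)) = cst (F z) t.
  have B0 : (cimg (atlas G e) `&` g @^-1` U) s0 by split=> //; rewrite /preimage /= g0.
  by apply: filterS (open_upd j oB' B0) => t [_ Ut]; exact: FG.
by rewrite (near_eq_derive _ N) derive_cst.
Qed.

Section Law.
Variable C : 'I_p -> 'I_q -> mi 'I_p -> J -> R.
Hypothesis dC : forall i al L, dinv (C i al L).
Variable m : nat.
Hypothesis C0 : forall i al L z, (m < msize L)%N -> C i al L z = 0.

Lemma taulin_Pdiv i : taulin U (Pdiv A rho C i).
Proof.
have [s [sP sE]] := sum_mi R 'I_p m.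
apply: (@taulin_ext _ _ _ U (fun z => \sum_al \sum_(L <- s) C i al L (res z) * Itau A rho al L z)).
  move=> z Uz; apply: eq_bigr => al _; rewrite sE => [|L mL]; last by rewrite C0 ?mulr0.
  by apply: eq_bigr => L _; rewrite mulrC.
apply: taulin_sum => al _; apply: taulin_sum => L _; apply: taulinM.
  by have /(diff_invariantP A Uopen)[] := dC i al L.
by have [] := tau_invariant_Itau Uopen Udom rhoP al L.
Qed.

Variables (Ad : G -> 'M[R]_r).
Hypothesis AdP : adjoint_matrix A e n Ad.
Hypothesis AdU : forall z, U z -> Ad (rho z) \in unitmx.
Let law i z := invmx (Ad (rho z)) *m upsilon A e rho C i z.

Lemma Pdiv_var_jet i j z : U z -> Pdiv A rho C i (var_jet A e j z) = law i z j 0.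
Proof.
move=> Uz; have jz := Udom Uz; have [s [sP sE]] := sum_mi R 'I_p m.
rewrite /Pdiv /law mxE.
under [RHS]eq_bigr => l _.
  rewrite mxE; under eq_bigr => al _ do
    (rewrite sE; last by move=> L mL; rewrite C0 ?mulr0).
  rewrite mulr_sumr; under eq_bigr do rewrite mulr_sumr.
  over.
rewrite exchange_big /=; apply: eq_bigr => al _.
rewrite sE => [|L mL]; last by rewrite C0 ?mulr0.
rewrite exchange_big /=; apply: eq_bigr => L _.
rewrite ItauE ?res_var_jet // tau_vec_var_jet (tangent_zeta he AdP) ?AdU // mulr_suml.
by apply: eq_bigr => l _; rewrite mulrA.
Qed.

Lemma tder_law i j z : U z ->
  tder (Some i) (Pdiv A rho C i) (var_jet A e j z) = tder i (fun w => law i w j 0) z.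
Proof.
move=> Uz; have fP := fsm_taulin Uopen (taulin_Pdiv i).
rewrite -(tder_var_jet i j fP Uz).
apply: (tder_ext i oU); last by rewrite inE.
by move=> w; rewrite inE => Uw; exact: Pdiv_var_jet.
Qed.

End Law.

(** * Integration by parts modulo divergences *)

Section IntegrationByParts.

(** Equality up to a divergence. The tuple [P] is required to be invariant so that its components
    can be decomposed along the [I_{tau K}] at the end. *)
Definition div_eq (F H : Jtau -> R) : Prop := exists P : 'I_p -> Jtau -> R,
  (forall i, tau_invariant A U (P i)) /\
  forall z, U (res z) -> F z = H z + \sum_i tder (Some i) (P i) z.

Lemma div_eq_ext F H : (forall z, U (res z) -> F z = H z) -> div_eq F H.
Proof.
move=> FH; exists (fun _ _ => 0); split=> [i|z Uz]; first exact: tau_invariant0.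
rewrite FH // big1 ?addr0 // => i _.
by rewrite (tderE _ (fsm_cst _ oUtau)) // diff_at_cst.
Qed.

Lemma div_eqD F H F' H' : div_eq F H -> div_eq F' H' ->
  div_eq (fun z => F z + F' z) (fun z => H z + H' z).
Proof.
move=> [P [tP E]] [P' [tP' E']]; exists (fun i z => P i z + P' i z).
split=> [i|z Uz]; first exact: tau_invariantD.
rewrite E // E' // addrACA; congr (_ + _); rewrite -big_split /=; apply: eq_bigr => i _.
have [tPi _] := tP i; have [tPi' _] := tP' i.
by rewrite (tderD _ (fsm_taulin Uopen tPi) (fsm_taulin Uopen tPi')).
Qed.

Lemma div_eq_trans F H H' : div_eq F H -> div_eq H H' -> div_eq F H'.
Proof.
move=> FH HH'; have [P [tP E]] := div_eqD FH HH'.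
exists P; split=> // z Uz; have := E z Uz.
by rewrite [F z + H z]addrC -addrA => /addrI.
Qed.

Lemma div_eq_sum (T : eqType) (l : seq T) (F H : T -> Jtau -> R) :
  (forall t, t \in l -> div_eq (F t) (H t)) ->
  div_eq (fun z => \sum_(t <- l) F t z) (fun z => \sum_(t <- l) H t z).
Proof.
elim: l => [|t l IH] FH; first by apply: div_eq_ext => z _; rewrite !big_nil.
have tl t' : t' \in l -> div_eq (F t') (H t') by move=> t'l; apply: FH; rewrite inE t'l orbT.
have [P [tP E]] := div_eqD (FH t (mem_head _ _)) (IH tl).
by exists P; split=> // z Uz; rewrite !big_cons E.
Qed.

Lemma tau_invariant_iterd L F : tau_invariant A U F ->
  tau_invariant A U (iterd tder (xmi 0 L) F).
Proof.
move=> tF; have fF := fsm_taulin Uopen (proj1 tF).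
elim/(@mi_ind 'I_p): L => [|L i IH]; first by rewrite xmi0 iterd0.
apply: (tau_invariant_ext Udom _ (tau_invariant_tder Uopen Udom i IH)) => z Uz.
by rewrite xmi_succ (iterd_tder_succ oUtau _ _ fF).
Qed.

(** One derivative at a time: the induction hypothesis is applied to [D_i F] in place of [F], and
    the product rule then moves the last [D_i]. *)
Lemma integration_by_parts L f F : dinv f -> tau_invariant A U F ->
  div_eq (fun z => f (res z) * iterd tder (xmi 0 L) F z)
         (fun z => (-1) ^+ msize L * iterd tder L f (res z) * F z).
Proof.
elim/(@mi_ind 'I_p): L f F => [|L i IH] f F df tF.
  apply: div_eq_ext => z Uz; rewrite xmi0 !iterd0 /msize big1 ?expr0 ?mul1r // => j _.
  by rewrite ffunE.
have fF := fsm_taulin Uopen (proj1 tF); have /(diff_invariantP A Uopen)[ff _] := df.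
have dLf := dinv_iterd Uopen Udom L df; have fLf := fsm_iterd L ff.
have tDF := tau_invariant_tder Uopen Udom i tF.
apply: (@div_eq_trans _ (fun z => f (res z) * iterd tder (xmi 0 L) (tder (Some i) F) z)).
  by apply: div_eq_ext => z Uz; rewrite xmi_succ (iterd_tder_succr oUtau _ _ fF).
apply: div_eq_trans (IH f _ df tDF) _.
pose c w := (-1) ^+ msize L * iterd tder L f w.
have dc : dinv c by apply: (dinvM Uopen) => //; exact: (@dinv_cst _ _ _ _ _ A n U Uopen).
have /(diff_invariantP A Uopen)[fc _] := dc.
have tQ := tau_invariantM Uopen Udom dc tF.
(* With [c] the coefficient reached so far, [c * D_i F] equals [- D_i c * F] plus [D_i (c * F)], so
   the divergence has a single component, in direction [i]. *)
exists (fun k z => if k == i then c (res z) * F z else 0); split=> [k|z Uz].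
  by case: eqP => _; [exact: tQ|exact: tau_invariant0].
rewrite (bigD1 i) //= big1 ?addr0 => [|k /negbTE ki]; last first.
  by rewrite ki (tderE _ (fsm_cst _ oUtau)) // diff_at_cst.
rewrite eqxx (tderM _ (fsm_comp_res fc) fF) // (tder_res_Some _ fc) //.
rewrite /c (tderM _ (fsm_cst _ oU) fLf) // (tderE _ (fsm_cst _ oU)) // diff_at_cst.
rewrite mul0r add0r -(iterd_tder_succ oU _ _ ff) // msize_succ exprS.
by rewrite addrA mulN1r !mulNr addNr add0r.
Qed.

Variables (N : nat) (kap : 'I_N -> J -> R).
Hypothesis dkap : forall j, dinv (kap j).

Lemma fsm_kjet c : fsm U (kjet kap ^~ c).
Proof.
case: c => [i|[j L]]; first exact: fsm_coord.
by have /(diff_invariantP A Uopen)[] := dinv_iterd Uopen Udom L (dkap j).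
Qed.

Lemma kjet_pact g z : U z -> U (pact A g z) -> kjet kap (pact A g z) = kjet kap z.
Proof.
move=> Uz Ugz; apply/funext => -[i|[j L]] //.
by have /(diff_invariantP A Uopen)[_] := dinv_iterd Uopen Udom L (dkap j); apply.
Qed.

Lemma dinv_comp_kjet V (F : jet R 'I_p N -> R) : fsm V F -> (forall z, U z -> V (kjet kap z)) ->
  dinv (F \o kjet kap).
Proof.
move=> fF UV; apply/(diff_invariantP A Uopen); split; first exact: fsm_comp fF fsm_kjet oU UV.
by move=> g z Uz Ugz; rewrite /= kjet_pact.
Qed.

Lemma iterd_zero L f z : (forall w, U w -> f w = 0) -> U z -> iterd tder L f z = 0.
Proof.
move=> f0 Uz; have H : {in U, f =1 fun=> 0} by move=> w; rewrite inE; exact: f0.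
rewrite (iterd_tder_ext oU L H (mem_set Uz)).
elim/(@mi_ind 'I_p): L z Uz => [|L i IH] z Uz; first by rewrite iterd0.
rewrite (iterd_tder_succ oU _ _ (fsm_cst _ oU)) //.
have H0 : {in U, iterd tder L (fun=> 0) =1 (fun _ : J => 0 : R)}.
  by move=> w; rewrite inE; exact: IH.
by rewrite (tder_ext i oU H0 (mem_set Uz)) (tderE _ (fsm_cst _ oU)) // diff_at_cst.
Qed.

Variables (h : 'I_N -> 'I_q -> mi 'I_p -> J -> R) (Lag : jet R 'I_p N -> R).
Hypothesis hP : syzygies A U rho kap h.
Hypothesis LP : lagrangian U kap Lag.

(** The index set of a Lagrangian contains no [x], so partial derivatives along [x] vanish as well
    as those of order above [m]. *)
Lemma lagrangian_fsm : exists m V, [/\ fsm V Lag, (forall z, U z -> V (kjet kap z)) &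
  forall z c, V z -> (if c is inr k then m < msize k.2 else true)%N -> pder c Lag z = 0].
Proof.
have [m [V]] := LP; set S := [set c | _] => -[oV sL UV]; exists m, V.
have fS : finite_set S.
  by apply: sub_finite_set (finite_ord_le m) => -[].
split=> //; first exact: fsm_fin fS oV sL.
move=> z c Vz cS; apply: (pder_agree (S := S) oV Vz) => [w Vw zw|].
  exact: (esym (smooth_depends sL Vz Vw zw)).
case: c cS => [i _|k mk] /=; first by [].
by rewrite leqNgt mk.
Qed.

Lemma tder_None_iterd L j z : U (res z) ->
  tder None (iterd tder L (kap j) \o res) z =
  iterd tder (xmi 0 L) (tder None (kap j \o res)) z.
Proof.
move=> Uz; have /(diff_invariantP A Uopen)[fk _] := dkap j.
have fkr := fsm_comp_res fk.
have H : {in Utau, iterd tder L (kap j) \o res =1 iterd tder (xmi 0 L) (kap j \o res)}.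
  by move=> w; rewrite inE => Uw; rewrite (iterd_res _ fk).
rewrite (tder_ext None oUtau H (mem_set (Uz : Utau z))).
by rewrite -(iterd_tder_succ oUtau _ _ fkr) // (iterd_tder_succr oUtau _ _ fkr).
Qed.

Lemma variation_div_eq :
  div_eq (tder None (Lag \o kjet kap \o res))
         (fun z => \sum_al euler kap h Lag al (res z) * Itau A rho al mi0 z).
Proof.
have [m [V [fL UV L0]]] := lagrangian_fsm; have [dh [mh h0] hE] := hP.
have [s [sP sE]] := sum_mi R 'I_p m; have [t [tP tE]] := sum_mi R 'I_p mh.
have /(diff_invariantP A Uopen)[fLK _] := dinv_comp_kjet fL UV.
pose dL j L := pder (inr (j, L)) Lag \o kjet kap.
have ddL j L : dinv (dL j L) by apply: dinv_comp_kjet (fsm_pder _ fL) UV.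
(* The right-hand side of the syzygy with its sum made finite: it stands for the tau-derivative of
   [kap j] and, unlike the latter, is visibly invariant and linear. *)
pose Q j (z : Jtau) := \sum_al \sum_(M <- t)
  h j al M (res z) * iterd tder (xmi 0 M) (Itau A rho al mi0) z.
have tI al := tau_invariant_Itau Uopen Udom rhoP al mi0.
have tQ j : tau_invariant A U (Q j).
  apply: (tau_invariant_sum (A := A) (U := U)) => al _ /=.
  apply: (tau_invariant_sum (A := A) (U := U)) => M _.
  by apply: (tau_invariantM Uopen Udom) => //; exact: tau_invariant_iterd.
have QE j : {in Utau, tder None (kap j \o res) =1 Q j}.
  move=> z; rewrite inE => Uz; rewrite hE //; apply: eq_bigr => al _.
  by rewrite tE // => M mM; rewrite h0 ?mul0r.
have EkE j z : U z -> euler_kap kap Lag j z =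
    \sum_(L <- s) (-1) ^+ msize L * iterd tder L (dL j L) z.
  move=> Uz; rewrite /euler_kap sE // => L mL; rewrite iterd_zero ?mulr0 // => w Uw.
  by apply: L0 => //; exact: UV.
have dEk j : dinv (euler_kap kap Lag j).
  apply: (@dinv_ext _ _ _ _ _ A n U Uopen
    (fun z => \sum_(L <- s) (-1) ^+ msize L * iterd tder L (dL j L) z)).
    by move=> z; rewrite inE => Uz; rewrite EkE.
  apply: (dinv_sum Uopen) => L _; apply: (dinvM Uopen).
    exact: (@dinv_cst _ _ _ _ _ A n U Uopen).
  exact: (dinv_iterd Uopen Udom L (ddL j L)).
apply: (@div_eq_trans _ (fun z => \sum_j \sum_(L <- s)
    dL j L (res z) * iterd tder (xmi 0 L) (Q j) z)).
  apply: div_eq_ext => z Uz; have Uz' : Utau z by [].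
  rewrite (tder_res_None fLK) // (diff_at_comp fL fsm_kjet) //; last exact: UV.
  (* Dropping the [x]-components makes [diff_at_vertical] applicable; they contribute nothing
     because [Lag] has no explicit dependence on [x]. *)
  pose w : coord 'I_p N -> R := fun c => if c is inr k then
    diff_at (kjet kap ^~ c) (res z) (tau_vec z) else 0.
  transitivity (diff_at Lag (kjet kap (res z)) w).
    apply: eq_fsbigr => -[i|k] _ //=.
    by rewrite (L0 _ (inl i)) ?mul0r //; exact: UV.
  have [s' [us' sP']] := finite_mi 'I_p m.
  have -> : diff_at Lag (kjet kap (res z)) w =
      \sum_j \sum_(L <- s) dL j L (res z) * w (inr (j, L)).
    rewrite (diff_at_vertical us' sP') // => [|j L mL]; last by apply: L0 => //; exact: UV.
    apply: eq_bigr => j _; rewrite -sE => [|L mL]; last first.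
      by rewrite /dL /= (L0 _ (inr (j, L))) ?mul0r //; exact: UV.
    by rewrite (sum_fsT us') // => L; rewrite sP' -ltnNge => mL;
      rewrite /dL /= (L0 _ (inr (j, L))) ?mul0r //; exact: UV.
  apply: eq_bigr => j _; apply: eq_bigr => L _; congr (_ * _).
  have /(diff_invariantP A Uopen)[fkL _] := dinv_iterd Uopen Udom L (dkap j).
  rewrite /w /= -(tder_res_None fkL) // tder_None_iterd //.
  exact: (iterd_tder_ext oUtau (xmi 0 L) (QE j) (mem_set Uz')).
(* First integration by parts: [D_L] leaves the variation of [kap j]. *)
apply: (@div_eq_trans _ (fun z => \sum_j \sum_(L <- s)
    (-1) ^+ msize L * iterd tder L (dL j L) (res z) * Q j z)).
  by apply: div_eq_sum => j _; apply: div_eq_sum => L _; exact: integration_by_parts.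
(* Summed over [L], the coefficients of [Q j] form [E^j(L)]. *)
apply: (@div_eq_trans _ (fun z => \sum_j \sum_al \sum_(M <- t)
    (h j al M (res z) * euler_kap kap Lag j (res z)) *
      iterd tder (xmi 0 M) (Itau A rho al mi0) z)).
  apply: div_eq_ext => z Uz; apply: eq_bigr => j _.
  rewrite -mulr_suml -EkE // /Q mulr_sumr; apply: eq_bigr => al _.
  by rewrite mulr_sumr; apply: eq_bigr => M _; rewrite mulrCA mulrA.
(* Second integration by parts: the operators of the syzygies leave [I_tau] and act by their
   adjoints. *)
apply: (@div_eq_trans _ (fun z => \sum_j \sum_al \sum_(M <- t)
    (-1) ^+ msize M * iterd tder M (fun w => h j al M w * euler_kap kap Lag j w) (res z) *
      Itau A rho al mi0 z)).
  apply: div_eq_sum => j _; apply: div_eq_sum => al _; apply: div_eq_sum => M _.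
  apply: (@integration_by_parts M (fun w => h j al M w * euler_kap kap Lag j w)) => //.
  exact: (dinvM Uopen (dh j al M) (dEk j)).
apply: div_eq_ext => z Uz; rewrite exchange_big /=; apply: eq_bigr => al _.
rewrite /euler mulr_suml; apply: eq_bigr => j _.
rewrite tE => [|M mM]; first by rewrite mulr_suml.
by rewrite iterd_zero ?mulr0 // => w Uw; rewrite h0 ?mul0r.
Qed.

Lemma by_parts_exists : exists C, by_parts A U rho kap h Lag C.
Proof.
have [P [tP PE]] := variation_div_eq.
have [C HC] := choice (fun i => tau_invariant_decomposition Uopen Udom KU rhoP (tP i)).
have [m Hm] := choice HC.
exists C; split.
- by move=> i; have [] := Hm i.
(* Each [P i] has its own order, and a common bound is required. *)
- exists (\max_i m i)%N => i al L z mL; have [_ H _] := Hm i; apply: H.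
  by apply: leq_ltn_trans mL; exact: (leq_bigmax i).
- move=> z Uz; rewrite PE //; congr (_ + _); apply: eq_bigr => i _.
  apply: (tder_ext _ oUtau); last by rewrite inE.
  by move=> w; rewrite inE => Uw; have [_ _ ->] := Hm i.
Qed.

End IntegrationByParts.
End ConservationLaws.

(** * Differentiation under the integral sign *)

Section ParametricIntegral.
Context {R : realType}.
Local Notation mu := (@lebesgue_measure R).
Implicit Types (a b : R) (f g : R -> R).

Definition itv_cont a b f : Prop := forall t, a <= t <= b -> forall e : R, 0 < e ->
  exists2 d : R, 0 < d & forall t', a <= t' <= b -> `|t' - t| < d -> `|f t' - f t| < e.

Lemma itv_cont_integrable a b f : itv_cont a b f -> mu.-integrable `[a, b] (EFin \o f).
Proof.
move=> cf; apply: continuous_compact_integrable; first exact: segment_compact.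
apply/subspace_continuousP => t tab.
have tab' : a <= t <= b by move: tab; rewrite /= in_itv.
apply/cvgrPdist_lt => e e0; have [d d0 H] := cf t tab' e e0.
exists d => //= t' /= td t'ab; rewrite distrC; apply: H; last by rewrite distrC.
by move: t'ab; rewrite /= in_itv.
Qed.

Lemma Rintegral_close a b f g e : a <= b ->
  mu.-integrable `[a, b] (EFin \o f) -> mu.-integrable `[a, b] (EFin \o g) ->
  (forall t, a <= t <= b -> `|f t - g t| <= e) ->
  `|Rintegral mu `[a, b] f - Rintegral mu `[a, b] g| <= e * (b - a).
Proof.
move=> ab fi gi fg.
have mI : measurable (`[a, b] : set (measurableTypeR R)) by exact: measurable_itv.
rewrite -RintegralB //.
have i1 : mu.-integrable `[a, b] (EFin \o (fun t => f t - g t)).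
  rewrite (_ : EFin \o _ = (EFin \o f) \- (EFin \o g))%E; last exact/funext.
  exact: integrableB.
apply: le_trans (le_normr_Rintegral mI i1) _.
have i2 : mu.-integrable `[a, b] (EFin \o (fun t => `|f t - g t|)).
  by have := integrable_norm i1.
have i3 : mu.-integrable `[a, b] (EFin \o cst e).
  apply: itv_cont_integrable => t _ x x0; exists 1 => // *.
  by rewrite subrr normr0.
have H : Rintegral mu `[a, b] (fun t => `|f t - g t|) <= Rintegral mu `[a, b] (cst e).
  by apply: le_Rintegral => // t; rewrite /= in_itv; exact: fg.
apply: le_trans H _; rewrite Rintegral_cst //.
have -> : fine (mu `[a, b]) = b - a.
  rewrite lebesgue_measure_itv /= lte_fin; case: ltgtP ab => // -> _.
  by rewrite subrr.
by [].
Qed.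

Section Family.
Context {I : choiceType}.
Variables (D D' : set (I -> R)) (c : I) (a b : R).
Hypothesis ab : a <= b.
Hypothesis DD : forall y t, D y -> a <= t <= b -> D' (upd y c t).
Implicit Types F : (I -> R) -> R.

Lemma near_in_upd2 (d : R) y y' t t' : near_in setT d y y' -> `|t' - t| < d ->
  near_in setT d (upd y c t) (upd y' c t').
Proof. by move=> yy tt x _; rewrite /upd; case: eqP => _ //; exact: yy. Qed.

Lemma slice_itv_cont F y : cont_in setT D' F -> D y -> itv_cont a b (fun t => F (upd y c t)).
Proof.
move=> cF Dy t tab e e0; have [d d0 H] := cF _ (DD Dy tab) e e0.
exists d => // t' t'ab td; apply: H; first exact: DD.
by apply: near_in_upd2 => //; exact: near_in_refl.
Qed.

(** Continuity at each point of the segment gives a radius depending on [t]; compactness of the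
    segment makes it uniform. Half of [e] is spent on each of the comparisons of [F (upd y' c t')]
    and [F (upd y c t')] with the centre. *)
Lemma tube F y e : cont_in setT D' F -> D y -> 0 < e -> exists2 d : R, 0 < d &
  forall y' t, D y' -> near_in setT d y y' -> a <= t <= b ->
    `|F (upd y' c t) - F (upd y c t)| < e.
Proof.
move=> cF Dy e0; have e20 : 0 < e / 2 by rewrite divr_gt0.
have /compact_near_coveringP cov := @segment_compact R a b.
pose P (d t : R) := a <= t <= b -> forall y', D y' -> near_in setT d y y' ->
    `|F (upd y' c t) - F (upd y c t)| < e.
have [|d d0 H] := cov R (0^'+) P _.
  move=> t; rewrite /= in_itv /= => tab; have [d d0 H] := cF _ (DD Dy tab) _ e20.
  exists (ball t d, [set x | 0 < x < d]); first split => /=.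
  - exact: nbhsx_ballx.
  - by exists d => //= x; rewrite /ball_ /= sub0r normrN => + x0; rewrite gtr0_norm // x0.
  move=> [t' x] /= [tt /andP[x0 xd]] t'ab y' Dy' yy'.
  have tt' : `|t' - t| < d by rewrite distrC.
  have H1 : `|F (upd y' c t') - F (upd y c t)| < e / 2.
    apply: H; first exact: DD.
    by apply: near_in_upd2 tt'; apply: near_in_sub yy' => //; exact: ltW.
  have H2 : `|F (upd y c t') - F (upd y c t)| < e / 2.
    apply: H; first exact: DD.
    by apply: near_in_upd2 tt'; exact: near_in_refl.
  rewrite -(subrK (F (upd y c t)) (F (upd y' c t'))) -addrA (splitr e).
  apply: le_lt_trans (ler_normD _ _) _; apply: ltrD H1 _.
  by rewrite distrC.
have d20 : 0 < d / 2 by rewrite divr_gt0.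
exists (d / 2) => // y' t Dy' yy' tab.
have := H (d / 2); rewrite /ball_ /= sub0r normrN gtr0_norm // => H'.
have d2d : d / 2 < d by rewrite [X in _ < X](splitr d) ltrDl.
by apply: (H' d2d d20 t) => //; rewrite /= in_itv.
Qed.

Lemma cont_in_Rintegral F : cont_in setT D' F ->
  cont_in setT D (fun y => Rintegral mu `[a, b] (fun t => F (upd y c t))).
Proof.
move=> cF y Dy e e0.
have e'0 : 0 < e / (b - a + 1) by rewrite divr_gt0 // ltr_wpDl ?subr_ge0.
have [d d0 H] := tube cF Dy e'0; exists d => // y' Dy' yy'.
have := @Rintegral_close a b (fun t => F (upd y' c t)) (fun t => F (upd y c t)) _ ab
  (itv_cont_integrable (slice_itv_cont cF Dy')) (itv_cont_integrable (slice_itv_cont cF Dy))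
  (fun t tab => ltW (H y' t Dy' yy' tab)).
move=> /le_lt_trans; apply; rewrite mulrAC ltr_pdivrMr ?ltr_wpDl ?subr_ge0 //.
by rewrite ltr_pM2l // ltrDl.
Qed.

(** The mean value theorem turns the difference quotient into [F'] at a point that depends on [t];
    the uniform radius of [tube] then bounds the error for all [t] at once. *)
Lemma is_derive_Rintegral F F' d0 y eps : d0 != c ->
  cont_in setT D' F -> cont_in setT D' F' -> D y -> 0 < eps ->
  (forall s, `|s - y d0| < eps -> D (upd y d0 s)) ->
  (forall y', D' y' -> is_derive (y' d0) 1 (fun s => F (upd y' d0 s)) (F' y')) ->
  is_derive (y d0) 1
    (fun s => Rintegral mu `[a, b] (fun t => F (upd (upd y d0 s) c t)))
    (Rintegral mu `[a, b] (fun t => F' (upd y c t))).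
Proof.
move=> dc cF cF' Dy eps0 Ds dF; apply/is_derive_epsP => e e0.
have ba0 : 0 < b - a + 1 by rewrite ltr_wpDl ?subr_ge0.
have e'0 : 0 < e / (b - a + 1) by rewrite divr_gt0.
have [d dp H] := tube cF' Dy e'0.
exists (Num.min d eps); first by rewrite lt_min dp.
move=> s; rewrite lt_min => /andP[sd se]; set k := s - y d0.
have mI : measurable (`[a, b] : set (measurableTypeR R)) by exact: measurable_itv.
have iF y' : D y' -> mu.-integrable `[a, b] (EFin \o (fun t => F (upd y' c t))).
  by move=> Dy'; apply: itv_cont_integrable; exact: slice_itv_cont.
have iF' : mu.-integrable `[a, b] (EFin \o (fun t => F' (upd y c t))).
  by apply: itv_cont_integrable; exact: slice_itv_cont.
have Dsy := Ds s se; rewrite upd_id.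
rewrite -RintegralB ?iF // mulrC -RintegralZl //.
have i1 : mu.-integrable `[a, b] (EFin \o (fun t => F (upd (upd y d0 s) c t) - F (upd y c t))).
  rewrite (_ : EFin \o _ = (EFin \o (fun t => F (upd (upd y d0 s) c t))) \-
    (EFin \o (fun t => F (upd y c t))))%E; last exact/funext.
  by apply: integrableB => //; exact: iF.
have i2 : mu.-integrable `[a, b] (EFin \o (fun t => k * F' (upd y c t))).
  rewrite (_ : EFin \o _ = (fun t => k%:E * (EFin \o (fun t => F' (upd y c t))) t))%E.
    exact: integrableZl.
  exact/funext.
apply: le_trans (Rintegral_close ab i1 i2 (e := e / (b - a + 1) * `|k|) _) _; last first.
  rewrite mulrAC ler_wpM2r // mulrAC ler_pdivrMr // ler_wpM2l ?(ltW e0) //.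
  by rewrite lerDl.
move=> t tab.
have [x xk E] : exists2 x, `|x - y d0| <= `|s - y d0| &
    F (upd (upd y d0 s) c t) - F (upd (upd y d0 (y d0)) c t) =
    F' (upd (upd y d0 x) c t) * (s - y d0).
  apply: (@mean_value R (fun x => F (upd (upd y d0 x) c t))
    (fun x => F' (upd (upd y d0 x) c t))) => x xs.
  have Dx : D (upd y d0 x) by apply: Ds; exact: le_lt_trans xs se.
  have := dF _ (DD Dx tab); rewrite (upd_neq _ _ dc) upd_eq.
  rewrite (_ : (fun s => _) = (fun x => F (upd (upd y d0 x) c t))) //.
  by apply/funext => z; rewrite -(updC _ _ _ dc) upd_upd.
rewrite upd_id in E; rewrite E -/k [k * _]mulrC -mulrBl normrM ler_wpM2r // ltW //.
apply: H => //; first by apply: Ds; exact: le_lt_trans xk se.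
by apply: near_in_upd => //; exact: le_lt_trans xk sd.
Qed.

End Family.
End ParametricIntegral.

Section BoxIntegral.
Context {R : realType} {p : nat}.
Local Notation mu := (@lebesgue_measure R).
Variables (a b : 'I_p -> R).
Hypothesis ab : forall i, a i <= b i.

(** The integral of [box_int] with tau kept among the coordinates, so that continuity and
    differentiability in tau can be carried through the list of integrations. *)
Definition iter_int (s : seq 'I_p) (H : (option 'I_p -> R) -> R) :
  (option 'I_p -> R) -> R :=
  foldr (fun i Gi y => Rintegral mu `[a i, b i] (fun t => Gi (upd y (Some i) t))) H s.

Lemma upd_xtau (x : 'I_p -> R) i t tau :
  xtau (upd x i t) tau = upd (xtau x tau) (Some i) t.
Proof. by apply/funext => -[j|] //=; rewrite /upd (inj_eq Some_inj). Qed.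

Lemma upd_xtau_None (x : 'I_p -> R) tau s : upd (xtau x tau) None s = xtau x s.
Proof. by apply/funext => -[j|]. Qed.

Lemma xtau_eta (y : option 'I_p -> R) : xtau (y \o Some) (y None) = y.
Proof. by apply/funext => -[j|]. Qed.

Lemma box_int_iter_int H tau : box_int a b (fun x => H (xtau x tau)) =
  iter_int (enum 'I_p) H (xtau (fun=> 0) tau).
Proof.
rewrite /box_int /iter_int; move: (fun=> 0); elim: (enum 'I_p) => //= i s IH x.
by congr (Rintegral _ _ _); apply/funext => t; rewrite IH upd_xtau.
Qed.

Lemma eq_box_int (F F' : ('I_p -> R) -> R) :
  (forall x, (forall i, a i <= x i <= b i) -> F x = F' x) -> box_int a b F = box_int a b F'.
Proof.
move=> FF; rewrite /box_int.
suff H (s : seq 'I_p) x : (forall i, i \notin s -> a i <= x i <= b i) ->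
    foldr (fun i (Gi : ('I_p -> R) -> R) x =>
      Rintegral lebesgue_measure `[a i, b i] (fun t : R => Gi (upd x i t))) F s x =
    foldr (fun i (Gi : ('I_p -> R) -> R) x =>
      Rintegral lebesgue_measure `[a i, b i] (fun t : R => Gi (upd x i t))) F' s x.
  by apply: H => i; rewrite mem_enum.
elim: s x => [|i s IH] x H /=; first by apply: FF => i; exact: H.
apply: eq_Rintegral => t; rewrite inE /= in_itv /= => tab; apply: IH => j js.
rewrite /upd; case: eqP => [->|/eqP ji] //; apply: H.
by rewrite inE negb_or ji.
Qed.

Variables (tau0 eps : R).

(** The coordinates in [s] are already integrated out and therefore unconstrained. *)
Definition box_tau (s : seq 'I_p) : set (option 'I_p -> R) :=
  [set y | (forall i, i \notin s -> a i <= y (Some i) <= b i) /\ `|y None - tau0| < eps].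

Lemma derive_iter_int (H H' : (option 'I_p -> R) -> R) (s : seq 'I_p) :
  cont_in setT (box_tau [::]) H -> cont_in setT (box_tau [::]) H' ->
  (forall y, box_tau [::] y -> is_derive (y None) 1 (fun t => H (upd y None t)) (H' y)) ->
  [/\ cont_in setT (box_tau s) (iter_int s H), cont_in setT (box_tau s) (iter_int s H') &
    forall y, box_tau s y ->
      is_derive (y None) 1 (fun t => iter_int s H (upd y None t)) (iter_int s H' y)].
Proof.
move=> cH cH' dH; elim: s => [|i s [cI cI' dI]]; first by split.
have DD y t : box_tau (i :: s) y -> a i <= t <= b i -> box_tau s (upd y (Some i) t).
  move=> [yab yt] tab; split=> // j js; rewrite /upd (inj_eq Some_inj).
  by case: eqP => [->|/eqP ji] //; apply: yab; rewrite inE negb_or ji.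
split; [exact: (cont_in_Rintegral (ab i) DD cI)|exact: (cont_in_Rintegral (ab i) DD cI')|].
move=> y Dy; have [yab yt] := Dy.
(* The room left around [y None] within the interval of radius [eps] about [tau0]. *)
apply: (is_derive_Rintegral (eps := eps - `|y None - tau0|) (ab i) DD _ cI cI' Dy) => //.
  by rewrite subr_gt0.
move=> t ty; split=> [j|]; first exact: yab.
rewrite upd_eq -(subrK (y None) t) -addrA.
by apply: le_lt_trans (ler_normD _ _) _; rewrite -ltrBrDr.
Qed.

End BoxIntegral.

(** * The variation formula on boxes *)

Section Variation.
Context {R : realType} {r p q : nat} {G : lieGroup R r} (A : smooth_action G p q).
Local Notation J := (jet R 'I_p q).
Local Notation Jtau := (jet R (option 'I_p) q).
Variables (n : nat) (U : set J) (rho : J -> G).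
Hypothesis Uopen : open_in (ord_le n) U.
Hypothesis Udom : forall z, U z -> jdom A z.
Variables (N : nat) (kap : 'I_N -> J -> R).
Hypothesis dkap : forall j, diff_invariant A U (kap j).
Variables (h : 'I_N -> 'I_q -> mi 'I_p -> J -> R) (Lag : jet R 'I_p N -> R).
Hypothesis LP : lagrangian U kap Lag.

(** Along a section, the tau-derivative of the integrand is its total tau-derivative at the jet,
    which [by_parts] rewrites; the rest is differentiation under the integral. *)
Lemma variation_formula_by_parts C :
  by_parts A U rho kap h Lag C -> variation_formula A U rho kap h Lag C.
Proof.
move=> [_ _ CE] W u a b tau0 eps oW su uU eps0 ab abW.
have [m [V [fL UV L0]]] := lagrangian_fsm LP.
have /(diff_invariantP A Uopen)[fF _] := dinv_comp_kjet Uopen Udom dkap fL UV.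
have fT : finite_set [set: option 'I_p] by exact: finite_finset.
have foW := fopen_fin fT oW.
have fu al : fsm W (u al) by exact: fsm_fin fT oW (su al).
have fFr := fsm_comp_res fF; have fj := fsm_jsec foW fu.
pose H y := Lag (kjet kap (res (jsec u y))).
have fH : fsm W H by exact: (fsm_comp fFr fj foW uU).
have HE y : W y -> pder None H y = \sum_al euler kap h Lag al (res (jsec u y)) *
    Itau A rho al mi0 (jsec u y) + \sum_i tder (Some i) (Pdiv A rho C i) (jsec u y).
  by move=> Wy; rewrite -CE ?(pder_jsec foW fu None fFr Wy) //; exact: uU.
have DW : box_tau a b tau0 eps [::] `<=` W.
  by move=> y [yab yt]; rewrite -(xtau_eta y); apply: abW yt => i; exact: yab.
have cont F : fsm W F -> cont_in setT (box_tau a b tau0 eps [::]) F.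
  by move=> [s [_ _ CF]]; apply: cont_in_sub DW (Ck_cont (CF 0)).
have [_ _ D] := derive_iter_int ab (enum 'I_p) (cont _ fH) (cont _ (fsm_pder None fH))
  (fun y Dy => fsm_is_derive None fH (DW y Dy)).
have B0 : box_tau a b tau0 eps (enum 'I_p) (xtau (fun=> 0) tau0).
  by split=> [i|] /=; [rewrite mem_enum|rewrite subrr normr0].
have E1 : (fun t => iter_int a b (enum 'I_p) H (upd (xtau (fun=> 0) tau0) None t)) =
    (fun tau => box_int a b (fun x => H (xtau x tau))).
  by apply/funext => t; rewrite upd_xtau_None -box_int_iter_int.
have E2 : iter_int a b (enum 'I_p) (pder None H) (xtau (fun=> 0) tau0) =
    box_int a b (fun x => let z := jsec u (xtau x tau0) in
      \sum_al euler kap h Lag al (res z) * Itau A rho al mi0 z +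
      \sum_i tder (Some i) (Pdiv A rho C i) z).
  rewrite -box_int_iter_int; apply: eq_box_int => x xab.
  by apply: HE; apply: abW => //; rewrite subrr normr0.
by have := D _ B0; rewrite E1 E2.
Qed.

End Variation.

Theorem theorem3p1 (R : realType) (p q r n N : nat)
    (G : lieGroup R r) (A : smooth_action G p q)
    (e : nat) (he : cdom (atlas G e) 1%g)
    (U : set (jet R 'I_p q)) (Uopen : open_in (ord_le n) U)
    (Udom : forall z, U z -> adom A (base z))
    (Ufree : free_on A n U) (Uorb : orbits_dim A e n U)
    (K : set (jet R 'I_p q)) (Kcs : cross_section A e n U K)
    (rho : jet R 'I_p q -> G) (rhoP : right_moving_frame A n U K rho)
    (kidx : 'I_N -> 'I_q * mi 'I_p)
    (kapP : generating A U (kappa A rho kidx))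
    (h : 'I_N -> 'I_q -> mi 'I_p -> jet R 'I_p q -> R)
    (hP : syzygies A U rho (kappa A rho kidx) h)
    (L : jet R 'I_p N -> R) (LP : lagrangian U (kappa A rho kidx) L)
    (Ad : G -> 'M[R]_r) (AdP : adjoint_matrix A e n Ad) :
  (exists C, by_parts A U rho (kappa A rho kidx) h L C) /\
  forall C, by_parts A U rho (kappa A rho kidx) h L C ->
    let law (i : 'I_p) (z : jet R 'I_p q) : 'cV[R]_r :=
      invmx (Ad (rho z)) *m upsilon A e rho C i z in
    [/\ variation_formula A U rho (kappa A rho kidx) h L C,
        forall z, U z -> Ad (rho z) \in unitmx,
        (* the j-th conservation law is the j-th row of the vector equation *)
        forall (j : 'I_r) (z : jet R 'I_p q), U z ->
          (forall i, Pdiv A rho C i (var_jet A e j z) = law i z j 0) /\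
          \sum_i tder (Some i) (Pdiv A rho C i) (var_jet A e j z) =
          \sum_i tder i (fun w => law i w j 0) z &
        (* the vector equation holds on solutions *)
        forall (V : set ('I_p -> R)) (u : 'I_q -> ('I_p -> R) -> R),
          open_in setT V -> (forall al, smooth_on setT V (u al)) ->
          (forall x, V x -> U (jsec u x)) ->
          (forall x al, V x -> euler (kappa A rho kidx) h L al (jsec u x) = 0) ->
          forall x j, V x ->
            \sum_i tder i (fun w => law i w j 0) (jsec u x) = 0].
Proof.
have KU : K `<=` U by case: Kcs.
have dkap j : diff_invariant A U (kappa A rho kidx j).
  exact: (dinv_kappa Uopen Udom rhoP).
have AdU z : U z -> Ad (rho z) \in unitmx.
  move=> Uz; apply: (adjoint_unit he AdP Uorb (Udom z Uz)).
  exact: (U_inv_jet KU rhoP Uz).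
split; first exact: (by_parts_exists Uopen Udom KU rhoP dkap hP LP).
move=> C CP law; have [dC [m C0] CE] := CP.
have lawE j z : U z ->
    \sum_i tder (Some i) (Pdiv A rho C i) (var_jet A e j z) =
    \sum_i tder i (fun w => law i w j 0) z.
  by move=> Uz; apply: eq_bigr => i _; exact: (tder_law Uopen Udom rhoP he dC C0 AdP AdU).
split=> //.
- exact: (variation_formula_by_parts Uopen Udom dkap LP CP).
- move=> j z Uz; split; last exact: lawE.
  by move=> i; exact: (Pdiv_var_jet Udom he C0 AdP AdU).
move=> V u oV su uU Eu x j Vx; have Uz := uU x Vx.
rewrite -lawE //.
(* The pointwise identity is evaluated at the variation jet: on a solution the Euler terms drop out,
   and the divergence equals the tau-derivative of the Lagrangian, that is, its derivative along
   [v_j]. *)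
have := CE (var_jet A e j (jsec u x)); rewrite res_var_jet => /(_ Uz).
rewrite big1 ?add0r => [<-|al _]; last by rewrite Eu ?mul0r.
have [m' [V' [fL UV L0]]] := lagrangian_fsm LP.
have dF := dinv_comp_kjet Uopen Udom dkap fL UV.
have /(diff_invariantP A Uopen)[fF _] := dF.
rewrite (tder_res_None fF) ?res_var_jet // tau_vec_var_jet.
exact: (dinv_zeta Uopen Udom he j dF Uz).
Qed.
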